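(* Let $0<h<1$, let $B=(B_t)_{t\in\mathbb{R}}$ be a fractional Brownian motion with index $h$, i.e. $\operatorname{Var}(B_t)=|t|^{2h}$, and let $\xi_B$ be the stationary point process on $\mathbb{R}$ with intensity $1$ whose Palm distribution is $\{n+B_n : n\in\mathbb{Z}\}$ (that is, the case $\hat\xi=\mathbb{Z}$). Then its structure factor satisfies $$s_{\xi_B}(t)\underset{t\to 0}{\sim}\alpha_h|t|^{1-2h},\qquad \alpha_h=2h\,\Gamma(2h)\sin(\pi h).$$ In particular, $\xi_B$ is hyperuniform if and only if $h<1/2$.
   Context: A fractional Brownian motion with index $h$ is a centered real Gaussian process on $\mathbb{R}$ with $B_0=0$, stationary increments and $\operatorname{Var}(B_t)=|t|^{2h}$. A point process on $\mathbb{R}$ is a random locally finite set of points, identified with the corresponding counting measure; $\tau_t\xi=\{x-t:x\in\xi\}$; it is stationary if its law is invariant under all $\tau_t$. The Palm distribution $\hat\xi$ of a stationary point process $\xi$ of intensity $\lambda_\xi=\mathbb{E}[\xi([0,1])]\in(0,\infty)$ is characterized by $\mathbb{E}[\int f(\tau_t\xi,t)\,\xi(\mathrm{d}t)]=\lambda_\xi\mathbb{E}[\int f(\hat\xi,t)\,\mathrm{d}t]$ for nonnegative measurable $f$. The process $\{n+B_n:n\in\mathbb{Z}\}$ is the Palm distribution of a stationary ergodic point process $\xi_B$ with intensity $1$ and finite second moment. The Bartlett spectrum of a stationary point process $\xi$ with finite second moment is the Fourier transform (with $\hat\varphi(t)=\int\varphi(x)e^{-itx}\mathrm{d}x$, and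 $\int\varphi\,\mathrm{d}\mathcal{S}_\xi=\mathcal{C}_\xi(\hat\varphi)$ for Schwartz $\varphi$) of the tempered distribution $\mathcal{C}_\xi(\varphi)=\mathbb{E}[\int\varphi\,\mathrm{d}\hat\xi]-\lambda_\xi\int\varphi(t)\,\mathrm{d}t$. The structure factor is its density with respect to Lebesgue measure. For $\xi_B$ this density exists and is given by $s_{\xi_B}(t)=\sum_{n\in\mathbb{Z}}e^{-\frac12|n|^{2h}t^2}e^{-int}$ for $t\ne0$. A stationary point process $\xi$ on $\mathbb{R}$ is hyperuniform if $\lim_{r\to\infty}\operatorname{Var}(\xi([-r,r]))/(2r)=0$; equivalently $\lim_{\varepsilon\to0}\varepsilon^{-1}\mathcal{S}_\xi([-\varepsilon,\varepsilon])=0$. $\Gamma$ is the Gamma function. *)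

(* Defs.v *)
From mathcomp Require Import all_boot all_order all_algebra.
From mathcomp Require Import all_classical all_reals all_analysis.
From mathcomp Require Import measurable_realfun complex.

Set Implicit Arguments.
Unset Strict Implicit.
Unset Printing Implicit Defensive.

Import Order.TTheory GRing.Theory Num.Theory.
Import numFieldNormedType.Exports.

Local Open Scope classical_set_scope.
Local Open Scope ring_scope.

(** A configuration is a subset [A] of [R], identified with the counting measure
    [I |-> #(A `&` I)].  The sigma-algebra is the one generated by the counting
    maps.  The type contains all subsets, not only the locally finite ones, so
    that [{n + B_n}], which is locally finite only almost surely, is a
    configuration for every outcome; local finiteness of a point process is
    required in [point_process]. *)

Definition counting_events (R : realType) : set (set (set R)) :=
  [set E | exists2 I : set R, measurable I &
           exists2 V : set (\bar R), measurable V &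
             E = [set A | V (counting (A `&` I))]].

Definition config (R : realType) := g_sigma_algebraType (@counting_events R).

Definition locally_finite (R : realType) (A : set R) :=
  forall a b : R, finite_set (A `&` `[a, b]).

Definition shift_config (R : realType) (t : R) (A : config R) : config R :=
  [set x - t | x in (A : set R)].

Definition point_process (R : realType) (d : measure_display)
    (T : measurableType d) (xi : T -> config R) :=
  measurable_fun setT xi /\ forall w, @locally_finite R (xi w).

Definition stationary (R : realType) (d : measure_display)
    (T : measurableType d) (P : probability T R) (xi : T -> config R) :=
  forall (t : R) (E : set (config R)), measurable E ->
    P [set w | E (shift_config t (xi w))] = P [set w | E (xi w)].

Definition num_points (R : realType) (T : Type) (xi : T -> config R)
  (I : set R) : T -> R := fun w => fine (counting ((xi w : set R) `&` I)).

Definition intensity (R : realType) (d : measure_display)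
    (T : measurableType d) (P : probability T R) (xi : T -> config R) : \bar R :=
  (\int[P]_w counting ((xi w : set R) `&` `[0%R, 1%R]))%E.

Definition hyperuniform (R : realType) (d : measure_display)
    (T : measurableType d) (P : probability T R) (xi : T -> config R) :=
  ('V_P[num_points xi `[(- r)%R, r]] * ((2 * r)^-1)%:E)%E @[r --> +oo%R]
    --> 0%E.

Definition is_palm (R : realType)
    (d : measure_display) (T : measurableType d)
    (P : probability T R) (xi : T -> config R)
    (d' : measure_display) (T' : measurableType d')
    (Q : probability T' R) (xihat : T' -> config R) :=
  [/\ (0 < intensity P xi < +oo)%E,
      measurable_fun setT xihat &
      forall f : (config R * R)%type -> \bar R,
        measurable_fun setT f -> (forall z, 0 <= f z)%E ->
        (\int[P]_w \int[@counting R R]_(t in (xi w : set R))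
            f (shift_config t (xi w), t) =
         intensity P xi *
         \int[Q]_w \int[@lebesgue_measure R]_t f (xihat w, t))%E].

(** Degenerate (constant) normal laws are included, whence the case [s = 0],
    for which [normal_prob] is not a Dirac mass. *)
Definition gaussian_rv (R : realType) (d : measure_display)
    (T : measurableType d) (P : probability T R) (X : T -> R) :=
  exists m s : R, forall A : set R, measurable A ->
    P (X @^-1` A) = if s == 0 then \d_m A else normal_prob m s A.

Definition gaussian_process (R : realType) (d : measure_display)
    (T : measurableType d) (P : probability T R) (X : R -> T -> R) :=
  forall (n : nat) (t a : 'I_n -> R),
    gaussian_rv P (fun w => \sum_(i < n) a i * X (t i) w).

Definition same_fdd (R : realType) (d : measure_display)
    (T : measurableType d) (P : probability T R) (X Y : R -> T -> R) :=
  forall (n : nat) (t : n.-tuple R) (E : set (n.-tuple R)), measurable E ->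
    P [set w | E [tuple X (tnth t i) w | i < n]] =
    P [set w | E [tuple Y (tnth t i) w | i < n]].

Definition stationary_increments (R : realType) (d : measure_display)
    (T : measurableType d) (P : probability T R) (X : R -> T -> R) :=
  forall s : R, same_fdd P (fun t w => X (s + t) w - X s w)
                           (fun t w => X t w - X 0 w).

Record fractional_brownian_motion (R : realType) (d : measure_display)
    (T : measurableType d) (P : probability T R) (h : R) (B : R -> T -> R)
    : Prop := FractionalBrownianMotion {
  fbm_measurable : forall t, measurable_fun setT (B t);
  fbm_gaussian : gaussian_process P B;
  fbm_centered : forall t, ('E_P[B t] = 0)%E;
  fbm_start : {ae P, forall w, B 0 w = 0};
  fbm_stationary_increments : stationary_increments P B;
  fbm_variance : forall t, ('V_P[B t] = (`|t| `^ (2 * h))%:E)%E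
}.

Definition perturbed_integers (R : realType) (T : Type) (B : R -> T -> R)
    (w : T) : config R :=
  range (fun n : int => n%:~R + B n%:~R w).

Definition Cintegral (R : realType) (d : measure_display)
    (T : measurableType d) (mu : {measure set T -> \bar R}) (D : set T)
    (f : T -> R[i]) : R[i] :=
  Complex (\int[mu]_(x in D) complex.Re (f x))
          (\int[mu]_(x in D) complex.Im (f x)).

Definition Cintegrable (R : realType) (d : measure_display)
    (T : measurableType d) (mu : {measure set T -> \bar R}) (D : set T)
    (f : T -> R[i]) :=
  mu.-integrable D (fun x => (complex.Re (f x))%:E) /\
  mu.-integrable D (fun x => (complex.Im (f x))%:E).

Definition expi (R : realType) (x : R) : R[i] := Complex (cos x) (sin x).

Definition fourier (R : realType) (phi : R -> R[i]) (t : R) : R[i] :=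
  Cintegral (@lebesgue_measure R) setT (fun x => phi x * expi (- (t * x))).

Definition schwartzR (R : realType) (f : R -> R) :=
  (forall (k : nat) (x : R), derivable (derive1n k f) x 1) /\
  (forall j k : nat, exists M : R, forall x : R,
     `|x| ^+ j * `|derive1n k f x| <= M).

Definition schwartz (R : realType) (phi : R -> R[i]) :=
  schwartzR (fun x => complex.Re (phi x)) /\
  schwartzR (fun x => complex.Im (phi x)).

(** The distribution [C_xi], in terms of the Palm version [xihat] on [(T', Q)]
    and the intensity [lambda].  When the underlying stationary process has a
    finite second moment, both integrals converge absolutely for Schwartz
    [phi]. *)
Definition palm_covariance (R : realType) (d' : measure_display)
    (T' : measurableType d') (Q : probability T' R) (xihat : T' -> config R)
    (lambda : R) (phi : R -> R[i]) : R[i] :=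
  Cintegral Q setT (fun w => Cintegral (@counting R R) (xihat w : set R) phi)
  - Complex lambda 0 * Cintegral (@lebesgue_measure R) setT phi.

Definition bartlett_spectrum (R : realType) (d' : measure_display)
    (T' : measurableType d') (Q : probability T' R) (xihat : T' -> config R)
    (lambda : R) (phi : R -> R[i]) : R[i] :=
  palm_covariance Q xihat lambda (fourier phi).

(** [s] is a version of the Lebesgue density of the Bartlett spectrum; such an
    [s] is unique up to Lebesgue null sets. *)
Definition is_structure_factor (R : realType)
    (d : measure_display) (T : measurableType d)
    (P : probability T R) (xi : T -> config R)
    (d' : measure_display) (T' : measurableType d')
    (Q : probability T' R) (xihat : T' -> config R) (s : R -> R) :=
  is_palm P xi Q xihat /\
  forall phi : R -> R[i], schwartz phi ->
    Cintegrable (@lebesgue_measure R) setT (fun t => phi t * Complex (s t) 0) /\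
    Cintegral (@lebesgue_measure R) setT (fun t => phi t * Complex (s t) 0) =
    bartlett_spectrum Q xihat (fine (intensity P xi)) phi.

Definition fbm_structure_term (R : realType) (h t : R) (n : int) : R[i] :=
  Complex (expR (- (2^-1 * (`|n%:~R| `^ (2 * h)) * t ^+ 2))) 0
  * expi (- (n%:~R * t)).

(** The sum over all integers [n] of [fbm_structure_term h t n], which converges
    absolutely for [t != 0].  Each partial sum over [-N <= n <= N] is real, so
    that taking [Re] loses nothing.  At [t = 0] the series diverges and the
    value is irrelevant. *)
Definition fbm_structure_factor (R : realType) (h t : R) : R :=
  limn (fun N : nat =>
    complex.Re (\sum_(k < N.*2.+1) fbm_structure_term h t (k%:Z - N%:Z))).

Definition Gamma (R : realType) (z : R) : R :=
  \int[@lebesgue_measure R]_(x in `]0, +oo[) (x `^ (z - 1) * expR (- x)).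

Definition alpha (R : realType) (h : R) : R :=
  2 * h * Gamma (2 * h) * sin (pi * h).

(* Main.v *)
(** Write [f_t n = exp (- |n|^(2h) t^2 / 2)] and [S_N(t) = \sum_(|n| <= N) f_t n * cos (n t)],
    so that [s = lim S_N].

    Density: for a Schwartz function [phi] with Fourier transform [psi], averaging over
    [B_n] turns [E \sum_(|n| <= N) psi (n + B_n)] into [\int phi S_N].  Two summations by
    parts, with the Dirichlet and then the Fejer kernels, bound
    [S_N(t) - f_t N * 2 sin ((N + 1/2) t) / t] by [C (1 + |t|^(- h))] uniformly in [N], and the
    integral of [phi] against the subtracted term is
    [E \int_(|x| <= N + 1/2) psi (x + B_N) dx], which tends to [\int psi].

    Asymptotics: [s(t) sin (t / 2) = \sum_n (f_t n - f_t (n + 1)) sin ((n + 1/2) t)] is close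
    to [- \int (f_t)'(y) sin (t y) dy], which by scaling is [h t^(2 - 2h)] times
    [\int x^(2h - 1) exp (- eps x^(2h)) sin x dx] with [eps = t^(2 - 2h) / 2].  The limit of
    this integral as [eps] tends to [0] is the same with [exp (- eps x)] in place of
    [exp (- eps x^(2h))], and then it is computed from
    [\int x^(z - 1) exp (- x e^(- i theta)) dx = Gamma(z) e^(i z theta)].

    Hyperuniformity: by the Palm formula [E xi([-r, r])^2 = \sum_n E (L - |n + B_n|)_+] with
    [L = 2 r].  The tent [(L - |x|)_+] is a second difference of [|x|] with step [L], and the
    average over the symmetric variable [B_n] brings in a second difference with step [B_n];
    as the two commute, the variance is, up to bounded terms,
    [\sum_n E (|B_n| - |n - L|)_+].  This is at most of order [L^(2h)], and it is at least of
    order [L] when [h >= 1/2], because of the integers [n] within distance of order [L^h]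
    of [L]. *)

Require Import Defs.
From mathcomp Require Import all_boot all_order all_algebra.
From mathcomp Require Import all_classical all_reals all_analysis.
From mathcomp Require Import measurable_realfun complex.
From mathcomp Require Import ring lra zify.

Set Implicit Arguments.
Unset Strict Implicit.
Unset Printing Implicit Defensive.

Import Order.TTheory GRing.Theory Num.Theory.
Import numFieldNormedType.Exports.

Local Open Scope classical_set_scope.
Local Open Scope ring_scope.

(** * Integration over the line *)

Section real_integration.
Context {R : realType}.
Local Notation mu := (@lebesgue_measure R).

(** The partial sums [S_N] concentrate at [0]: the term [f_t N * D_N(t)], with [D_N] the Dirichlet
    kernel, tends to [0] for every [t != 0] but keeps the mass that the covariance compensates by
    [\int psi]. It has to be isolated before domination is possible. One summation by parts against
    [|D_n(t)| <= C / |t|] would leave a bound that is not integrable at [0]; the second difference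
    of [f_t] against the Fejer bound [C / t^2] gains a factor [t^(2 - h)].

    Without its exponential factor the sine integral does not converge absolutely, and for
    [2 h >= 1] it does not converge at all. Since [sin] changes sign under a shift by [pi], the
    power [x^(2h - 1)] may be replaced by a second difference, which is dominated uniformly in
    [eps].

    The points [n + B_n] are distinct only almost surely, so sums over [n] and integrals over the
    set of points agree off a null set on which nothing is known, not even measurability.

    Hyperuniformity is defined by the number variance and is obtained from second moments, not from
    the asymptotics of [s]. *)

Lemma Rdominated_cvg d (T : measurableType d) (m : {measure set T -> \bar R})
    (D : set T) (f_ : nat -> T -> R) (f g : T -> R) :
  measurable D -> (forall n, measurable_fun D (f_ n)) -> measurable_fun D f ->
  {ae m, forall x, D x -> f_ n x @[n --> \oo] --> f x} ->
  m.-integrable D (EFin \o g) ->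
  (forall n x, D x -> `|f_ n x| <= g x) ->
  m.-integrable D (EFin \o f) /\
  \int[m]_(x in D) f_ n x @[n --> \oo] --> \int[m]_(x in D) f x.
Proof.
move=> mD mf_ mf ff ig fg.
have [] := @dominated_convergence _ _ _ m D mD (fun n => EFin \o f_ n)
  (EFin \o f) (EFin \o g).
- by move=> n; apply/measurable_EFinP.
- exact/measurable_EFinP.
- apply: filterS ff => x fx Dx; apply: cvg_EFin; first exact: nearW.
  exact: fx.
- exact: ig.
- by apply: aeW => x n Dx; rewrite /= lee_fin; exact: fg.
move=> intf _ cv; split => //.
apply: fine_cvg; rewrite fineK//; exact: integrable_fin_num.
Qed.

Lemma le_integrable_R d (T : measurableType d) (m : {measure set T -> \bar R})
    (D : set T) (f g : T -> R) : measurable D -> measurable_fun D f ->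
  (forall x, D x -> `|f x| <= g x) -> m.-integrable D (EFin \o g) ->
  m.-integrable D (EFin \o f).
Proof.
move=> mD mf fg; apply: le_integrable => //; first exact/measurable_EFinP.
move=> x Dx /=; rewrite lee_fin (le_trans (fg x Dx))//.
exact: ler_norm.
Qed.

Section integrable_R.
Context d (T : measurableType d) (m : {measure set T -> \bar R}) (D : set T).
Hypothesis mD : measurable D.

Lemma integrableD_R (f g : T -> R) : m.-integrable D (EFin \o f) ->
  m.-integrable D (EFin \o g) -> m.-integrable D (EFin \o (fun x => f x + g x)).
Proof. by move=> intf intg; exact: (integrableD mD intf intg). Qed.

Lemma integrableB_R (f g : T -> R) : m.-integrable D (EFin \o f) ->
  m.-integrable D (EFin \o g) -> m.-integrable D (EFin \o (fun x => f x - g x)).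
Proof. by move=> intf intg; exact: (integrableB mD intf intg). Qed.

Lemma integrableZ_R (c : R) (f : T -> R) : m.-integrable D (EFin \o f) ->
  m.-integrable D (EFin \o (fun x => c * f x)).
Proof. by move=> intf; exact: (integrableZl mD c intf). Qed.

End integrable_R.

Section affine.
Variables (a b : R).
Hypothesis a0 : 0 < a.
Let aff (x : R) : measurableTypeR R := a * x + b.

Let measurable_aff : measurable_fun setT aff.
Proof. by apply: measurable_funD => //; apply: measurable_funM. Qed.

Let pf : {measure set (measurableTypeR R) -> \bar R} :=
  measure_function_pushforward__canonical__measure_function_Measure mu
    measurable_aff.
Let pfm : {measure set (measurableTypeR R) -> \bar R} :=
  mscale (NngNum (ltW a0)) pf.

Let lebesgue_affine (A : set R) : measurable A -> mu A = pfm A.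
Proof.
move=> mA; apply: lebesgue_measure_unique => //= _ [[u v]] _ <-.
rewrite /pfm /mscale/= /pushforward/=.
have -> : aff @^-1` `]u, v] = `](u - b) / a, (v - b) / a]%classic.
  apply/seteqP; split => x /=; rewrite !in_itv/= /aff.
  - by rewrite ltr_pdivrMr// ler_pdivlMr// (mulrC x) ltrBlDr lerBrDr.
  - by rewrite ltr_pdivrMr// ler_pdivlMr// (mulrC x) ltrBlDr lerBrDr.
rewrite !lebesgue_measure_itv/= !lte_fin ltr_pM2r ?invr_gt0//.
rewrite ltrD2r; case: ifPn => _; last by rewrite mule0.
rewrite -!EFinD -EFinM; congr EFin.
by field; rewrite gt_eqF.
Qed.

Lemma ge0_integral_affine (f : R -> \bar R) : measurable_fun setT f ->
  (forall x, 0 <= f x)%E ->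
  (\int[mu]_x f x = a%:E * \int[mu]_x f (a * x + b)%R)%E.
Proof.
move=> mf f0.
rewrite (@eq_measure_integral _ _ _ _ pfm); last first.
  by move=> A mA _; exact: lebesgue_affine.
rewrite ge0_integral_mscale//; congr (_ * _)%E.
rewrite ge0_integral_pushforward//.
Qed.

Lemma integrable_affine (f : R -> R) : mu.-integrable setT (EFin \o f) ->
  mu.-integrable setT (EFin \o (fun x => f (a * x + b))).
Proof.
move=> /integrableP[mf foo]; apply/integrableP; split.
  apply/measurable_EFinP; apply: (@measurableT_comp _ _ _ _ _ _ f _ aff) => //.
  exact/measurable_EFinP.
move: foo; rewrite ge0_integral_affine//; last exact: measurableT_comp.
rewrite !ltey; apply: contra_neq => /= ->.
by rewrite gt0_muley.
Qed.

Lemma Rintegral_affine (f : R -> R) : mu.-integrable setT (EFin \o f) ->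
  \int[mu]_x f x = a * \int[mu]_x f (a * x + b).
Proof.
move=> intf; have intf' := integrable_affine intf.
have mf := measurable_int _ intf.
have mf' := measurable_int _ intf'.
rewrite -RintegralZl//= /Rintegral; congr fine.
under [RHS]eq_integral do rewrite EFinM.
rewrite (integralZl _ intf')// integralE ge0_integral_affine//; last first.
  exact: measurable_funepos.
rewrite [X in (_ - X)%E]ge0_integral_affine//; last first.
  exact: measurable_funeneg.
transitivity (a%:E * (\int[mu]_x (EFin \o (fun x => f (a * x + b)%R))^\+ x -
  \int[mu]_x (EFin \o (fun x => f (a * x + b)%R))^\- x))%E; last by rewrite -integralE.
rewrite [RHS]muleBr//.
  by congr (_ - _)%E; congr (_ * _)%E; apply: eq_integral => x _;
    rewrite ?funeposE ?funenegE.
apply: fin_num_adde_defl; rewrite fin_numN.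
exact: integrable_neg_fin_num intf'.
Qed.

End affine.

Section improper.
Variables (D : set R) (u v : nat -> R).
Hypothesis uv : forall n, u n < v n.
Hypothesis uN : {homo u : m n / (m <= n)%N >-> n <= m}.
Hypothesis vN : {homo v : m n / (m <= n)%N >-> m <= n}.
Hypothesis DE : D = \bigcup_n (`[u n, v n]%classic : set R).
Variables (F f : R -> R).
Hypothesis FE : forall x, D x -> is_derive x 1 F (f x).
Hypothesis cf : forall x, D x -> {for x, continuous f}.

Let mD : measurable D.
Proof. by rewrite DE; apply: bigcupT_measurable. Qed.

Let sub n : `[u n, v n] `<=` D.
Proof. by rewrite DE => x xn; exists n. Qed.

Let FTC n : (\int[mu]_(x in `[u n, v n]) (f x)%:E = (F (v n) - F (u n))%:E)%E.
Proof.
have cF x : D x -> {for x, continuous F}.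
  move=> Dx; apply/differentiable_continuous/derivable1_diffP.
  by have := FE Dx => -[].
rewrite (@continuous_FTC2 _ f F)//.
- apply: continuous_in_subspaceT => x /set_mem xD; apply: cf; exact: sub xD.
- split.
  + move=> x; rewrite in_itv/= => /andP[ux xv].
    have /FE [] : D x by apply: (@sub n); rewrite /= in_itv/= !ltW.
    by [].
  + apply: cvg_at_right_filter; apply: cF; apply: (@sub n).
    by rewrite /= in_itv/= lexx ltW.
  + apply: cvg_at_left_filter; apply: cF; apply: (@sub n).
    by rewrite /= in_itv/= lexx ltW.
- move=> x; rewrite in_itv/= => /andP[ux xv].
  have /FE Fx : D x by apply: (@sub n); rewrite /= in_itv/= !ltW.
  by rewrite derive1E derive_val.
Qed.

Let mf : measurable_fun D f.
Proof.
rewrite DE; apply/measurable_fun_bigcup => // n.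
apply: subspace_continuous_measurable_fun => //.
by apply: continuous_in_subspaceT => x /set_mem xD; apply: cf; exact: sub xD.
Qed.

Let nd : {homo (fun n => `[u n, v n]%classic : set R) : m n / (m <= n)%N >-> (m <= n)%O}.
Proof.
move=> m n mn; apply/subsetPset => x /=; rewrite !in_itv/= => /andP[ux xv].
by rewrite (le_trans (uN mn))//= (le_trans xv)// vN.
Qed.

(** The fundamental theorem applies on each compact interval, and [M] bounds the increasing sequence
    of integrals so obtained. The antiderivative is used only inside [D], whose ends may be singular
    or infinite. *)
Lemma ge0_integrable_improper (M : R) : (forall x, D x -> 0 <= f x) ->
  (forall n, F (v n) - F (u n) <= M) -> mu.-integrable D (EFin \o f).
Proof.
move=> f0 FM; apply/integrableP; split; first exact/measurable_EFinP.
have -> : (\int[mu]_(x in D) `|(EFin \o f) x| = \int[mu]_(x in D) (f x)%:E)%E.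
  by apply: eq_integral => x /set_mem Dx; rewrite /= ger0_norm// f0.
have := @ge0_nondecreasing_set_cvg_integral _ _ _
  (fun n => `[u n, v n]%classic : set (measurableTypeR R)) (EFin \o f) mu nd.
rewrite -DE => /(_ (fun=> measurable_itv _)).
have mfE n : measurable_fun `[u n, v n] (EFin \o f).
  apply/measurable_EFinP; apply: measurable_funS mf => //; exact: sub.
have f0E n x : `[u n, v n]%classic x -> (0 <= (EFin \o f) x)%E.
  by move=> /sub Dx; rewrite lee_fin f0.
move=> /(_ mfE f0E) cv; apply: (@le_lt_trans _ _ M%:E); last exact: ltry.
rewrite -(cvg_lim _ cv)//; apply: lime_le.
  by apply/cvg_ex; eexists; exact: cv.
by apply: nearW => n; rewrite FTC lee_fin.
Qed.

Lemma Rintegral_improper (l : R) : mu.-integrable D (EFin \o f) ->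
  F (v n) - F (u n) @[n --> \oo] --> l -> \int[mu]_(x in D) f x = l.
Proof.
move=> intf Fl.
have mfn n : measurable_fun D (f \_ `[u n, v n]).
  by apply/measurable_restrict => //; apply: measurable_funS mf => // x [].
have [||n x Dx|_] := @Rdominated_cvg _ _ mu D (fun n => f \_ `[u n, v n]) f
  (Num.norm \o f) mD mfn mf.
- apply: aeW => x Dx; apply: cvg_near_cst.
  move: (Dx); rewrite DE => -[n _ xn]; exists n => // m /= nm.
  by rewrite patchT// inE; move/subsetPset : (nd nm); apply.
- exact: integrable_norm.
- rewrite /patch; case: ifPn => //= _.
  by rewrite normr0.
have -> : (fun n => \int[mu]_(x in D) (f \_ `[u n, v n]) x) =
    (fun n => F (v n) - F (u n)).
  apply/funext => n; rewrite -Rintegral_mkcondr setIidr; last exact: sub.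
  by rewrite /Rintegral FTC.
move=> cv; apply: cvg_unique Fl => //; exact: cv.
Qed.

End improper.

Lemma integrable_setU d (T : measurableType d) (m : {measure set T -> \bar R})
    (A B : set T) (f : T -> R) : measurable A -> measurable B ->
  m.-integrable A (EFin \o f) -> m.-integrable B (EFin \o f) ->
  m.-integrable (A `|` B) (EFin \o f).
Proof.
move=> mA mB iA iB.
have mf : measurable_fun (A `|` B) (EFin \o f).
  apply/measurable_funU => //.
  by split; [exact: (measurable_int m iA)|exact: (measurable_int m iB)].
apply/integrableP; split => //.
have -> : A `|` B = A `|` (B `\` A) by rewrite setDE setUIr setUv setIT.
have mBA : measurable (B `\` A) by exact: measurableD.
rewrite ge0_integral_setU//=; last 2 first.
- apply/measurable_EFinP; apply: measurableT_comp => //; apply/measurable_EFinP.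
  by rewrite setDE setUIr setUv setIT.
- by apply/disj_setPS => x [Ax [_ /(_ Ax)]].
apply: lte_add_pinfty.
  by case/integrableP : iA.
have : m.-integrable (B `\` A) (EFin \o f) by apply: integrableS iB.
by case/integrableP.
Qed.

Lemma is_derive1_mul (f g : R -> R) (x a b : R) :
  is_derive x 1 f a -> is_derive x 1 g b ->
  is_derive x 1 (fun x => f x * g x) (a * g x + f x * b).
Proof.
move=> fa gb; have := is_deriveM fa gb.
have -> : f x *: b + g x *: a = a * g x + f x * b by rewrite /GRing.scale/=; ring.
by [].
Qed.

Lemma is_derive1_add (f g : R -> R) (x a b : R) :
  is_derive x 1 f a -> is_derive x 1 g b ->
  is_derive x 1 (fun x => f x + g x) (a + b).
Proof. by move=> fa gb; exact: is_deriveD. Qed.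

Lemma is_derive1_scale (c : R) (f : R -> R) (x a : R) :
  is_derive x 1 f a -> is_derive x 1 (fun x => c * f x) (c * a).
Proof. by move=> fa; exact: is_deriveZ. Qed.

Lemma is_derive1_continuous (f : R -> R) (x a : R) :
  is_derive x 1 f a -> {for x, continuous f}.
Proof. by move=> [+ _] => ?; apply/differentiable_continuous/derivable1_diffP. Qed.

(** One family for all integrands: [f_t] has [s = 0], [a = 2 h], [l = t^2 / 2]; the scaled sine
    integral has [s = 2 h - 1]; the Gamma integrand has [a = 1]. Derivatives in [x] stay in the span
    of the family. *)
Definition powexp (s a l x : R) : R := x `^ s * expR (- (l * x `^ a)).

Lemma is_derive_powexp (s a l x : R) : 0 < x ->
  is_derive x 1 (powexp s a l)
    (s * powexp (s - 1) a l x - a * l * powexp (s + a - 1) a l x).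
Proof.
move=> x0; rewrite /powexp.
have d1 := is_derive1_powR s x0.
have d2 : is_derive x 1 (fun x => expR (- (l * x `^ a)))
   (expR (- (l * x `^ a)) * (- l * (a * x `^ (a - 1)))).
  apply: (@is_derive1_comp _ expR (fun x => - (l * x `^ a))).
  have := is_derive1_scale (- l) (is_derive1_powR a x0).
  by under eq_fun do rewrite mulNr.
have := is_derive1_mul d1 d2.
have -> : x `^ (s + a - 1) = x `^ s * x `^ (a - 1).
  rewrite -powRD ?addrA//.
  by apply/implyP => _; rewrite gt_eqF.
set y := (X in is_derive _ _ _ X); set z := (X in _ -> is_derive _ _ _ X).
suff -> : y = z by [].
rewrite /y /z; ring.
Qed.

Lemma powexp_ge0 s a l x : 0 <= powexp s a l x.
Proof. by rewrite mulr_ge0 ?powR_ge0 ?expR_ge0. Qed.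

(** The inequality [u / k <= exp (u / k)] raised to the power [k]. It is the source of all bounds
    that are uniform in the parameter [l] of [powexp]. *)
Lemma powR_expRN_le (k u : R) : 0 < k -> 0 <= u -> u `^ k * expR (- u) <= k `^ k.
Proof.
move=> k0 u0; rewrite expRN ler_pdivrMr ?expR_gt0//.
have -> : expR u = expR (u / k) `^ k by rewrite -expRM divfK// gt_eqF.
rewrite -powRM ?expR_ge0 ?(ltW k0)//.
apply: ge0_ler_powR; rewrite ?nnegrE ?mulr_ge0 ?expR_ge0 ?(ltW k0)//.
rewrite -ler_pdivrMl// mulrC (le_trans _ (expR_ge1Dx _))//.
by rewrite lerDr.
Qed.

Lemma measurable_powexp s a l : measurable_fun setT (powexp s a l).
Proof.
apply: measurable_funM; first exact: measurable_powR.
apply: measurableT_comp => //; apply: measurableT_comp => //.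
by apply: measurable_funM => //; exact: measurable_powR.
Qed.

Lemma integrable_powR_near0 (s b : R) : -1 < s -> 0 < b ->
  mu.-integrable `]0, b] (EFin \o (fun x => x `^ s)).
Proof.
move=> s1 b0; have s10 : 0 < s + 1 by rewrite -ltrBlDr sub0r.
apply: (@ge0_integrable_improper _ (fun n => b / n.+2%:R) (fun=> b) _ _ _ _
  (fun x => (s + 1)^-1 * x `^ (s + 1)) _ _ _ ((s + 1)^-1 * b `^ (s + 1))) => //.
- by move=> n; rewrite ltr_pdivrMr// ltr_pMr// ltr1n.
- by move=> m n mn; rewrite ler_pM2l// lef_pV2 ?posrE// ler_nat.
- apply/seteqP; split => x /=.
    rewrite in_itv/= => /andP[x0 xb].
    exists (Num.truncn (b / x)) => //=.
    rewrite in_itv/= xb andbT ler_pdivrMr// -ler_pdivrMl// mulrC.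
    apply/ltW/(lt_le_trans (truncnS_gt _)).
    by rewrite ler_nat.
  move=> [n _ /=]; rewrite !in_itv/= => /andP[bx ->]; rewrite andbT.
  by apply: lt_le_trans bx; rewrite divr_gt0.
- move=> x /=; rewrite in_itv/= => /andP[x0 _].
  have := is_derive1_scale (s + 1)^-1 (is_derive1_powR (s + 1) x0).
  by rewrite mulrA mulVf ?mul1r ?addrK// gt_eqF.
- move=> x /=; rewrite in_itv/= => /andP[x0 _].
  exact: is_derive1_continuous (is_derive1_powR s x0).
- by move=> x _; exact: powR_ge0.
- by move=> n; rewrite gerBl mulr_ge0 ?powR_ge0// invr_ge0 ltW.
Qed.

Lemma integrable_powR_neary (s c : R) : s < -1 -> 0 < c ->
  mu.-integrable `[c, +oo[ (EFin \o (fun x => x `^ s)).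
Proof.
move=> s1 c0; have s10 : s + 1 < 0 by rewrite -ltrBrDr sub0r.
have gt x : x \in `[c, +oo[ -> 0 < x.
  by rewrite in_itv/= andbT; exact: lt_le_trans.
apply: (@ge0_integrable_improper _ (fun=> c) (fun n => c + n.+1%:R) _ _ _ _
  (fun x => (s + 1)^-1 * x `^ (s + 1)) _ _ _ (- (s + 1)^-1 * c `^ (s + 1))) => //.
- by move=> n; rewrite ltrDl.
- by move=> m n mn; rewrite lerD2l ler_nat.
- apply/seteqP; split => x /=.
    rewrite !in_itv/= andbT => cx.
    exists (Num.truncn (x - c)) => //=.
    by rewrite in_itv/= cx/= -lerBlDl ltW// truncnS_gt.
  by move=> [n _ /=]; rewrite !in_itv/= => /andP[->].
- move=> x /gt x0.
  have := is_derive1_scale (s + 1)^-1 (is_derive1_powR (s + 1) x0).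
  by rewrite mulrA mulVf ?mul1r ?addrK// lt_eqF.
- move=> x /gt x0.
  exact: is_derive1_continuous (is_derive1_powR s x0).
- by move=> x _; exact: powR_ge0.
- by move=> n; rewrite mulNr gerDr nmulr_rle0 ?powR_ge0 ?invr_lt0.
Qed.

Lemma integrable_powexp (s a l : R) : -1 < s -> 0 < a -> 0 < l ->
  mu.-integrable `]0, +oo[ (EFin \o powexp s a l).
Proof.
move=> s1 a0 l0.
have -> : `]0, +oo[%classic = `]0, 1] `|` `[1, +oo[ :> set R.
  apply/seteqP; split => x /=; rewrite !in_itv/= !andbT.
    by move=> ->/=; exact/orP/le_total.
  by move=> [/andP[]//|]; exact: lt_le_trans.
apply: integrable_setU => //.
- apply: (@le_integrable_R _ (measurableTypeR R) mu _ _ (fun x => x `^ s)) => //.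
  + by apply: measurable_funS (measurable_powexp _ _ _).
  + move=> x; rewrite /= in_itv/= => /andP[x0 _].
    rewrite ger0_norm ?powexp_ge0// /powexp ler_piMr ?powR_ge0//.
    by rewrite -[leRHS]expR0 ler_expR oppr_le0 mulr_ge0 ?powR_ge0 ?ltW.
  + exact: integrable_powR_near0.
- pose k := (s + 2) / a.
  have k0 : 0 < k by rewrite divr_gt0// -ltrBlDr sub0r (lt_trans _ s1)// ltrN2 ltr1n.
  apply: (@le_integrable_R _ (measurableTypeR R) mu _ _ (fun x => k `^ k / l `^ k * x `^ (- 2))) => //.
  + by apply: measurable_funS (measurable_powexp _ _ _).
  + move=> x; rewrite /= in_itv/= andbT => x1.
    have x0 : 0 < x by exact: lt_le_trans x1.
    rewrite ger0_norm ?powexp_ge0// /powexp.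
    have := @powR_expRN_le k (l * x `^ a) k0 _.
    rewrite mulr_ge0 ?powR_ge0 ?(ltW l0)// => /(_ isT).
    rewrite powRM ?powR_ge0 ?(ltW l0)// -powRrM.
    have -> : a * k = s + 2 by rewrite /k mulrC divfK// gt_eqF.
    rewrite -mulrA -ler_pdivlMl ?powR_gt0// => H.
    have -> : x `^ s = x `^ (s + 2) * x `^ (- 2).
      rewrite -powRD ?addrK//.
      by apply/implyP => _; rewrite gt_eqF.
    rewrite mulrAC ler_wpM2r ?powR_ge0//.
    by rewrite [leRHS]mulrC.
  + rewrite (_ : _ \o _ = (fun x => (k `^ k / l `^ k)%:E * (x `^ (-2))%:E)%E); last first.
      by apply/funext => x /=; rewrite EFinM.
    apply: integrableZl => //; apply: integrable_powR_neary => //.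
    by rewrite ltrN2 ltr1n.
Qed.

(** The mean value theorem is applied to [y |-> p (y + d) - p y], and then to [p1] on an interval of
    length [d]. *)
Lemma second_difference_le (p p1 p2 : R -> R) (x d K : R) : 0 < d ->
  (forall y, x <= y <= x + d *+ 2 -> is_derive y 1 p (p1 y)) ->
  (forall y, x <= y <= x + d *+ 2 -> is_derive y 1 p1 (p2 y)) ->
  (forall y, x <= y <= x + d *+ 2 -> `|p2 y| <= K) ->
  `|p x - p (x + d) *+ 2 + p (x + d *+ 2)| <= d ^+ 2 * K.
Proof.
move=> d0 dp dp1 pK.
have shift (f : R -> R) (y a : R) : is_derive (y + d) 1 f a ->
    is_derive y 1 (fun z => f (z + d)) a.
  move=> fa; rewrite -[a]mulr1.
  apply: (@is_derive1_comp _ f (fun z => z + d)) => //.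
  have := is_derive1_add (is_derive_id y (1 : R)) (is_derive_cst d y (1 : R)).
  by rewrite addr0.
have [|||c cI E] := @MVT _ (fun y => p (y + d) - p y) (fun y => p1 (y + d) - p1 y)
    x (x + d).
- by rewrite ltrDl.
- move=> y; rewrite in_itv/= => /andP[xy yd].
  apply: is_deriveB; first apply: shift; apply: dp.
    by rewrite mulr2n addrA; lra.
  by rewrite mulr2n; lra.
- apply: derivable_within_continuous => y; rewrite in_itv/= => /andP[xy yd].
  have H1 : is_derive (y + d) 1 p (p1 (y + d)) by apply: dp; rewrite mulr2n; lra.
  have H2 : is_derive y 1 p (p1 y) by apply: dp; rewrite mulr2n; lra.
  by have [] := is_deriveB (shift _ _ _ H1) H2.
move: cI; rewrite in_itv/= => /andP[xc cd].
have [|||e eI E2] := @MVT _ p1 p2 c (c + d).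
- by rewrite ltrDl.
- move=> y; rewrite in_itv/= => /andP[cy yd].
  by apply: dp1; rewrite mulr2n; lra.
- apply: derivable_within_continuous => y; rewrite in_itv/= => /andP[cy yd].
  by have [] : is_derive y 1 p1 (p2 y) by apply: dp1; rewrite mulr2n; lra.
move: eI; rewrite in_itv/= => /andP[ce ed].
have -> : p x - p (x + d) *+ 2 + p (x + d *+ 2) = p2 e * d ^+ 2.
  transitivity (p (x + d + d) - p (x + d) - (p (x + d) - p x)).
    by rewrite mulr2n !mulr2n addrA; ring.
  by rewrite E E2; ring.
rewrite normrM mulrC (ger0_norm (sqr_ge0 _)) ler_wpM2l ?sqr_ge0// pK//.
by rewrite mulr2n; lra.
Qed.

(** A function changing sign under the shift by [d] sees only second
    differences. *)
Lemma Rintegral_antiperiodic (u k : R -> R) (d : R) :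
  measurable_fun setT k -> (forall x, `|k x| <= 1) ->
  (forall x, k (x + d) = - k x) ->
  mu.-integrable setT (EFin \o u) ->
  \int[mu]_x (u x * k x) =
  4^-1 * \int[mu]_x ((u x - u (x + d) *+ 2 + u (x + d *+ 2)) * k x).
Proof.
move=> mk k1 kd iu.
have ik v : mu.-integrable setT (EFin \o v) ->
    mu.-integrable setT (EFin \o (fun x => v x * k x)).
  move=> iv; apply: (@le_integrable_R _ _ _ _ _ (Num.norm \o v)) => //.
  - apply: measurable_funM => //.
    by apply/measurable_EFinP; exact: measurable_int iv.
  - by move=> x _; rewrite normrM ler_piMr.
  - exact: integrable_norm iv.
have sh e v : mu.-integrable setT (EFin \o v) ->
    mu.-integrable setT (EFin \o (fun x => v (x + e))).
  move=> /(integrable_affine e ltr01).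
  by under [in X in X -> _]eq_fun do rewrite mul1r.
have step v : mu.-integrable setT (EFin \o v) ->
    \int[mu]_x (v x * k x) = 2^-1 * \int[mu]_x ((v x - v (x + d)) * k x).
  move=> iv.
  have E : \int[mu]_x (v x * k x) = - \int[mu]_x (v (x + d) * k x).
    rewrite (Rintegral_affine d ltr01 (ik v iv)) mul1r.
    rewrite -mulN1r -RintegralZl//; last exact: ik (sh d v iv).
    by apply: eq_Rintegral => x _; rewrite mul1r kd; ring.
  rewrite (_ : \int[mu]_x ((v x - v (x + d)) * k x) =
    \int[mu]_x (v x * k x) - \int[mu]_x (v (x + d) * k x)).
    by rewrite E; field.
  rewrite -RintegralB//; [|exact: ik|exact: ik (sh d v iv)].
  by apply: eq_Rintegral => x _; ring.
rewrite step// step//; last first.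
  rewrite (_ : _ \o _ = (fun x => (u x)%:E - (u (x + d))%:E)%E)//.
  by apply: integrableB => //; exact: sh.
rewrite mulrA -invfM -natrM; congr (_ * _); apply: eq_Rintegral => x _.
by congr (_ * _); rewrite !mulr2n addrA; ring.
Qed.

End real_integration.

(** * Sine integrals and the Gamma function *)

Section gamma_integrals.
Context {R : realType}.
Local Notation mu := (@lebesgue_measure R).
Local Notation pinf := (`]0%R, +oo[%classic : set R).

Lemma in_pinf (x : R) : (x \in pinf) = (0 < x).
Proof. by apply/idP/idP; rewrite inE /= in_itv /= andbT. Qed.

Lemma restrict_pinf (f : R -> R) x : (f \_ pinf) x = if 0 < x then f x else 0.
Proof. by rewrite patchE in_pinf. Qed.

Lemma pinf_bigcup :
  pinf = \bigcup_n (`[n.+2%:R^-1, n.+1%:R]%classic : set R).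
Proof.
apply/seteqP; split => x /=; rewrite !in_itv/= ?andbT.
  move=> x0.
  exists (maxn (Num.truncn x) (Num.truncn x^-1)) => //=.
  rewrite in_itv/=; apply/andP; split.
    rewrite -[leRHS]invrK lef_pV2 ?posrE ?invr_gt0//.
    apply/ltW/(lt_le_trans (truncnS_gt _)).
    by rewrite ler_nat ltnS leqW// leq_maxr.
  apply/ltW/(lt_le_trans (truncnS_gt _)).
  by rewrite ler_nat ltnS leq_maxl.
move=> [n _ /=]; rewrite !in_itv/= => /andP[+ _].
by apply: lt_le_trans; rewrite invr_gt0.
Qed.

Lemma cvg_invSn (k : nat) : (n + k).+1%:R^-1 @[n --> \oo] --> (0 : R).
Proof. by have := @cvg_harmonic R; rewrite -(cvg_shiftn k). Qed.

Lemma norm_sin_le1 (x : R) : `|sin x| <= 1.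
Proof. by rewrite ler_norml sin_le1 sin_geN1. Qed.

Lemma norm_cos_le1 (x : R) : `|cos x| <= 1.
Proof. by rewrite ler_norml cos_le1 cos_geN1. Qed.

(** The exponential absorbs [(l y^a)^k]: a factor [l^k] is traded for a loss of [k a] in the
    exponent of [y], with a constant independent of [l]. *)
Lemma powexp_mul_le (r k a l y : R) : 0 < k -> 0 <= l -> 0 < y ->
  l `^ k * powexp (r + k * a) a l y <= k `^ k * y `^ r.
Proof.
move=> k0 l0 y0; rewrite /powexp powRD; last first.
  by apply/implyP => _; rewrite gt_eqF.
rewrite (mulrC k) powRrM.
have -> : l `^ k * (y `^ r * y `^ a `^ k * expR (- (l * y `^ a))) =
  (l * y `^ a) `^ k * expR (- (l * y `^ a)) * y `^ r.
  by rewrite powRM ?powR_ge0//; ring.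
rewrite ler_wpM2r ?powR_ge0// powR_expRN_le//.
by rewrite mulr_ge0 ?powR_ge0.
Qed.

Definition powexp1 (s a l y : R) : R :=
  s * powexp (s - 1) a l y - a * l * powexp (s + a - 1) a l y.

Definition powexp2 (s a l y : R) : R :=
  s * powexp1 (s - 1) a l y - a * l * powexp1 (s + a - 1) a l y.

Lemma is_derive_powexp1 (s a l x : R) : 0 < x ->
  is_derive x 1 (powexp1 s a l) (powexp2 s a l x).
Proof.
move=> x0; rewrite /powexp1 /powexp2.
by apply: is_deriveB; apply: is_derive1_scale; apply: is_derive_powexp.
Qed.

(** The second derivative is a sum of terms [l^j y^(s - 2 + j a) exp (- l y^a)] with [j = 0, 1, 2],
    and each is at most [j^j y^(s - 2)] (read as [y^(s - 2)] for [j = 0]), whatever [l] is. The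
    factor [4] is [2^2]. *)
Lemma powexp2_le (s a : R) : 0 < a -> exists2 C : R, 0 <= C &
  forall l y, 0 < l -> 0 < y -> `|powexp2 s a l y| <= C * y `^ (s - 2).
Proof.
move=> a0; exists (`|s * (s - 1)| + `|s * a| + `|a * (s + a - 1)| + `|a * a| * 4).
  by rewrite !addr_ge0 ?mulr_ge0.
move=> l y l0 y0.
have E j : powexp (s - 2 + j * a) a l y * l `^ j >= 0.
  by rewrite mulr_ge0 ?powexp_ge0 ?powR_ge0.
have b0 : powexp (s - 1 - 1) a l y <= y `^ (s - 2).
  rewrite /powexp (_ : s - 1 - 1 = s - 2); last by ring.
  by rewrite ler_piMr ?powR_ge0// -expR0 ler_expR oppr_le0 mulr_ge0 ?powR_ge0 ?ltW.
have b1 : l * powexp (s - 2 + 1 * a) a l y <= y `^ (s - 2).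
  have := @powexp_mul_le (s - 2) 1 a l y ltr01 (ltW l0) y0.
  by rewrite !powRr1 ?(ltW l0)// mul1r mul1r.
have b2 : l * l * powexp (s - 2 + 2 * a) a l y <= 4 * y `^ (s - 2).
  have := @powexp_mul_le (s - 2) 2 a l y (ltr0Sn _ _) (ltW l0) y0.
  by rewrite !powR_mulrn ?(ltW l0)// !expr2 -natrM.
have -> : powexp2 s a l y = s * (s - 1) * powexp (s - 1 - 1) a l y
   - s * a * (l * powexp (s - 2 + 1 * a) a l y)
   - a * (s + a - 1) * (l * powexp (s - 2 + 1 * a) a l y)
   + a * a * (l * l * powexp (s - 2 + 2 * a) a l y).
  rewrite /powexp2 /powexp1.
  rewrite (_ : s - 1 + a - 1 = s - 2 + 1 * a); last by ring.
  rewrite (_ : s + a - 1 - 1 = s - 2 + 1 * a); last by ring.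
  rewrite (_ : s + a - 1 + a - 1 = s - 2 + 2 * a); last by ring.
  by ring.
have -> : (`|s * (s - 1)| + `|s * a| + `|a * (s + a - 1)| + `|a * a| * 4)
    * y `^ (s - 2) = `|s * (s - 1)| * y `^ (s - 2) + `|s * a| * y `^ (s - 2) +
    `|a * (s + a - 1)| * y `^ (s - 2) + `|a * a| * (4 * y `^ (s - 2)) by ring.
have N (c w v : R) : 0 <= w -> w <= v -> `|c * w| <= `|c| * v.
  by move=> w0 wv; rewrite normrM (ger0_norm w0) ler_wpM2l.
apply: (le_trans (ler_normD _ _)); apply: lerD; last first.
  by apply: N => //; apply: mulr_ge0; [apply: mulr_ge0; exact: ltW|exact: powexp_ge0].
apply: (le_trans (ler_normB _ _)); apply: lerD; last first.
  by apply: N => //; apply: mulr_ge0; [exact: ltW|exact: powexp_ge0].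
apply: (le_trans (ler_normB _ _)); apply: lerD; last first.
  by apply: N => //; apply: mulr_ge0; [exact: ltW|exact: powexp_ge0].
by apply: N => //; exact: powexp_ge0.
Qed.

Section abel.
Variables (z a : R).
Hypotheses (z0 : 0 < z) (z2 : z < 2) (a0 : 0 < a).

Let P (l x : R) : R := (powexp (z - 1) a l \_ pinf) x.
Let P0 (x : R) : R := ((fun x => x `^ (z - 1)) \_ pinf) x.
Let D2 (u : R -> R) (x : R) := u x - u (x + pi) *+ 2 + u (x + pi *+ 2).

(** Two shifts by the half-period [pi] of [sin] turn [x `^ (z - 1)] into its second
    difference, which is integrable. *)
Definition abel_limit : R := 4^-1 * \int[mu]_x (D2 P0 x * sin x).

Let mrestrict (f : R -> R) : measurable_fun setT f ->
  measurable_fun setT (f \_ pinf).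
Proof.
move=> mf; apply/(measurable_restrictT _ _).1 => //.
exact: measurable_funS mf.
Qed.

Let mD2 (f : R -> R) : measurable_fun setT f -> measurable_fun setT (D2 f).
Proof.
move=> mf; apply: measurable_funD; last first.
  by apply: measurableT_comp => //; apply: measurable_funD.
apply: measurable_funB => //.
rewrite (_ : (fun x => _) = (fun x => 2 * f (x + pi))); last first.
  by apply/funext => x; rewrite mulr_natl.
apply: measurable_funM => //.
by apply: measurableT_comp => //; apply: measurable_funD.
Qed.

Let mP l : measurable_fun setT (P l).
Proof. by apply: mrestrict; exact: measurable_powexp. Qed.

Let iP l : 0 < l -> mu.-integrable setT (EFin \o P l).
Proof.
move=> l0; have := @integrable_powexp R (z - 1) a l _ a0 l0.
rewrite ltrBrDr addrC subrr => /(_ z0).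
move=> /(integrable_mkcond _ _).1; rewrite restrict_EFin; apply.
exact: measurable_itv.
Qed.

(** Majorant for [x < pi]: the three arguments of [D2] then stay below [3 pi], and the exponential
    is at most [1]. *)
Let P1 (x : R) : R := ((fun x => x `^ (z - 1)) \_ (`]0, 3 * pi]%classic : set R)) x.

Let P_le l y : 0 < l -> y < 3 * pi -> `|P l y| <= P1 y.
Proof.
move=> l0 y3; rewrite /P restrict_pinf /P1 patchE.
case: ifPn => y0; last first.
  by rewrite normr0; case: ifP => // _; exact: powR_ge0.
rewrite mem_set/=; last by rewrite in_itv/= y0 ltW.
rewrite ger0_norm ?powexp_ge0// /powexp ler_piMr ?powR_ge0//.
by rewrite -expR0 ler_expR oppr_le0 mulr_ge0 ?powR_ge0 ?ltW.
Qed.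

Let iP1 c : mu.-integrable setT (EFin \o (fun x => P1 (x + c))).
Proof.
have : mu.-integrable setT (EFin \o P1).
  have := @integrable_powR_near0 R (z - 1) (3 * pi) _ _.
  rewrite ltrBrDr addrC subrr mulr_gt0 ?pi_gt0// => /(_ z0 isT).
  by move=> /(integrable_mkcond _ _).1; rewrite restrict_EFin; apply.
move=> /(integrable_affine c ltr01).
by under [in X in X -> _]eq_fun do rewrite mul1r.
Qed.

(** Majorant for [x >= pi]: there the second difference is of order [x^(z - 3)], integrable at
    infinity because [z < 2]. *)
Let Q (x : R) : R := ((fun x => x `^ (z - 3)) \_ (`[pi, +oo[%classic : set R)) x.

Let iQ : mu.-integrable setT (EFin \o Q).
Proof.
have := @integrable_powR_neary R (z - 3) pi _ (pi_gt0 _).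
have -> : z - 3 < -1 by move: z2; lra.
by move=> /(_ isT)/(integrable_mkcond _ _).1; rewrite restrict_EFin; apply.
Qed.

(** Once the integrand is a second difference, its majorant does not involve [l], and its pointwise
    limit involves neither [l] nor [a]. This is why the factors [exp (- l x^(2h))] and [exp (- l x)]
    lead to the same limit. *)
Lemma cvg_abel (l_ : nat -> R) : (forall n, 0 < l_ n) ->
  l_ n @[n --> \oo] --> 0 ->
  \int[mu]_(x in pinf) (powexp (z - 1) a (l_ n) x * sin x) @[n --> \oo] -->
  abel_limit.
Proof.
move=> l0 l_0.
have [C C0 CP] := powexp2_le (z - 1) a0.
have E n : \int[mu]_(x in pinf) (powexp (z - 1) a (l_ n) x * sin x) =
   4^-1 * \int[mu]_x (D2 (P (l_ n)) x * sin x).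
  rewrite Rintegral_mkcond -(@Rintegral_antiperiodic R _ sin)//.
  - apply: eq_Rintegral => x _; rewrite /P !restrict_pinf.
    by case: ifP; rewrite ?mul0r.
  - exact: continuous_measurable_fun (@continuous_sin R).
  - by move=> x; exact: norm_sin_le1.
  - by move=> x; rewrite sinDpi.
  - exact: iP.
under eq_fun do rewrite E.
rewrite /abel_limit; apply: cvgM; first exact: cvg_cst.
pose m x := P1 (x + 0) + 2 * P1 (x + pi) + P1 (x + pi *+ 2) + pi ^+ 2 * C * Q x.
have [//||||||_] := @Rdominated_cvg R _ _ mu setT (fun n x => D2 (P (l_ n)) x * sin x)
  (fun x => D2 P0 x * sin x) m.
- move=> n; apply: measurable_funM; first exact: (mD2 (mP _)).
  exact: continuous_measurable_fun (@continuous_sin R).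
- apply: measurable_funM; last exact: continuous_measurable_fun (@continuous_sin R).
  exact: (mD2 (mrestrict (measurable_powR _))).
- have cP y : P (l_ n) y @[n --> \oo] --> P0 y.
    rewrite /P /P0.
    under eq_fun do rewrite restrict_pinf.
    rewrite restrict_pinf; case: ifP => _; last exact: cvg_cst.
    suff : powexp (z - 1) a (l_ n) y @[n --> \oo] --> y `^ (z - 1) * 1.
      by rewrite mulr1.
    apply: cvgM; first exact: cvg_cst.
    rewrite -expR0; apply: continuous_cvg; first exact: continuous_expR.
    rewrite -oppr0 -(mul0r (y `^ a)).
    by apply: cvgN; apply: cvgM => //; exact: cvg_cst.
  apply: aeW => x _; apply: cvgM; last exact: cvg_cst.
  apply: cvgD; last exact: cP.
  apply: cvgB; first exact: cP.
  rewrite !mulr2n; apply: cvgD; exact: cP.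
- exact: (integrableD_R measurableT (integrableD_R measurableT
    (integrableD_R measurableT (iP1 0) (integrableZ_R measurableT 2 (iP1 pi)))
    (iP1 (pi *+ 2))) (integrableZ_R measurableT (pi ^+ 2 * C) iQ)).
- move=> n x _; rewrite normrM.
  apply: (@le_trans _ _ `|D2 (P (l_ n)) x|).
    by rewrite ler_piMr//; exact: norm_sin_le1.
  have P10 y : 0 <= P1 y.
    by rewrite /P1 patchE; case: ifP => // _; exact: powR_ge0.
  have Q0 y : 0 <= Q y.
    by rewrite /Q patchE; case: ifP => // _; exact: powR_ge0.
  have [xpi|xpi] := ltP x pi.
    apply: (@le_trans _ _ (P1 (x + 0) + 2 * P1 (x + pi) + P1 (x + pi *+ 2))); last first.
      have pC : 0 <= pi ^+ 2 * C :> R by apply: mulr_ge0 => //; exact: sqr_ge0.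
    by rewrite /m lerDl; apply: mulr_ge0.
    have pi0 := pi_gt0 R.
    apply: (le_trans (ler_normD _ _)); apply: lerD; last first.
      by apply: P_le => //; rewrite mulr2n; lra.
    apply: (le_trans (ler_normB _ _)); apply: lerD.
      by rewrite addr0; apply: P_le => //; lra.
    rewrite normrMn -[leLHS]mulr_natl ler_pM2l//.
    by apply: P_le => //; lra.
  have x0 : 0 < x by apply: lt_le_trans xpi; exact: pi_gt0.
  apply: (@le_trans _ _ (pi ^+ 2 * C * Q x)); last first.
    rewrite /m lerDr; apply: addr_ge0 => //; apply: addr_ge0 => //.
    by apply: mulr_ge0.
  have pi0 := pi_gt0 R.
  have -> : D2 (P (l_ n)) x = powexp (z - 1) a (l_ n) x -
     powexp (z - 1) a (l_ n) (x + pi) *+ 2 + powexp (z - 1) a (l_ n) (x + pi *+ 2).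
    by rewrite /D2 /P !restrict_pinf x0 !ifT// ?mulr2n; lra.
  rewrite -mulrA; apply: (@second_difference_le R _ (powexp1 (z - 1) a (l_ n))
    (powexp2 (z - 1) a (l_ n))) => //.
  + move=> y /andP[xy _]; apply: is_derive_powexp; exact: lt_le_trans xy.
  + move=> y /andP[xy _]; apply: is_derive_powexp1; exact: lt_le_trans xy.
  + move=> y /andP[xy _].
    have y0 : 0 < y by exact: lt_le_trans xy.
    apply: (le_trans (CP _ _ (l0 n) y0)); rewrite ler_wpM2l//.
    rewrite /Q patchE mem_set/=; last by rewrite in_itv/= xpi.
    have -> : z - 1 - 2 = - (3 - z) by ring.
    have -> : z - 3 = - (3 - z) by ring.
    rewrite !powRN lef_pV2 ?posrE ?powR_gt0//.
    apply: ge0_ler_powR; rewrite ?nnegrE ?(ltW x0) ?(ltW y0)//.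
    by move: z2; lra.
by [].
Qed.

End abel.


(** * The Gamma integral along a rotated ray *)

Section gamma_rotation.
Variable z : R.
Hypothesis z0 : 0 < z.

(** With [K th := \int x `^ (z - 1) * exp (- x e^(- i th)) = Kc th + i Ks th], the
    rotation of the contour is replaced by the differential equation [K' = i z K]. *)
Let kc (th x : R) := x `^ (z - 1) * (expR (- (x * cos th)) * cos (x * sin th)).
Let ks (th x : R) := x `^ (z - 1) * (expR (- (x * cos th)) * sin (x * sin th)).
Let Kc th := \int[mu]_(x in pinf) kc th x.
Let Ks th := \int[mu]_(x in pinf) ks th x.
(** The derivatives of [kc] and [ks] in [th]: differentiation brings out a factor [x], whence [x^z],
    and the addition formulas merge the two terms. *)
Let dkc (th x : R) := x `^ z * (expR (- (x * cos th)) * sin (th - x * sin th)).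
Let dks (th x : R) := x `^ z * (expR (- (x * cos th)) * cos (th - x * sin th)).

Let int_dom (s c : R) : -1 < s -> 0 < c ->
  mu.-integrable pinf (EFin \o (fun x => x `^ s * expR (- (x * c)))).
Proof.
move=> s1 c0; have := @integrable_powexp R s 1 c s1 ltr01 c0.
apply: eq_integrable; first exact: measurable_itv.
move=> x; rewrite in_pinf => x0 /=; congr (_%:E).
by rewrite /powexp powRr1 ?ltW// (mulrC c).
Qed.

Let mk s th (f : R -> R) : measurable_fun setT f ->
  measurable_fun setT (fun x => x `^ s * (expR (- (x * cos th)) * f x)).
Proof.
move=> mf; apply: measurable_funM; first exact: measurable_powR.
apply: measurable_funM => //; apply: measurableT_comp => //.
by apply: measurableT_comp => //; exact: measurable_funM.
Qed.

Let int_k s th (f : R -> R) : -1 < s -> 0 < cos th -> measurable_fun setT f ->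
  (forall x, `|f x| <= 1) ->
  mu.-integrable pinf (EFin \o (fun x => x `^ s * (expR (- (x * cos th)) * f x))).
Proof.
move=> s1 c0 mf f1.
apply: (@le_integrable_R _ _ (measurableTypeR R) mu _ _
  (fun x => x `^ s * expR (- (x * cos th)))) => //.
- by apply: measurable_funS (mk s th mf).
- move=> x _; rewrite mulrA normrM ger0_norm; last first.
    by rewrite mulr_ge0 ?powR_ge0 ?expR_ge0.
  by rewrite ler_piMr// mulr_ge0 ?powR_ge0 ?expR_ge0.
- exact: int_dom.
Qed.

Let mcos (f : R -> R) : measurable_fun setT f -> measurable_fun setT (cos \o f).
Proof. by move=> mf; apply: measurableT_comp => //; exact: continuous_measurable_fun (@continuous_cos R). Qed.

Let msin (f : R -> R) : measurable_fun setT f -> measurable_fun setT (sin \o f).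
Proof. by move=> mf; apply: measurableT_comp => //; exact: continuous_measurable_fun (@continuous_sin R). Qed.

Let mlin (c : R) : measurable_fun setT (fun x : R => x * c).
Proof. exact: measurable_funM. Qed.

Let mlin2 (d c : R) : measurable_fun setT (fun x : R => d - x * c).
Proof. by apply: measurable_funB => //; exact: measurable_funM. Qed.

Let z1 : -1 < z - 1. Proof. by move: z0; lra. Qed.

Let zN1 : -1 < z. Proof. by move: z0; lra. Qed.

Let int_kc th : 0 < cos th -> mu.-integrable pinf (EFin \o kc th).
Proof.
by move=> c; apply: int_k => //; [exact: mcos|move=> x; exact: norm_cos_le1].
Qed.

Let int_ks th : 0 < cos th -> mu.-integrable pinf (EFin \o ks th).
Proof.
by move=> c; apply: int_k => //; [exact: msin|move=> x; exact: norm_sin_le1].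
Qed.

Let int_dkc th : 0 < cos th -> mu.-integrable pinf (EFin \o dkc th).
Proof.
by move=> c; apply: int_k => //; [exact: msin|move=> x; exact: norm_sin_le1].
Qed.

Let int_dks th : 0 < cos th -> mu.-integrable pinf (EFin \o dks th).
Proof.
by move=> c; apply: int_k => //; [exact: mcos|move=> x; exact: norm_cos_le1].
Qed.

Let is_derive_sin (g : R -> R) (x a : R) : is_derive x 1 g a ->
  is_derive x 1 (fun y => sin (g y)) (cos (g x) * a).
Proof. by move=> ga; apply: (@is_derive1_comp _ sin g). Qed.

Let is_derive_cos (g : R -> R) (x a : R) : is_derive x 1 g a ->
  is_derive x 1 (fun y => cos (g y)) (- sin (g x) * a).
Proof. by move=> ga; apply: (@is_derive1_comp _ cos g). Qed.

Let is_derive_exp (g : R -> R) (x a : R) : is_derive x 1 g a ->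
  is_derive x 1 (fun y => expR (g y)) (expR (g x) * a).
Proof. by move=> ga; apply: (@is_derive1_comp _ expR g). Qed.

Let is_derive_lin (c x : R) : is_derive x 1 (fun y => y * c) c.
Proof.
have := is_derive1_scale c (is_derive_id x (1 : R)); rewrite mulr1.
by under eq_fun do rewrite mulrC.
Qed.

Let is_derive_opp (g : R -> R) (x a : R) : is_derive x 1 g a ->
  is_derive x 1 (fun y => - g y) (- a).
Proof. by move=> ga; exact: is_deriveN. Qed.

Let is_derive_kc (th x : R) : 0 < x -> is_derive th 1 (kc ^~ x) (dkc th x).
Proof.
move=> x0; have dc := is_derive_cos (is_derive_id th (1 : R)).
have ds := is_derive_sin (is_derive_id th (1 : R)).
have d1 := is_derive_exp (is_derive_opp (is_derive1_scale x dc)).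
have d2 := is_derive_cos (is_derive1_scale x ds).
have := is_derive1_scale (x `^ (z - 1)) (is_derive1_mul d1 d2).
have xz : x `^ z = x `^ (z - 1) * x by rewrite mulrC mulr_powRB1// ltW.
set A := (X in is_derive _ _ _ X); set B := (X in _ -> is_derive _ _ _ X).
suff -> : A = B by [].
by rewrite /A /B /dkc xz sinB; ring.
Qed.

Let is_derive_ks (th x : R) : 0 < x -> is_derive th 1 (ks ^~ x) (dks th x).
Proof.
move=> x0; have dc := is_derive_cos (is_derive_id th (1 : R)).
have ds := is_derive_sin (is_derive_id th (1 : R)).
have d1 := is_derive_exp (is_derive_opp (is_derive1_scale x dc)).
have d2 := is_derive_sin (is_derive1_scale x ds).
have := is_derive1_scale (x `^ (z - 1)) (is_derive1_mul d1 d2).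
have xz : x `^ z = x `^ (z - 1) * x by rewrite mulrC mulr_powRB1// ltW.
set A := (X in is_derive _ _ _ X); set B := (X in _ -> is_derive _ _ _ X).
suff -> : A = B by [].
by rewrite /A /B /dks xz cosB; ring.
Qed.

(** Boundary terms of the integrations by parts. At infinity [x^(z + 1) exp (- x cos th)] is
    bounded, which leaves a factor [1 / x]; at the origin [x^z] tends to [0]. *)
Let boundary th (f : R -> R) : 0 < cos th -> (forall x, `|f x| <= 1) ->
  (fun x => x `^ z * (expR (- (x * cos th)) * f x)) n.+1%:R -
  (fun x => x `^ z * (expR (- (x * cos th)) * f x)) n.+2%:R^-1
   @[n --> \oo] --> 0.
Proof.
move=> c0 f1; rewrite -(subr0 0); apply: cvgB; apply: norm_cvg0.
- have k0 : 0 < z + 1 by move: z0; lra.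
  pose C := (z + 1) `^ (z + 1) / (cos th) `^ (z + 1).
  apply: (@squeeze_cvgr _ _ _ _ (cst 0) (fun n : nat => C * n.+1%:R^-1)).
  + apply: nearW => n /=; rewrite normr_ge0/=.
    have n0 : 0 < n.+1%:R :> R by [].
    rewrite mulrA normrM (le_trans (ler_piMr _ (f1 _)))//.
    rewrite ger0_norm ?mulr_ge0 ?powR_ge0 ?expR_ge0//.
    have := @powR_expRN_le R (z + 1) (n.+1%:R * cos th) k0 _.
    rewrite mulr_ge0 ?(ltW c0)// => /(_ isT).
    rewrite powRM ?(ltW c0)// powRD ?pnatr_eq0 ?implybT//.
    rewrite powRr1// => H.
    rewrite /C ler_pdivlMr// ler_pdivlMr ?powR_gt0//; apply: le_trans H.
    by rewrite le_eqVlt; apply/orP; left; apply/eqP; ring.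
  + exact: cvg_cst.
  + rewrite -(mulr0 C); apply: cvgM; first exact: cvg_cst.
    exact: cvg_harmonic.
- apply: (@squeeze_cvgr _ _ _ _ (cst 0) (fun n : nat => n.+2%:R^-1 `^ z)).
  + apply: nearW => n /=; rewrite normr_ge0/=.
    rewrite mulrA normrM (le_trans (ler_piMr _ (f1 _)))//.
    rewrite ger0_norm ?mulr_ge0 ?powR_ge0 ?expR_ge0// ler_piMr ?powR_ge0//.
    by rewrite -expR0 ler_expR oppr_le0 mulr_ge0 ?(ltW c0).
  + exact: cvg_cst.
  + have := @powR_cvg0 R z z0.
    move=> /cvg_at_rightP; apply; split; first by move=> n; rewrite invr_gt0.
    by have := cvg_invSn 1; under eq_fun do rewrite addn1.
Qed.

Let ibp_improper (F f : R -> R) :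
  (forall x : R, 0 < x -> is_derive x 1 F (f x)) ->
  (forall x : R, 0 < x -> {for x, continuous f}) ->
  F n.+1%:R - F n.+2%:R^-1 @[n --> \oo] --> 0 ->
  mu.-integrable pinf (EFin \o f) -> \int[mu]_(x in pinf) f x = 0.
Proof.
move=> dF cf lF intf.
apply: (Rintegral_improper _ _ _ pinf_bigcup _ _ _ lF) => //.
- move=> n; apply: (@lt_le_trans _ _ 1); last by rewrite ler1n.
  by rewrite invf_lt1// ltr1n.
- by move=> m n mn; rewrite lef_pV2 ?posrE// ler_nat.
- by move=> m n mn; rewrite ler_nat.
- by move=> x; rewrite /= in_itv/= andbT; exact: dF.
- by move=> x; rewrite /= in_itv/= andbT; exact: cf.
Qed.

Let cont_prod (s c : R) (f : R -> R) (x a : R) : 0 < x -> is_derive x 1 f a ->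
  {for x, continuous (fun x : R => x `^ s * (expR (- (x * c)) * f x))}.
Proof.
move=> x0 fa.
have d1 := is_derive_exp (is_derive_opp (is_derive_lin c x)).
exact: is_derive1_continuous
  (is_derive1_mul (is_derive1_powR s x0) (is_derive1_mul d1 fa)).
Qed.

Let lin2 (d c x : R) : is_derive x 1 (fun y => d - y * c) (0 - c).
Proof. by apply: is_deriveB; exact: is_derive_lin. Qed.

(** The derivative in [x] of [x^z exp (- x cos th) sin (x sin th)] is [z * ks th x + dkc th x].
    Integrating it expresses the derivative of [Kc] through [Ks], which closes the differential
    system. *)
Let ibp_kc th : 0 < cos th -> \int[mu]_(x in pinf) dkc th x = - z * Ks th.
Proof.
move=> c0.
have : \int[mu]_(x in pinf) (z * ks th x + dkc th x) = 0.
  apply: (ibp_improper (F := fun x => x `^ z * (expR (- (x * cos th)) * sin (x * sin th)))).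
  - move=> x x0.
    have d1 := is_derive_exp (is_derive_opp (is_derive_lin (cos th) x)).
    have d2 := is_derive_sin (is_derive_lin (sin th) x).
    have := is_derive1_mul (is_derive1_powR z x0) (is_derive1_mul d1 d2).
    set A := (X in is_derive _ _ _ X); set B := (X in _ -> is_derive _ _ _ X).
    suff -> : A = B by [].
    by rewrite /A /B /ks /dkc sinB; ring.
  - move=> x x0; apply: continuousD; last first.
      exact: cont_prod x0 (is_derive_sin (lin2 _ _ _)).
    apply: continuousM; first exact: cvg_cst.
    exact: cont_prod x0 (is_derive_sin (is_derive_lin _ _)).
  - by apply: (@boundary th (fun x => sin (x * sin th))) => // x; exact: norm_sin_le1.
  - have mpinf : measurable (pinf : set (measurableTypeR R)) by exact: measurable_itv.
    exact: (integrableD_R mpinf (integrableZ_R mpinf z (int_ks c0)) (int_dkc c0)).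
rewrite RintegralD//; last 2 first.
- by apply: (integrableZ_R _ z (int_ks c0)).
- exact: int_dkc.
rewrite RintegralZl//; last exact: int_ks.
rewrite -/(Ks th) => /eqP; rewrite addrC addr_eq0 => /eqP ->.
by rewrite mulNr.
Qed.

Let ibp_ks th : 0 < cos th -> \int[mu]_(x in pinf) dks th x = z * Kc th.
Proof.
move=> c0.
have : \int[mu]_(x in pinf) (z * kc th x - dks th x) = 0.
  apply: (ibp_improper (F := fun x => x `^ z * (expR (- (x * cos th)) * cos (x * sin th)))).
  - move=> x x0.
    have d1 := is_derive_exp (is_derive_opp (is_derive_lin (cos th) x)).
    have d2 := is_derive_cos (is_derive_lin (sin th) x).
    have := is_derive1_mul (is_derive1_powR z x0) (is_derive1_mul d1 d2).
    set A := (X in is_derive _ _ _ X); set B := (X in _ -> is_derive _ _ _ X).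
    suff -> : A = B by [].
    by rewrite /A /B /kc /dks cosB; ring.
  - move=> x x0; apply: continuousB; last first.
      exact: cont_prod x0 (is_derive_cos (lin2 _ _ _)).
    apply: continuousM; first exact: cvg_cst.
    exact: cont_prod x0 (is_derive_cos (is_derive_lin _ _)).
  - by apply: (@boundary th (fun x => cos (x * sin th))) => // x; exact: norm_cos_le1.
  - have mpinf : measurable (pinf : set (measurableTypeR R)) by exact: measurable_itv.
    exact: (integrableB_R mpinf (integrableZ_R mpinf z (int_kc c0)) (int_dks c0)).
rewrite RintegralB//; last 2 first.
- by apply: (integrableZ_R _ z (int_kc c0)).
- exact: int_dks.
rewrite RintegralZl//; last exact: int_kc.
by rewrite -/(Kc th) => /eqP; rewrite subr_eq0 => /eqP.
Qed.

(** A neighbourhood of [th] on which [cos] is bounded below by [cos v > 0], so that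
    [x^z exp (- x cos v)] dominates the derivatives in [th]. *)
Let range_cos (th : R) : `|th| < pi / 2 ->
  exists v, [/\ - v < th < v, v < pi / 2 &
    forall y, - v < y < v -> cos v <= cos y].
Proof.
move=> th2; exists ((`|th| + pi / 2) / 2); split.
- by rewrite -ltr_norml; lra.
- by lra.
- move=> y; rewrite -ltr_norml => yv; have -> : cos y = cos `|y|.
    by case: ger0P => // _; rewrite cosN.
  have := pi_gt0 R => pi0.
  have := normr_ge0 y => y0.
  rewrite ltW// ltr_cos// in_itv/=; lra.
Qed.

Let diff_K (f df : R -> R -> R) (th : R) : `|th| < pi / 2 ->
  (forall t : R, 0 < cos t -> mu.-integrable pinf (EFin \o f t)) ->
  (forall t x : R, 0 < x -> is_derive t 1 (f ^~ x) (df t x)) ->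
  (forall (t x : R), `|df t x| <= x `^ z * expR (- (x * cos t))) ->
  is_derive th 1 (fun t => \int[mu]_(x in pinf) f t x)
    (\int[mu]_(x in pinf) df th x).
Proof.
move=> th2 intf fdf dfG.
have [v [/andP[v1 v2] v3 cv]] := range_cos th2.
have v0 : 0 < v by move: v1 v2; lra.
have cv0 : 0 < cos v.
  by apply: cos_gt0_pihalf; apply/andP; split => //; move: v3 v0; lra.
have thI : `]- v, v[%classic th by rewrite /= in_itv/= v1.
have intfI t : `]- v, v[%classic t -> mu.-integrable pinf (EFin \o f t).
  rewrite /= in_itv/= => tv; apply: intf; apply: lt_le_trans (cv _ tv).
  exact: cv0.
have derf t x : `]- v, v[%classic t -> pinf x -> derivable (f ^~ x) t 1.
  move=> _; rewrite /= in_itv/= andbT => x0.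
  by have [] := fdf t x x0.
have G0 x : 0 <= x `^ z * expR (- (x * cos v)).
  by rewrite mulr_ge0 ?powR_ge0 ?expR_ge0.
have iG := @int_dom z (cos v) zN1 cv0.
have dfE t x : 0 < x -> partial1of2 f t x = df t x.
  move=> x0; rewrite partial1of2E.
  by have := fdf t x x0 => H; rewrite derive_val.
have ub t x : `]- v, v[%classic t -> pinf x ->
    `|partial1of2 f t x| <= x `^ z * expR (- (x * cos v)).
  rewrite /= !in_itv/= andbT => tv x0; rewrite dfE//.
  apply: (le_trans (dfG _ _)); rewrite ler_wpM2l ?powR_ge0//.
  by rewrite ler_expR lerN2 ler_wpM2l ?(ltW x0)// cv.
have mpinf : measurable (pinf : set (measurableTypeR R)) by exact: measurable_itv.
have D := @derivable_under_integral R _ _ mu f pinf mpinf th (- v) v thI intfI derf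
  _ G0 iG ub.
have E := @differentiation_under_integral R _ _ mu f pinf mpinf th (- v) v thI intfI derf
  _ G0 iG ub.
apply: DeriveDef => //; rewrite -derive1E E.
by apply: eq_Rintegral => x; rewrite in_pinf => x0; rewrite dfE.
Qed.

Let norm_dk (t x u : R) : `|u| <= 1 ->
  `|x `^ z * (expR (- (x * cos t)) * u)| <= x `^ z * expR (- (x * cos t)).
Proof.
move=> u1; rewrite mulrA normrM ger0_norm; last first.
  by rewrite mulr_ge0 ?powR_ge0 ?expR_ge0.
by rewrite ler_piMr// mulr_ge0 ?powR_ge0 ?expR_ge0.
Qed.

Let cos_gt0 (th : R) : `|th| < pi / 2 -> 0 < cos th.
Proof. by rewrite ltr_norml => /cos_gt0_pihalf. Qed.

Let is_derive_Kc (th : R) : `|th| < pi / 2 -> is_derive th 1 Kc (- z * Ks th).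
Proof.
move=> th2; rewrite -ibp_kc; last exact: cos_gt0.
apply: diff_K => //.
by move=> t x; apply: norm_dk; exact: norm_sin_le1.
Qed.

Let is_derive_Ks (th : R) : `|th| < pi / 2 -> is_derive th 1 Ks (z * Kc th).
Proof.
move=> th2; rewrite -ibp_ks; last exact: cos_gt0.
apply: diff_K => //.
by move=> t x; apply: norm_dk; exact: norm_cos_le1.
Qed.

Let cst_on (f : R -> R) (th : R) : 0 < th < pi / 2 ->
  (forall y : R, `|y| < pi / 2 -> is_derive y 1 f 0) -> f th = f 0.
Proof.
move=> /andP[th0 th2] df.
have I (y : R) : 0 <= y <= th -> `|y| < pi / 2.
  by move=> /andP[y0 yt]; rewrite ger0_norm// (le_lt_trans yt).
have [|||c _] := @MVT R f (fun=> 0) 0 th.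
- by [].
- by move=> y; rewrite in_itv/= => /andP[? ?]; apply/df/I; rewrite !ltW.
- apply: derivable_within_continuous => y; rewrite in_itv/= => yt.
  by have [] := df y (I _ yt).
by rewrite mul0r => /eqP; rewrite subr_eq0 => /eqP.
Qed.

(** In the proof [U] and [V] say that the real and the imaginary part of [K(th) e^(- i z th)] are
    constant; at [th = 0] they are [Gamma z] and [0]. *)
Lemma Rintegral_gamma_sin (th : R) : 0 < th < pi / 2 ->
  \int[mu]_(x in pinf) (x `^ (z - 1) * (expR (- (x * cos th)) * sin (x * sin th)))
  = Gamma z * sin (z * th).
Proof.
move=> th2; rewrite -/(ks th) -/(Ks th).
have dz (y : R) : is_derive y 1 (fun y => z * y) z.
  by have := is_derive1_scale z (is_derive_id y (1 : R)); rewrite mulr1.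
have U : Kc th * cos (z * th) + Ks th * sin (z * th) =
         Kc 0 * cos (z * 0) + Ks 0 * sin (z * 0).
  apply: (cst_on (f := fun y => Kc y * cos (z * y) + Ks y * sin (z * y))) => //.
  move=> y y2.
  have := is_derive1_add
    (is_derive1_mul (is_derive_Kc y2) (is_derive_cos (dz y)))
    (is_derive1_mul (is_derive_Ks y2) (is_derive_sin (dz y))).
  set A := (X in is_derive _ _ _ X -> _).
  suff -> : A = 0 by [].
  by rewrite /A; ring.
have V : Ks th * cos (z * th) - Kc th * sin (z * th) =
         Ks 0 * cos (z * 0) - Kc 0 * sin (z * 0).
  apply: (cst_on (f := fun y => Ks y * cos (z * y) - Kc y * sin (z * y))) => //.
  move=> y y2.
  have := is_derive1_add
    (is_derive1_mul (is_derive_Ks y2) (is_derive_cos (dz y)))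
    (is_derive_opp (is_derive1_mul (is_derive_Kc y2) (is_derive_sin (dz y)))).
  set A := (X in is_derive _ _ _ X -> _).
  suff -> : A = 0 by [].
  by rewrite /A; ring.
have K0 : Kc 0 = Gamma z.
  apply: eq_Rintegral => x _.
  by rewrite /kc cos0 sin0 mulr0 cos0 !mulr1.
have S0 : Ks 0 = 0.
  rewrite /Ks /Rintegral (_ : integral _ _ _ = 0)//.
  apply: integral0_eq => x _.
  by rewrite /ks sin0 mulr0 sin0 !mulr0.
move: U V; rewrite mulr0 cos0 sin0 S0 K0 !mulr0 mul0r !addr0 !mulr1 subr0.
move=> U V.
transitivity ((Kc th * cos (z * th) + Ks th * sin (z * th)) * sin (z * th) +
  (Ks th * cos (z * th) - Kc th * sin (z * th)) * cos (z * th)).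
  transitivity (Ks th * (cos (z * th) ^+ 2 + sin (z * th) ^+ 2)).
    by rewrite cos2Dsin2 mulr1.
  by ring.
by rewrite U V mul0r addr0.
Qed.

(** The change of variable [x sin th] turns the rotated integral into a sine integral with [a = 1]
    and [l = cot th]; this [l] tends to [0] as [th] tends to [pi / 2]. *)
Lemma Rintegral_powexp_sin (th : R) : 0 < th < pi / 2 ->
  \int[mu]_(x in pinf) (powexp (z - 1) 1 (cos th / sin th) x * sin x) =
  sin th `^ z * (Gamma z * sin (z * th)).
Proof.
move=> th2; have /andP[t0 t2] := th2.
have pi0 := pi_gt0 R.
have s0 : 0 < sin th by apply: sin_gt0_pi; apply/andP; split => //; lra.
have c0 : 0 < cos th by apply: cos_gt0_pihalf; apply/andP; split => //; lra.
rewrite Rintegral_mkcond (Rintegral_affine 0 s0); last first.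
  rewrite -restrict_EFin; apply/(integrable_mkcond _ _).1.
    exact: measurable_itv.
  apply: (@le_integrable_R _ _ (measurableTypeR R) mu _ _
    (powexp (z - 1) 1 (cos th / sin th))) => //.
  - apply: measurable_funS (_ : measurable_fun setT _) => //.
    apply: measurable_funM; first exact: measurable_powexp.
    exact: continuous_measurable_fun (@continuous_sin R).
  - move=> x _; rewrite normrM ger0_norm ?powexp_ge0//.
    by rewrite ler_piMr ?powexp_ge0// norm_sin_le1.
  - apply: integrable_powexp => //.
    by rewrite divr_gt0.
rewrite -(Rintegral_gamma_sin th2).
rewrite -[in RHS](mulr_powRB1 (ltW s0) z0) -mulrA; congr (_ * _).
rewrite -RintegralZl//; last exact: int_ks.
rewrite [RHS]Rintegral_mkcond; apply: eq_Rintegral => x _.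
rewrite !restrict_pinf addr0 pmulr_rgt0//.
case: ifPn => // x0.
rewrite /powexp powRM ?(ltW x0) ?(ltW s0)// powRr1; last by rewrite mulr_ge0 ?ltW.
rewrite mulrA -!mulrA; congr (_ * (_ * (expR _ * sin _))); last exact: mulrC.
by field; rewrite gt_eqF.
Qed.

Lemma abel_limit_gamma : z < 2 -> abel_limit z = Gamma z * sin (z * (pi / 2)).
Proof.
move=> z2.
have pi0 := pi_gt0 R.
have pi1 := pihalf_ge1 R.
(* Since [1 / (n + 2) < 1 <= pi / 2], these angles lie strictly between [0] and [pi / 2]. *)
pose th (n : nat) : R := pi / 2 - n.+2%:R^-1.
have th2 n : 0 < th n < pi / 2.
  have H1 : n.+2%:R^-1 < 1 :> R by rewrite invf_lt1// ltr1n.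
  have H2 : 0 < n.+2%:R^-1 :> R by rewrite invr_gt0.
  rewrite /th; move: H1 H2; move: (n.+2%:R^-1) => e e1 e0.
  by apply/andP; split; lra.
have cth : th n @[n --> \oo] --> pi / 2.
  rewrite -[X in _ --> X]subr0; apply: cvgB; first exact: cvg_cst.
  by have := cvg_invSn 1; under eq_fun do rewrite addn1.
have cs : sin (th n) @[n --> \oo] --> (1 : R).
  rewrite -(@sin_pihalf R); apply: continuous_cvg cth; exact: continuous_sin.
have cc : cos (th n) @[n --> \oo] --> (0 : R).
  rewrite -(@cos_pihalf R); apply: continuous_cvg cth; exact: continuous_cos.
have l0 n : 0 < cos (th n) / sin (th n).
  have /andP[t0 t2] := th2 n; apply: divr_gt0.
    by apply: cos_gt0_pihalf; apply/andP; split => //; lra.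
  by apply: sin_gt0_pi; apply/andP; split => //; lra.
have lc : cos (th n) / sin (th n) @[n --> \oo] --> 0.
  rewrite -(mul0r (1 : R)^-1); apply: cvgM => //; apply: cvgV => //.
have A := cvg_abel z0 z2 ltr01 l0 lc.
suff B : sin (th n) `^ z * (Gamma z * sin (z * th n)) @[n --> \oo] -->
    1 * (Gamma z * sin (z * (pi / 2))).
  apply: (cvg_unique _ A) => //; rewrite -[Gamma z * _]mul1r.
  apply: cvg_trans B; apply: near_eq_cvg; apply: nearW => n.
  by rewrite /= Rintegral_powexp_sin.
apply: cvgM.
  suff : sin (th n) `^ z @[n --> \oo] --> (1 : R) `^ z by rewrite powR1.
  have cz : {for 1, continuous (fun x : R => x `^ z)}.
    exact: is_derive1_continuous (is_derive1_powR z (@ltr01 R)).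
  exact: (cvg_comp _ _ cs cz).
apply: cvgM; first exact: cvg_cst.
apply: continuous_cvg; first exact: continuous_sin.
by apply: cvgM => //; exact: cvg_cst.
Qed.

End gamma_rotation.

Lemma cvg_powexp_sin (z a : R) (l_ : nat -> R) : 0 < z -> z < 2 -> 0 < a ->
  (forall n, 0 < l_ n) -> l_ n @[n --> \oo] --> 0 ->
  \int[mu]_(x in pinf) (powexp (z - 1) a (l_ n) x * sin x) @[n --> \oo] -->
  Gamma z * sin (z * (pi / 2)).
Proof.
by move=> z0 z2 a0 l0 lc; rewrite -abel_limit_gamma//; exact: cvg_abel.
Qed.

End gamma_integrals.

(** * Gaussian laws *)

Section density.
Context d (T : measurableType d) (R : realType).
Variables (m nu : {measure set T -> \bar R}) (p : T -> R).
Hypotheses (mp : measurable_fun setT p) (p0 : forall x, 0 <= p x).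
Hypothesis nuE : forall A, measurable A -> nu A = (\int[m]_(x in A) (p x)%:E)%E.
Import HBNNSimple.
Local Open Scope ereal_scope.

Lemma ge0_integral_density (f : T -> \bar R) : measurable_fun setT f ->
  (forall x, 0 <= f x) -> \int[nu]_x f x = \int[m]_x (f x * (p x)%:E).
Proof.
move=> mf f0.
have p0' x : 0 <= (p x)%:E by rewrite lee_fin.
have mp' : measurable_fun setT (EFin \o p) by exact/measurable_EFinP.
pose f_ := nnsfun_approx measurableT mf.
have fc x : (f_ n x)%:E @[n --> \oo] --> f x by exact: cvg_nnsfun_approx.
have nd x : nondecreasing_seq (fun n => (f_ n x)%:E).
  by move=> k n kn; rewrite lee_fin; exact/lefP/nd_nnsfun_approx.
transitivity (limn (fun n => \int[nu]_x (f_ n x)%:E)).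
  rewrite -monotone_convergence//.
  - by apply: eq_integral => x _; apply/esym/cvg_lim.
  - by move=> n; exact/measurable_EFinP/measurable_funP.
  - by move=> n x _; rewrite lee_fin.
rewrite [X in limn X](_ : _ = (fun n => \int[m]_x ((f_ n x)%:E * (p x)%:E))).
  rewrite -monotone_convergence//; last 3 first.
  - move=> n; apply: emeasurable_funM => //.
    exact/measurable_EFinP/measurable_funP.
  - by move=> n x _; rewrite mule_ge0// lee_fin.
  - by move=> x _ k n kn; rewrite lee_wpmul2r// nd.
  apply: eq_integral => x _; apply/cvg_lim => //.
  by apply: cvgeZr => //; exact: fc.
apply/funext => n.
rewrite integralT_nnsfun sintegralE.
transitivity (\sum_(k \in range (f_ n))
    \int[m]_x (k%:E * ((\1_(f_ n @^-1` [set k]) x)%:E * (p x)%:E))).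
  apply: eq_fsbigr => r /set_mem [y _ yr]; rewrite nuE//.
  rewrite ge0_integralZl//; last 3 first.
  - by apply: emeasurable_funM => //; exact/measurable_EFinP.
  - by move=> x _; rewrite mule_ge0// lee_fin.
  - by rewrite lee_fin -yr.
  congr (_ * _); rewrite integral_mkcond; apply: eq_integral => x _.
  rewrite patchE indicE; case: ifPn => _; first by rewrite mul1e.
  by rewrite mul0e.
rewrite -ge0_integral_fsum//.
- apply: eq_integral => x _; rewrite [in RHS]fimfunE -fsumEFin//.
  rewrite ge0_mule_fsuml//; last by move=> r; rewrite nnfun_muleindic_ge0.
  by apply: eq_fsbigr => r _; rewrite EFinM muleA.
- move=> r; apply: emeasurable_funM => //; apply: emeasurable_funM => //.
  exact/measurable_EFinP.
- by move=> r x _; rewrite muleA mule_ge0// -EFinM nnfun_muleindic_ge0.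
Qed.

Lemma integral_density (f : T -> \bar R) : measurable_fun setT f ->
  \int[nu]_x f x = \int[m]_x (f x * (p x)%:E).
Proof.
move=> mf; rewrite integralE ge0_integral_density//; last exact: measurable_funepos.
rewrite (ge0_integral_density (measurable_funeneg mf))//.
rewrite [RHS]integralE; congr (_ - _); apply: eq_integral => x _.
- by rewrite !funeposE muleC maxe_pMr ?lee_fin// mule0 muleC.
- by rewrite !funenegE -mulNe muleC maxe_pMr ?lee_fin// mule0 muleC.
Qed.

End density.

Section reflection.
Context {R : realType}.
Local Notation mu := (@lebesgue_measure R).

Lemma ge0_integral_opp (f : R -> \bar R) : measurable_fun setT f ->
  (forall x, 0 <= f x)%E -> (\int[mu]_x f x = \int[mu]_x f (- x)%R)%E.
Proof.
move=> mf f0.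
have mo : measurable_fun setT (-%R : measurableTypeR R -> measurableTypeR R).
  exact: oppr_measurable.
have := @ge0_integral_pushforward _ _ (measurableTypeR R) (measurableTypeR R) R
  -%R mo mu setT f measurableT mf.
move=> <-//.
by apply: eq_measure_integral => A mA _; exact/esym/lebesgue_measureN.
Qed.

Lemma integral_opp (f : R -> \bar R) : measurable_fun setT f ->
  (\int[mu]_x f x = \int[mu]_x f (- x)%R)%E.
Proof.
move=> mf; rewrite integralE (ge0_integral_opp (measurable_funepos mf))//.
rewrite (ge0_integral_opp (measurable_funeneg mf))// [RHS]integralE.
by congr (_ - _)%E; apply: eq_integral => x _; rewrite ?funeposE ?funenegE.
Qed.

End reflection.

Section std_normal.
Context {R : realType}.
Local Notation mu := (@lebesgue_measure R).
Local Notation gam := (@normal_prob R 0 1).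

Definition gauss_density (y : R) : R := normal_peak 1 * expR (- (y ^+ 2 / 2)).
Local Notation gd := gauss_density.

Lemma gauss_densityE : normal_pdf 0 1 = gd.
Proof.
apply/funext => y; rewrite normal_pdfE ?oner_neq0// /gd; congr (_ * expR _).
by rewrite subr0 expr1n mulNr.
Qed.

Lemma gauss_density_ge0 y : 0 <= gd y.
Proof. by rewrite mulr_ge0 ?expR_ge0 ?normal_peak_ge0. Qed.

Lemma measurable_gauss_density : measurable_fun setT gd.
Proof. by rewrite -gauss_densityE; exact: measurable_normal_pdf. Qed.

Lemma gauss_density_opp y : gd (- y) = gd y.
Proof. by rewrite /gd sqrrN. Qed.

Lemma integral_gauss_density : (\int[mu]_x (gd x)%:E = 1)%E.
Proof. by rewrite -gauss_densityE integral_normal_pdf. Qed.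

Lemma integral_gauss (f : R -> \bar R) : measurable_fun setT f ->
  (\int[gam]_y f y = \int[mu]_y (f y * (gd y)%:E))%E.
Proof.
move=> mf; apply: integral_density => //.
- exact: measurable_gauss_density.
- exact: gauss_density_ge0.
- by move=> A mA; rewrite -gauss_densityE.
Qed.

Lemma Rintegral_gauss (f : R -> R) : measurable_fun setT f ->
  \int[gam]_y f y = \int[mu]_y (f y * gd y).
Proof.
move=> mf; rewrite /Rintegral integral_gauss; last exact/measurable_EFinP.
by [].
Qed.

Lemma integrable_gauss (f : R -> R) : measurable_fun setT f ->
  mu.-integrable setT (EFin \o (fun y => f y * gd y)) ->
  gam.-integrable setT (EFin \o f).
Proof.
move=> mf /integrableP[_ h]; apply/integrableP; split; first exact/measurable_EFinP.
rewrite integral_gauss; last first.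
  by apply/measurable_EFinP; exact: measurableT_comp.
apply: le_lt_trans h; rewrite le_eqVlt; apply/orP; left; apply/eqP.
apply: eq_integral => x _ /=.
by rewrite -EFinM normrM (ger0_norm (gauss_density_ge0 _)).
Qed.

Lemma expR_pow_le (k : nat) (u : R) : 0 <= u -> u ^+ k * expR (- u) <= k`!%:R.
Proof.
move=> u0; rewrite expRN ler_pdivrMr ?expR_gt0//.
case: k => [|k]; first by rewrite fact0 mul1r expr0 -expR0 ler_expR.
have := expR_ge1Dxn k u0.
have f0 : 0 < (k.+1)`!%:R :> R by rewrite ltr0n fact_gt0.
rewrite -lerBrDl ler_pdivrMr// => /le_trans; apply.
by rewrite mulrC ler_wpM2l ?(ltW f0)// gerBl.
Qed.

Lemma integrable_gauss_density_pow (k : nat) :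
  mu.-integrable setT (EFin \o (fun y => y ^+ k * gd y)).
Proof.
have s20 : Num.sqrt 2 != 0 :> R by rewrite sqrtr_eq0 -ltNge.
have H := @integrable_normal_pdf R 0 (Num.sqrt 2).
(* From [|y|^k <= 1 + y^(2k)] and [(y^2 / 4)^k exp (- y^2 / 4) <= k!]: half of the Gaussian exponent
   absorbs the power, and the other half is a normal density of variance [2]. *)
pose C : R := 1 + (4 ^+ k * k`!%:R).
apply: (@le_integrable_R _ _ (measurableTypeR R) mu _ _ (fun y =>
   normal_peak 1 / normal_peak (Num.sqrt 2) * C * normal_pdf 0 (Num.sqrt 2) y)) => //.
- apply: measurable_funM; last exact: measurable_gauss_density.
  exact: measurable_funX.
- move=> y _.
  rewrite normrM (ger0_norm (gauss_density_ge0 _)) normrX.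
  rewrite normal_pdfE//= /normal_fun subr0 sqr_sqrtr// /gd.
  have np := normal_peak_gt0 s20.
  set e := expR _; set e' := expR _.
  have -> : e = expR (- (y ^+ 2 / 4)) * expR (- (y ^+ 2 / 4)).
    by rewrite -expRD; congr expR; field.
  have -> : e' = expR (- (y ^+ 2 / 4)).
    by congr expR; rewrite mulNr -mulr_natr -natrM.
  set w := expR _.
  have w0 : 0 <= w by exact: expR_ge0.
  have -> : normal_peak 1 / normal_peak (Num.sqrt 2) * C * (normal_peak (Num.sqrt 2) * w)
     = normal_peak 1 * (C * w) by field; rewrite gt_eqF.
  rewrite mulrCA ler_wpM2l ?normal_peak_ge0// mulrA ler_wpM2r//.
  have H1 : `|y| ^+ k <= 1 + (y ^+ 2) ^+ k.
    have [y1|y1] := leP `|y| 1.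
      apply: (@le_trans _ _ 1); first by apply: exprn_ile1.
      by rewrite lerDl exprn_ge0 ?sqr_ge0.
    rewrite -[y ^+ 2]ger0_norm ?sqr_ge0// normrX -exprM mulnC exprM.
    set v := `|y| ^+ k; have v1 : 1 <= v by rewrite exprn_ege1// ltW.
    apply: (@le_trans _ _ (v ^+ 2)); last by rewrite lerDr.
    by rewrite expr2 ler_peMr// (le_trans ler01).
  apply: (le_trans (ler_wpM2r w0 H1)); rewrite mulrDl mul1r /C; apply: lerD.
    by rewrite /w -expR0 ler_expR oppr_le0 divr_ge0// sqr_ge0.
  have := @expR_pow_le k (y ^+ 2 / 4) _; rewrite divr_ge0 ?sqr_ge0// => /(_ isT).
  rewrite expr_div_n -/w mulrAC ler_pdivrMr ?exprn_gt0//.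
  by rewrite [leRHS]mulrC.
- exact: (integrableZ_R measurableT _ H).
Qed.

Let mcos (t : R) : measurable_fun setT (fun y : R => cos (t * y)).
Proof.
apply: measurableT_comp; last exact: measurable_funM.
exact: continuous_measurable_fun (@continuous_cos R).
Qed.

Let msin (t : R) : measurable_fun setT (fun y : R => sin (t * y)).
Proof.
apply: measurableT_comp; last exact: measurable_funM.
exact: continuous_measurable_fun (@continuous_sin R).
Qed.

Let int_pow (k : nat) (f : R -> R) : measurable_fun setT f ->
  (forall y, `|f y| <= 1) ->
  mu.-integrable setT (EFin \o (fun y => f y * (y ^+ k * gd y))).
Proof.
move=> mf f1.
apply: (@le_integrable_R _ _ (measurableTypeR R) mu _ _
  (Num.norm \o (fun y => y ^+ k * gd y))) => //.
- apply: measurable_funM => //; apply: measurable_funM; last exact: measurable_gauss_density.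
  exact: measurable_funX.
- by move=> y _; rewrite normrM ler_piMl.
- exact: (integrable_norm (integrable_gauss_density_pow k)).
Qed.

Let is_derive_gd (y : R) : is_derive y 1 gd (- y * gd y).
Proof.
have d2 : is_derive y 1 (fun y : R => - (y ^+ 2 / 2)) (- y).
  have := is_derive1_scale (- 2^-1) (is_derive1_mul (is_derive_id y (1 : R)) (is_derive_id y (1 : R))).
  have -> : - 2^-1 * (1 * y + y * 1) = - y by field.
  by under eq_fun do rewrite -expr2 mulNr mulrC.
have := is_derive1_scale (normal_peak 1) (@is_derive1_comp R expR _ y _ _ (is_derive_expR _) d2).
have -> : normal_peak 1 * (expR (- (y ^+ 2 / 2)) * - y) = - y * gd y.
  by rewrite /gd; ring.
by [].
Qed.

Let R_bigcup : setT = \bigcup_n (`[- n.+1%:R, n.+1%:R]%classic : set R).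
Proof.
apply/seteqP; split => x //= _.
exists (Num.truncn `|x|) => //=; rewrite in_itv/= -ler_norml.
exact/ltW/truncnS_gt.
Qed.

(** The bound on [F] makes the boundary terms of order [1 / |y|], since [y^2 exp (- y^2 / 2) <= 2].
    With suitable [F] this yields the mean, the variance and the characteristic function of the
    standard normal law. *)
Let gd_ibp (F f : R -> R) : (forall x : R, is_derive x 1 F (f x)) ->
  continuous f -> (forall y, 1 <= `|y| -> `|F y| <= `|y| * gd y) ->
  mu.-integrable setT (EFin \o f) -> \int[mu]_x f x = 0.
Proof.
move=> dF cf FC intf.
apply: (Rintegral_improper _ _ _ R_bigcup _ _ intf).
- by move=> n; rewrite (@lt_trans _ _ 0)// oppr_lt0.
- by move=> a b ab; rewrite lerN2 ler_nat.
- by move=> a b ab; rewrite ler_nat.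
- by move=> x _; exact: cf.
have FC' (y : R) : 1 <= `|y| -> `|F y| <= normal_peak 1 * 2 * `|y|^-1.
  move=> y1; apply: (le_trans (FC _ y1)); rewrite /gd.
  have y0 : 0 < `|y| by exact: lt_le_trans y1.
  have := @expR_pow_le 1 (y ^+ 2 / 2) _; rewrite divr_ge0 ?sqr_ge0// => /(_ isT).
  have -> : (1`! = 1)%N by [].
  rewrite expr1 mulrAC ler_pdivrMr// mul1r => H.
  rewrite mulrCA -mulrA ler_wpM2l ?normal_peak_ge0//.
  by rewrite ler_pdivlMr// mulrC mulrA -expr2 -normrX ger0_norm ?sqr_ge0.
rewrite -(subr0 0); apply: cvgB; apply: norm_cvg0.
- apply: (@squeeze_cvgr _ _ _ _ (cst 0) (fun n : nat => normal_peak 1 * 2 * n.+1%:R^-1)).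
  + apply: nearW => n /=; rewrite normr_ge0/=.
    have := FC' n.+1%:R; rewrite normr_nat; apply; by rewrite ler1n.
  + exact: cvg_cst.
  + rewrite -(mulr0 (normal_peak 1 * 2)); apply: cvgM; first exact: cvg_cst.
    exact: cvg_harmonic.
- apply: (@squeeze_cvgr _ _ _ _ (cst 0) (fun n : nat => normal_peak 1 * 2 * n.+1%:R^-1)).
  + apply: nearW => n /=; rewrite normr_ge0/=.
    have := FC' (- n.+1%:R); rewrite normrN normr_nat; apply; by rewrite ler1n.
  + exact: cvg_cst.
  + rewrite -(mulr0 (normal_peak 1 * 2)); apply: cvgM; first exact: cvg_cst.
    exact: cvg_harmonic.
Qed.

Let continuous_gd : continuous gd.
Proof. by move=> y; exact: is_derive1_continuous (is_derive_gd y). Qed.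

Lemma gauss_mean : \int[mu]_y (y * gd y) = 0.
Proof.
have := @gd_ibp gd (fun y => - y * gd y) is_derive_gd _ _ _.
move=> H; suff : \int[mu]_y (- y * gd y) = 0.
  under eq_Rintegral do rewrite mulNr -mulN1r.
  rewrite RintegralZl//.
    by move=> /eqP; rewrite mulN1r oppr_eq0 => /eqP.
  by have := integrable_gauss_density_pow 1; under eq_fun do rewrite expr1.
apply: H.
- move=> y; apply: continuousM; last exact: continuous_gd.
  exact: (is_derive1_continuous (is_deriveN (is_derive_id y (1 : R)))).
- by move=> y y1; rewrite ger0_norm ?gauss_density_ge0// ler_peMl ?gauss_density_ge0.
- have := integrableZ_R measurableT (-1) (integrable_gauss_density_pow 1).
  by under eq_fun do rewrite expr1 mulrA mulN1r.
Qed.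

Lemma gauss_variance : \int[mu]_y (y ^+ 2 * gd y) = 1.
Proof.
have i0 : mu.-integrable setT (EFin \o gd).
  by have := integrable_gauss_density_pow 0; under eq_fun do rewrite expr0 mul1r.
have := @gd_ibp (fun y => y * gd y) (fun y => gd y - y ^+ 2 * gd y) _ _ _ _.
move=> H; have : \int[mu]_y (gd y - y ^+ 2 * gd y) = 0.
  apply: H.
  - move=> y; have := is_derive1_mul (is_derive_id y (1 : R)) (is_derive_gd y).
    by have -> : 1 * gd y + y * (- y * gd y) = gd y - y ^+ 2 * gd y by ring.
  - move=> y; apply: continuousB; first exact: continuous_gd.
    apply: continuousM; last exact: continuous_gd.
    exact: sqr_continuous.
  - by move=> y y1; rewrite normrM (ger0_norm (gauss_density_ge0 _)).
  - exact: (integrableB_R measurableT i0 (integrable_gauss_density_pow 2)).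
rewrite RintegralB//; last exact: (integrable_gauss_density_pow 2).
rewrite {1}/Rintegral integral_gauss_density/= => /eqP.
by rewrite subr_eq0 => /eqP <-.
Qed.

(** The characteristic function, determined from [phi' = - t phi]: the derivative is taken under the
    integral sign, and [sin (t y) * gd y] is the function whose derivative is integrated. *)
Let phi (t : R) := \int[mu]_y (cos (t * y) * gd y).

Let is_derive_phi (t : R) : is_derive t 1 phi (- t * phi t).
Proof.
have lin (y u : R) : is_derive u 1 (fun t : R => t * y) y.
  have := is_derive1_mul (is_derive_id u (1 : R)) (is_derive_cst y u (1 : R)).
  by rewrite mul1r mulr0 addr0.
have lin' (u y : R) : is_derive y 1 (fun y : R => u * y) u.
  by have := is_derive1_scale u (is_derive_id y (1 : R)); rewrite mulr1.
have i0 u : mu.-integrable setT (EFin \o (fun y => cos (u * y) * gd y)).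
  have := int_pow 0 (mcos u) (fun y => norm_cos_le1 _).
  by under eq_fun do rewrite expr0 mul1r.
have i1 u : mu.-integrable setT (EFin \o (fun y => sin (u * y) * (y * gd y))).
  have := int_pow 1 (msin u) (fun y => norm_sin_le1 _).
  by under eq_fun do rewrite expr1.
have derf (u y : R) : is_derive u 1 ((fun u y : R => cos (u * y) * gd y) ^~ y)
    (- (sin (u * y) * (y * gd y))).
  have := is_derive1_mul (@is_derive1_comp R cos _ u _ _ (is_derive_cos _) (lin y u))
     (is_derive_cst (gd y) u (1 : R)).
  set A := (X in is_derive _ _ _ X); set B := (X in _ -> is_derive _ _ _ X).
  suff -> : A = B by [].
  by rewrite /A /B /=; ring.
have dE u y : partial1of2 (fun u y : R => cos (u * y) * gd y) u y =
    - (sin (u * y) * (y * gd y)).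
  by rewrite partial1of2E; have := derf u y => H; rewrite derive_val.
have G0 (y : R) : 0 <= `|y ^+ 1 * gd y| by [].
have iG := integrable_norm (integrable_gauss_density_pow 1).
have ub u y : `]t - 1, t + 1[%classic u -> [set: R] y ->
   `|partial1of2 (fun u y : R => cos (u * y) * gd y) u y| <= `|y ^+ 1 * gd y|.
  by move=> _ _; rewrite dE normrN normrM expr1 ler_piMl// norm_sin_le1.
have tI : `]t - 1, t + 1[%classic t by rewrite /= in_itv/=; lra.
have df u y : `]t - 1, t + 1[%classic u -> [set: R] y ->
    derivable ((fun u y : R => cos (u * y) * gd y) ^~ y) u 1.
  by move=> _ _; have [] := derf u y.
have D := @derivable_under_integral R _ _ mu _ setT measurableT t (t - 1) (t + 1)
  tI (fun u _ => i0 u) df _ G0 iG ub.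
have E := @differentiation_under_integral R _ _ mu _ setT measurableT t (t - 1) (t + 1)
  tI (fun u _ => i0 u) df _ G0 iG ub.
apply: DeriveDef => //; rewrite -derive1E E.
transitivity (\int[mu]_y (- 1 * (sin (t * y) * (y * gd y)))).
  by apply: eq_Rintegral => y _; rewrite dE mulN1r.
rewrite RintegralZl//.
have cF : continuous (fun y : R => t * (cos (t * y) * gd y) - sin (t * y) * (y * gd y)).
  move=> y; have cl := is_derive1_continuous (lin' t y).
  have cc : {for y, continuous (fun y => cos (t * y))}.
    by apply: (continuous_comp cl); exact: continuous_cos.
  have cs : {for y, continuous (fun y => sin (t * y))}.
    by apply: (continuous_comp cl); exact: continuous_sin.
  apply: cvgB.
    apply: cvgM; first exact: cvg_cst.
    by apply: cvgM; [exact: cc|exact: continuous_gd].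
  by apply: cvgM; [exact: cs|apply: cvgM; [exact: cvg_id|exact: continuous_gd]].
have : \int[mu]_y (t * (cos (t * y) * gd y) - sin (t * y) * (y * gd y)) = 0.
  apply: (@gd_ibp (fun y => sin (t * y) * gd y)).
  - move=> y.
    have := is_derive1_mul (@is_derive1_comp R sin _ y _ _ (is_derive_sin _) (lin' t y))
     (is_derive_gd y).
    set A := (X in is_derive _ _ _ X); set B := (X in _ -> is_derive _ _ _ X).
    suff -> : A = B by [].
    by rewrite /A /B /=; ring.
  - exact: cF.
  - move=> y y1; rewrite normrM (ger0_norm (gauss_density_ge0 _)).
    rewrite ler_wpM2r ?gauss_density_ge0// (le_trans _ y1)//.
    exact: norm_sin_le1.
  - exact: (integrableB_R measurableT (integrableZ_R measurableT t (i0 t)) (i1 t)).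
rewrite RintegralB//; last exact: (integrableZ_R measurableT t (i0 t)).
rewrite RintegralZl// -/(phi t) => /eqP; rewrite subr_eq0 => /eqP <-.
by rewrite mulN1r mulNr.
Qed.

Lemma gauss_char_cos (t : R) : \int[mu]_y (cos (t * y) * gd y) = expR (- (t ^+ 2 / 2)).
Proof.
rewrite -/(phi t).
have d2 (u : R) : is_derive u 1 (fun y : R => y ^+ 2 / 2) u.
  have := is_derive1_scale (2^-1) (is_derive1_mul (is_derive_id u (1 : R)) (is_derive_id u (1 : R))).
  have -> : 2^-1 * (1 * u + u * 1) = u by field.
  by under eq_fun do rewrite -expr2 mulrC.
have dz (u : R) : is_derive u 1 (fun u => phi u * expR (u ^+ 2 / 2)) 0.
  have := is_derive1_mul (is_derive_phi u)
    (@is_derive1_comp R expR _ u _ _ (is_derive_expR _) (d2 u)).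
  set A := (X in is_derive _ _ _ X -> _).
  suff -> : A = 0 by [].
  by rewrite /A /=; ring.
have := is_derive_0_is_cst t 0 dz.
have -> : phi 0 = 1.
  rewrite /phi; under eq_Rintegral do rewrite mul0r cos0 mul1r.
  by rewrite /Rintegral integral_gauss_density.
rewrite expr0n/= mul0r expR0 mulr1 expRN => H.
have e0 : expR (t ^+ 2 / 2) != 0 by rewrite gt_eqF// expR_gt0.
by apply: (mulIf e0); rewrite H mulVf.
Qed.

Lemma gauss_char_sin (t : R) : \int[mu]_y (sin (t * y) * gd y) = 0.
Proof.
have E : \int[mu]_y (sin (t * y) * gd y) = - \int[mu]_y (sin (t * y) * gd y).
  rewrite [in LHS]/Rintegral integral_opp; last first.
    apply/measurable_EFinP; apply: measurable_funM => //.
    exact: measurable_gauss_density.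
  rewrite -mulN1r -RintegralZl//; last first.
    have := int_pow 0 (msin t) (fun y => norm_sin_le1 _).
    by under eq_fun do rewrite expr0 mul1r.
  apply: eq_Rintegral => y _.
  by rewrite gauss_density_opp mulrN sinN mulN1r mulNr.
by move: E; lra.
Qed.

End std_normal.

Lemma integral_transport d d1 d2 (T : measurableType d) (T1 : measurableType d1)
    (T2 : measurableType d2) (R : realType) (m1 : {measure set T1 -> \bar R})
    (m2 : {measure set T2 -> \bar R}) (X1 : T1 -> T) (X2 : T2 -> T) :
  (forall g : T -> \bar R, measurable_fun setT g -> (forall x, 0 <= g x)%E ->
     \int[m1]_x g (X1 x) = \int[m2]_x g (X2 x))%E ->
  forall g : T -> \bar R, measurable_fun setT g ->
     (\int[m1]_x g (X1 x) = \int[m2]_x g (X2 x))%E.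
Proof.
move=> H g mg.
have Ep := H g^\+%E (measurable_funepos mg) (fun=> funepos_ge0 _ _).
have En := H g^\-%E (measurable_funeneg mg) (fun=> funeneg_ge0 _ _).
rewrite integralE [RHS]integralE; congr (_ - _)%E.
- transitivity (\int[m1]_x g^\+ (X1 x))%E.
    by apply: eq_integral => x _; rewrite !funeposE.
  by rewrite Ep; apply: eq_integral => x _; rewrite !funeposE.
- transitivity (\int[m1]_x g^\- (X1 x))%E.
    by apply: eq_integral => x _; rewrite !funenegE.
  by rewrite En; apply: eq_integral => x _; rewrite !funenegE.
Qed.

Section gaussian_law.
Context {R : realType} d (T : measurableType d) (P : probability T R).
Local Notation mu := (@lebesgue_measure R).
Local Notation gam := (@normal_prob R 0 1).

(** With [s = 0] the right-hand side is [f m], so that point masses need no separate treatment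
    afterwards. For [s != 0] the law [normal_prob m s] depends on [s] only through [|s|], which is
    the witness. *)
Lemma gaussian_rv_law (X : T -> R) : measurable_fun setT X -> gaussian_rv P X ->
  exists m s : R, 0 <= s /\ forall f : R -> \bar R, measurable_fun setT f ->
    (\int[P]_w f (X w) = \int[gam]_y f (m + s * y)%R)%E.
Proof.
move=> mX [m [s PX]]; exists m, `|s|; split=> //.
apply: integral_transport => f mf f0.
rewrite -(@ge0_integral_pushforward _ _ _ (measurableTypeR R) _ _ mX P setT f measurableT mf)//.
move: PX; have [-> PX|s0 PX] := eqVneq s 0.
  transitivity (\int[\d_(m : measurableTypeR R)]_y f y)%E.
    by apply: eq_measure_integral => A mA _; exact: PX.
  rewrite integral_dirac//= diracT mul1e normr0.
  under eq_integral do rewrite mul0r addr0.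
  by rewrite integral_cst// [X in (_ * X)%E]probability_setT mule1.
transitivity (\int[normal_prob m s]_y f y)%E.
  by apply: eq_measure_integral => A mA _; exact: PX.
transitivity (\int[mu]_y (f y * (normal_pdf m s y)%:E))%E.
  apply: integral_density => //; first exact: measurable_normal_pdf.
  by move=> x; exact: normal_pdf_ge0.
have s0' : 0 < `|s| by rewrite normr_gt0.
rewrite (ge0_integral_affine m s0'); last 2 first.
- apply: emeasurable_funM => //; apply/measurable_EFinP.
  exact: measurable_normal_pdf.
- by move=> x; rewrite mule_ge0// lee_fin normal_pdf_ge0.
have maff : measurable_fun setT (fun y : R => m + `|s| * y).
  by apply: measurable_funD => //; exact: measurable_funM.
rewrite integral_gauss; last exact: (measurableT_comp mf maff).
rewrite -ge0_integralZl//; last 2 first.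
- apply: emeasurable_funM.
    apply: (measurableT_comp mf).
    by apply: measurable_funD => //; exact: measurable_funM.
  apply/measurable_EFinP; apply: measurableT_comp.
    exact: measurable_normal_pdf.
  by apply: measurable_funD => //; exact: measurable_funM.
- by move=> x _; rewrite mule_ge0// lee_fin normal_pdf_ge0.
apply: eq_integral => y _.
rewrite (addrC m) muleCA -EFinM; congr (_ * (_%:E))%E.
rewrite normal_pdfE//= /normal_fun addrK /gauss_density mulrA.
congr (_ * expR _).
  rewrite /normal_peak expr1n mul1r -mulrnAr sqrtrM ?sqr_ge0// sqrtr_sqr.
  by rewrite invfM mulrA divff ?gt_eqF// mul1r.
rewrite exprMn -normrX ger0_norm ?sqr_ge0// -mulr_natr.
by field.
Qed.

(** [B t] has the law of [|t|^h Y] with [Y] standard normal: a linear combination of length one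
    shows that it is Gaussian, and its mean and variance determine the two parameters. *)
Lemma fbm_law (h : R) (B : R -> T -> R) : fractional_brownian_motion P h B ->
  forall (t : R) (f : R -> \bar R), measurable_fun setT f ->
    (\int[P]_w f (B t w) = \int[gam]_y f (`|t| `^ h * y)%R)%E.
Proof.
move=> fbm t.
have gB : gaussian_rv P (B t).
  have := fbm_gaussian fbm (fun=> t : R) (fun=> 1 : R) (n := 1).
  by under eq_fun do rewrite big_ord1 mul1r.
have mB := fbm_measurable fbm t.
have [m [s [s0 law]]] := gaussian_rv_law mB gB.
have i1 : mu.-integrable setT (EFin \o (fun y => y * gauss_density y)).
  by have := @integrable_gauss_density_pow R 1; under eq_fun do rewrite expr1.
have i0 : mu.-integrable setT (EFin \o @gauss_density R).
  by have := @integrable_gauss_density_pow R 0; under eq_fun do rewrite expr0 mul1r.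
have mlin (a b : R) : measurable_fun setT (fun y : R => a + b * y).
  by apply: measurable_funD => //; exact: measurable_funM.
have R0 : \int[mu]_y gauss_density y = 1 by rewrite /Rintegral integral_gauss_density.
have m0 : m = 0.
  have := fbm_centered fbm t; rewrite unlock.
  have -> : (\int[P]_w (B t w)%:E = \int[gam]_y (m + s * y)%:E)%E.
    by rewrite (law EFin)//; exact/measurable_EFinP.
  rewrite integral_gauss; last exact/measurable_EFinP.
  have iA : mu.-integrable setT (EFin \o (fun y => m * gauss_density y + s * (y * gauss_density y))).
    exact: (integrableD_R measurableT (integrableZ_R measurableT m i0) (integrableZ_R measurableT s i1)).
  have -> : (\int[mu]_y ((m + s * y)%:E * (gauss_density y)%:E) =
     (\int[mu]_y (m * gauss_density y + s * (y * gauss_density y)))%:E)%E.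
    rewrite /Rintegral fineK; last exact: (integrable_fin_num measurableT iA).
    by apply: eq_integral => y _; rewrite -EFinM mulrDl mulrA.
  move=> /(congr1 fine)/=; rewrite RintegralD//; last 2 first.
  - exact: (integrableZ_R measurableT m i0).
  - exact: (integrableZ_R measurableT s i1).
  by rewrite RintegralZl// RintegralZl// R0 mulr1 gauss_mean mulr0 addr0.
have sE : s = `|t| `^ h.
  have := fbm_variance fbm t.
  rewrite /variance unlock (fbm_centered fbm t)/= unlock.
  have -> : (\int[P]_w (((B t \- cst 0) * (B t \- cst 0)) w)%:E =
     \int[gam]_y (s ^+ 2 * y ^+ 2)%:E)%E.
    transitivity (\int[P]_w ((fun x : R => (x ^+ 2)%:E) (B t w)))%E.
      by apply: eq_integral => w _; rewrite !fctE/= subr0 expr2.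
    rewrite (law (fun x : R => (x ^+ 2)%:E)); last first.
      by apply/measurable_EFinP; exact: measurable_funX.
    by apply: eq_integral => y _; rewrite m0 add0r exprMn.
  rewrite integral_gauss; last first.
    by apply/measurable_EFinP; apply: measurable_funM => //; exact: measurable_funX.
  have i2 := @integrable_gauss_density_pow R 2.
  have -> : (\int[mu]_y ((s ^+ 2 * y ^+ 2)%:E * (gauss_density y)%:E) =
     (\int[mu]_y (s ^+ 2 * (y ^+ 2 * gauss_density y)))%:E)%E.
    rewrite /Rintegral fineK; last exact: (integrable_fin_num measurableT (integrableZ_R measurableT (s ^+ 2) i2)).
    by apply: eq_integral => y _; rewrite -EFinM mulrA.
  rewrite RintegralZl// gauss_variance mulr1 => /(congr1 fine)/=.
  rewrite mulrC powRrM powR_mulrn ?powR_ge0// => /eqP.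
  by rewrite eqrXn2 ?powR_ge0// => /eqP.
move=> f mf; rewrite law// m0 sE.
by apply: eq_integral => y _; rewrite add0r.
Qed.

End gaussian_law.

(** * The partial sums of the structure factor *)

Section symsum.
Context {R : realType}.

(** The sum over [-N <= n <= N], with the indexing of [fbm_structure_factor]. *)
Definition symsum (g : int -> R) (N : nat) : R :=
  \sum_(k < N.*2.+1) g (k%:Z - N%:Z).

Lemma symsum0 g : symsum g 0 = g 0.
Proof. by rewrite /symsum big_ord1. Qed.

Lemma symsumS g N :
  symsum g N.+1 = symsum g N + (g N.+1%:Z + g (- N.+1%:Z)).
Proof.
rewrite /symsum doubleS big_ord_recl big_ord_recr /=.
have -> : 0%:Z - N.+1%:Z = - N.+1%:Z by rewrite sub0r.
have -> : (bump 0 N.*2.+1)%:Z - N.+1%:Z = N.+1%:Z.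
  rewrite /bump/= -addnn; lia.
rewrite (eq_bigr (fun k : 'I_(N.*2.+1) => g (k%:Z - N%:Z))); last first.
  by move=> k _; congr g; rewrite /bump/=; lia.
by ring.
Qed.

End symsum.

(** * Dirichlet and Fejer kernels *)

Section trig_bounds.
Context {R : realType}.

Lemma sin_MVT (x : R) : 0 < x -> exists2 c, 0 < c < x & sin x = cos c * x.
Proof.
move=> x0; have [//||c cI] := @MVT R sin cos 0 x.
- exact/continuous_subspaceT/continuous_sin.
by rewrite sin0 !subr0 => E; exists c.
Qed.

Lemma norm_sin_le (x : R) : `|sin x| <= `|x|.
Proof.
wlog x0 : x / 0 < x.
  move=> H; have [|x0|<-] := ltgtP 0 x; first exact: H.
    rewrite -[`|sin x|]normrN -sinN -[`|x|]normrN; apply: H; by rewrite oppr_gt0.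
  by rewrite sin0.
have [c _ ->] := sin_MVT x0.
by rewrite normrM ler_piMl// norm_cos_le1.
Qed.

Lemma cos_ge_quadratic (x : R) : 1 - x ^+ 2 / 2 <= cos x.
Proof.
have -> : cos x = 1 - sin (x / 2) ^+ 2 *+ 2.
  have {1}-> : x = (x / 2) *+ 2 by rewrite -mulr_natr divfK.
  have := cos2Dsin2 (x / 2); rewrite cos_mulr2n => H.
  have -> : cos (x / 2) ^+ 2 = 1 - sin (x / 2) ^+ 2 by lra.
  by rewrite !mulr2n; ring.
rewrite lerD2l lerN2.
have H : sin (x / 2) ^+ 2 <= (x / 2) ^+ 2.
  by rewrite -[leLHS]real_normK ?num_real// -[leRHS]real_normK ?num_real// lerXn2r// ?nnegrE// norm_sin_le.
have -> : x ^+ 2 / 2 = (x / 2) ^+ 2 *+ 2 by rewrite mulr2n; field.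
by rewrite lerMn2r.
Qed.

Lemma sin_ge_cubic (x : R) : 0 <= x -> x - x ^+ 3 / 2 <= sin x.
Proof.
rewrite le_eqVlt => /predU1P[<-|x0]; first by rewrite sin0 expr0n/= mul0r subr0.
have [c /andP[c0 cx] ->] := sin_MVT x0.
have H := cos_ge_quadratic c.
have cx2 : c ^+ 2 <= x ^+ 2 by rewrite lerXn2r ?nnegrE ?ltW.
have -> : x - x ^+ 3 / 2 = (1 - x ^+ 2 / 2) * x by field.
apply: ler_wpM2r; first exact: ltW.
by apply: le_trans H; lra.
Qed.

Lemma sin_half_ge (t : R) : 0 <= t <= 1 -> t / 4 <= sin (t / 2).
Proof.
move=> /andP[t0 t1]; apply: le_trans (sin_ge_cubic _); last by lra.
have t2 : t ^+ 2 <= 1 by rewrite expr2 mulr_ile1.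
have -> : t / 2 - (t / 2) ^+ 3 / 2 = t * (1 / 2 - t ^+ 2 / 16) by field.
have -> : t / 4 = t * (1 / 4) by field.
by rewrite ler_wpM2l//; lra.
Qed.

Lemma sin_half_sqr_ge (t : R) : `|t| <= 1 -> t ^+ 2 / 16 <= sin (t / 2) ^+ 2.
Proof.
move=> t1.
have H : `|t| / 4 <= sin (`|t| / 2) by apply: sin_half_ge; rewrite normr_ge0.
have -> : t ^+ 2 / 16 = (`|t| / 4) ^+ 2.
  by rewrite expr_div_n real_normK ?num_real// -natrX.
have -> : sin (t / 2) ^+ 2 = sin (`|t| / 2) ^+ 2.
  by case: ger0P => // _; rewrite mulNr sinN sqrrN.
by rewrite lerXn2r ?nnegrE ?divr_ge0//; apply: le_trans H; rewrite divr_ge0.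
Qed.

Lemma sub_sin_half_le (t : R) : `|t - 2 * sin (t / 2)| <= `|t| ^+ 3 / 8.
Proof.
wlog t0 : t / 0 <= t.
  move=> H; have [/H//|t0] := leP 0 t.
  have := H (- t); rewrite oppr_ge0 (ltW t0) normrN mulNr sinN => /(_ isT).
  by rewrite -[X in X <= _]normrN; congr (`|_| <= _); ring.
have := sin_ge_cubic (divr_ge0 t0 (ler0n R 2)).
have := norm_sin_le (t / 2); rewrite (ger0_norm t0) (ger0_norm (divr_ge0 t0 (ler0n R 2))).
have -> : (t / 2) ^+ 3 / 2 = t ^+ 3 / 16 by field.
move=> /ler_normlP[_ +] H; move: (sin (t / 2)) (t ^+ 3) H => s c H1 H2.
have c0 : 0 <= c by lra.
by rewrite ler_norml; apply/andP; split; lra.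
Qed.

Definition dirichlet (t : R) (N : nat) : R := symsum (fun n => cos (n%:~R * t)) N.

(** [N] times the usual Fejer kernel; it is the factor that appears when the Dirichlet kernels are
    summed by parts. *)
Definition fejer (t : R) (N : nat) : R := \sum_(m < N) dirichlet t m.

Lemma dirichletS (t : R) N :
  dirichlet t N.+1 = dirichlet t N + 2 * cos (N.+1%:R * t).
Proof.
rewrite /dirichlet symsumS; congr (_ + _).
rewrite mulrNz mulNr cosN -mulr2n mulr_natl.
by [].
Qed.

Lemma dirichletE (t : R) N :
  sin (t / 2) * dirichlet t N = sin ((N%:R + 2^-1) * t).
Proof.
elim: N => [|N IH].
  by rewrite /dirichlet symsum0 mul0r cos0 mulr1 add0r mulrC.
rewrite dirichletS mulrDr IH.
have -> : (N%:R + 2^-1) * t = N.+1%:R * t - t / 2 by rewrite -[N.+1%:R]natr1; field.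
have -> : (N.+1%:R + 2^-1) * t = N.+1%:R * t + t / 2 by field.
by rewrite sinB sinD; ring.
Qed.

(** The subtracted function is the Fourier transform of the indicator of [[- N - 1/2, N + 1/2]].
    Both functions are [sin ((N + 1/2) t)] times a factor, and the factors [1 / sin (t / 2)] and
    [2 / t] differ by a bounded amount. *)
Lemma dirichlet_sub_le (t : R) N : t != 0 -> `|t| <= 1 ->
  `|dirichlet t N - 2 * sin ((N%:R + 2^-1) * t) / t| <= 1.
Proof.
move=> t0 t1; rewrite -dirichletE.
have tp : 0 < `|t| by rewrite normr_gt0.
have q0 : `|t| / 4 <= `|sin (t / 2)|.
  rewrite -(@ler_pXn2r _ 2)// ?nnegrE ?divr_ge0//.
  rewrite real_normK ?num_real// expr_div_n real_normK ?num_real// -natrX.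
  exact: sin_half_sqr_ge.
have q00 : 0 < `|sin (t / 2)| by apply: lt_le_trans q0; rewrite divr_gt0.
have -> : dirichlet t N - 2 * (sin (t / 2) * dirichlet t N) / t =
    (t - 2 * sin (t / 2)) * dirichlet t N / t by field.
rewrite -(ler_pM2l q00) -normrM mulr1.
have -> : sin (t / 2) * ((t - 2 * sin (t / 2)) * dirichlet t N / t) =
  (t - 2 * sin (t / 2)) / t * (sin (t / 2) * dirichlet t N) by field.
rewrite dirichletE normrM; apply: le_trans q0.
apply: (le_trans (ler_piMr (normr_ge0 _) (norm_sin_le1 _))).
rewrite normf_div ler_pdivrMr//; apply: (le_trans (sub_sin_half_le _)).
have : `|t| ^+ 3 <= `|t| * `|t| by rewrite exprSr ler_wpM2r// expr2 ler_piMr.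
by move: (`|t|) tp => u u0 H; nra.
Qed.

Lemma fejerE (t : R) N : sin (t / 2) ^+ 2 * fejer t N = sin (N%:R * (t / 2)) ^+ 2.
Proof.
rewrite /fejer; elim: N => [|N IH].
  by rewrite big_ord0 mulr0 mul0r sin0 expr0n.
rewrite big_ord_recr/= mulrDr IH expr2 -mulrA dirichletE.
set A := N%:R * (t / 2); set B := t / 2.
have -> : (N%:R + 2^-1) * t = A + (A + B) by rewrite /A /B; field.
have -> : N.+1%:R * B = A + B by rewrite /A /B -[N.+1%:R]natr1; field.
rewrite sinD [sin (A + B)]sinD cosD.
have := cos2Dsin2 B; move: (cos B) (sin B) => cB sB H.
move: (cos A) (sin A) => cA sA.
have -> : (sA * cB + cA * sB) ^+ 2 = sA ^+ 2 * cB ^+ 2 + 2 * sA * cA * sB * cB + cA ^+ 2 * sB ^+ 2 by ring.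
have -> : cB ^+ 2 = 1 - sB ^+ 2 by lra.
by ring.
Qed.

Lemma fejer_le (t : R) N : `|t| <= 1 -> t != 0 -> `|fejer t N| <= 16 / t ^+ 2.
Proof.
move=> t1 tn0; have s2 := sin_half_sqr_ge t1.
have t20 : 0 < t ^+ 2 by rewrite exprn_even_gt0//= tn0.
have s0 : 0 < sin (t / 2) ^+ 2 by apply: lt_le_trans s2; rewrite divr_gt0.
rewrite -(ler_pM2l s0) -[X in X * `|_|]ger0_norm ?sqr_ge0// -normrM fejerE.
rewrite ger0_norm ?sqr_ge0//.
apply: (@le_trans _ _ 1).
  by rewrite -[leLHS]ger0_norm ?sqr_ge0// normrX exprn_ile1// norm_sin_le1.
rewrite mulrC; apply: (@le_trans _ _ (16 / t ^+ 2 * (t ^+ 2 / 16))).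
  by rewrite le_eqVlt; apply/orP; left; apply/eqP; field.
by rewrite ler_wpM2l// divr_ge0// ltW.
Qed.

End trig_bounds.

Section power_series.
Context {R : realType}.

(** Comparison with the integral of [x^(- 1 - s)], carried out by the mean value theorem and
    telescoping. *)
Lemma psum_powR_le (s : R) (N : nat) : 0 < s ->
  \sum_(n < N) n.+1%:R `^ (- 1 - s) <= 1 + s^-1 :> R.
Proof.
move=> s0.
have step (n : nat) : n.+2%:R `^ (- 1 - s) <=
    s^-1 * (n.+1%:R `^ (- s) - n.+2%:R `^ (- s)) :> R.
  have [|||c] := @MVT R (fun x => x `^ (- s)) (fun x => - s * x `^ (- s - 1)) n.+1%:R n.+2%:R.
  - by rewrite ltr_nat.
  - move=> x; rewrite in_itv/= => /andP[x0 _]; apply: is_derive1_powR.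
    by apply: lt_trans x0.
  - apply: derivable_within_continuous => x; rewrite in_itv/= => /andP[x0 _].
    have x0' : 0 < x by apply: lt_le_trans x0.
    by have [] := is_derive1_powR (- s) x0'.
  rewrite in_itv/= => /andP[nc cn] E.
  have c0 : 0 < c by apply: lt_trans nc.
  have -> : n.+1%:R `^ (- s) - n.+2%:R `^ (- s) = s * c `^ (- s - 1) :> R.
    by rewrite -opprB E -[n.+2]addn1 natrD addrAC subrr add0r; ring.
  rewrite mulrA mulVf ?gt_eqF// mul1r.
  have -> : - s - 1 = - (1 + s) by ring.
  have -> : - 1 - s = - (1 + s) by ring.
  rewrite !powRN lef_pV2 ?posrE ?powR_gt0//.
  by apply: ge0_ler_powR; rewrite ?nnegrE ?(ltW c0)// ?(ltW cn)// addr_ge0// ltW.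
case: N => [|N]; first by rewrite big_ord0 addr_ge0// invr_ge0 ltW.
suff H : \sum_(n < N.+1) n.+1%:R `^ (- 1 - s) <= 1 + s^-1 * (1 - N.+1%:R `^ (- s)) :> R.
  by apply: (le_trans H); rewrite lerD2l ler_piMr ?invr_ge0 ?(ltW s0)// gerBl powR_ge0.
elim: N => [|N IH].
  by rewrite big_ord_recl big_ord0 addr0 !powR1 subrr mulr0 addr0.
rewrite big_ord_recr/=; apply: (le_trans (lerD IH (step N))).
by rewrite -addrA lerD2l -mulrDr ler_wpM2l ?invr_ge0 ?(ltW s0)// addrA subrK.
Qed.

Lemma cvg_series_powR (s : R) : 0 < s ->
  cvgn (series (fun n => n.+1%:R `^ (- 1 - s) : R)).
Proof.
move=> s0; apply: nondecreasing_is_cvgn.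
  apply/nondecreasing_seqP => n.
  by rewrite seriesEnat/= big_nat_recr//= lerDl powR_ge0.
exists (1 + s^-1) => _ [n _ <-].
by rewrite seriesEnat/= big_mkord psum_powR_le.
Qed.

End power_series.

Lemma norm_sub_le (R : realDomainType) (x y M : R) :
  0 <= x -> 0 <= y -> x <= M -> y <= M -> `|x - y| <= M.
Proof. by move=> *; rewrite ler_norml; apply/andP; split; lra. Qed.

Section coefficients.
Context {R : realType}.
Variable h : R.
Hypotheses (h0 : 0 < h) (h1 : h < 1).

Let a0 : 0 < 2 * h. Proof. by move: h0; lra. Qed.

(** The factor [n `^ 0] of [powexp] is [1], also for [n = 0]. *)
Definition fexp (t : R) (n : nat) : R := powexp 0 (2 * h) (t ^+ 2 / 2) n%:R.

Definition fexpD (t : R) (n : nat) : R := fexp t n - fexp t n.+1.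

Definition fsum (t : R) (N : nat) : R := complex.Re
  (\sum_(k < N.*2.+1) fbm_structure_term h t (k%:Z - N%:Z)).

Lemma fexpE t n : fexp t n = expR (- (t ^+ 2 / 2 * n%:R `^ (2 * h))).
Proof. by rewrite /fexp /powexp powRr0 mul1r. Qed.

Lemma fexp0 t : fexp t 0 = 1.
Proof. by rewrite fexpE powR0 ?gt_eqF// mulr0 oppr0 expR0. Qed.

Lemma fexp_ge0 t n : 0 <= fexp t n.
Proof. by rewrite fexpE expR_ge0. Qed.

Lemma fexp_le1 t n : fexp t n <= 1.
Proof.
by rewrite fexpE -expR0 ler_expR oppr_le0 mulr_ge0 ?powR_ge0// divr_ge0// sqr_ge0.
Qed.

Lemma ReE_structure_term t (n : int) :
  complex.Re (fbm_structure_term h t n) = fexp t `|n|%N * cos (n%:~R * t).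
Proof.
rewrite /fbm_structure_term/= mul0r subr0 cosN fexpE; congr (expR _ * _).
have -> : `|n%:~R| = `|n|%N%:R :> R by rewrite -intr_norm pmulrn abszE.
by field.
Qed.

Lemma fsumE t N :
  fsum t N = symsum (fun n => fexp t `|n|%N * cos (n%:~R * t)) N.
Proof.
rewrite /fsum /symsum.
rewrite (big_morph (@complex.Re R) (id1 := 0) (op1 := +%R))//; last by move=> [? ?] [? ?].
by apply: eq_bigr => k _; rewrite ReE_structure_term.
Qed.

Lemma fsumS t N :
  fsum t N.+1 = fsum t N + 2 * (fexp t N.+1 * cos (N.+1%:R * t)).
Proof.
rewrite !fsumE symsumS; congr (_ + _).
rewrite abszN mulrNz mulNr cosN -mulr2n mulr_natl.
by [].
Qed.

Lemma fsum0 t : fsum t 0 = 1.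
Proof. by rewrite fsumE symsum0/= fexp0 mul0r cos0 mulr1. Qed.

Lemma fsum_series t N :
  fsum t N = 1 + 2 * \sum_(n < N) (fexp t n.+1 * cos (n.+1%:R * t)).
Proof.
elim: N => [|N IH]; first by rewrite fsum0 big_ord0 mulr0 addr0.
by rewrite fsumS IH big_ord_recr/=; ring.
Qed.

Lemma fsum_dirichlet t N : fsum t N =
  fexp t N * dirichlet t N + \sum_(n < N) fexpD t n * dirichlet t n.
Proof.
elim: N => [|N IH].
  by rewrite fsum0 big_ord0 addr0 fexp0 /dirichlet symsum0 mul0r cos0 mulr1.
rewrite fsumS IH big_ord_recr/= dirichletS /fexpD.
move: (fexp t N) (fexp t N.+1) (dirichlet t N) (\sum_(i < N) _) (cos _) => u v d s c.
by ring.
Qed.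

Lemma fsum_fejer t N : \sum_(n < N) fexpD t n * dirichlet t n =
  fexpD t N * fejer t N +
  \sum_(n < N) (fexpD t n - fexpD t n.+1) * fejer t n.+1.
Proof.
elim: N => [|N IH]; first by rewrite !big_ord0 /fejer big_ord0 mulr0 addr0.
have FS : fejer t N.+1 = fejer t N + dirichlet t N by rewrite /fejer big_ord_recr.
rewrite [LHS]big_ord_recr [in RHS]big_ord_recr/= IH FS.
by rewrite /fexpD; move: (fexp t N) (fexp t N.+1) (fexp t N.+2) (fejer _ _) (dirichlet _ _) (\sum_(i < N) _) => *; ring.
Qed.

(** The exponent [1 / h] turns [n^(2h)] into [n^2]. As [C] serves all [u] with [|u| >= |t|], the
    case [t = 1] gives a bound on the partial sums uniform away from the origin. The exponent is
    written [- 1 - 1] to match [psum_powR_le]. *)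
Lemma fexp_le_inv_sqr (t : R) : t != 0 -> exists2 C : R, 0 <= C &
  forall (u : R) n, `|t| <= `|u| -> fexp u n.+1 <= C * n.+1%:R `^ (- 1 - 1).
Proof.
move=> t0; have t2 : 0 < t ^+ 2 / 2 by rewrite divr_gt0// exprn_even_gt0//= t0.
exists (h^-1 `^ h^-1 / (t ^+ 2 / 2) `^ h^-1).
  by rewrite divr_ge0 ?powR_ge0.
move=> u n tu; apply: (@le_trans _ _ (fexp t n.+1)).
  rewrite !fexpE ler_expR lerN2 ler_wpM2r ?powR_ge0// ler_pM2r ?invr_gt0//.
  by rewrite -[leLHS]real_normK ?num_real// -[leRHS]real_normK ?num_real// lerXn2r ?nnegrE.
have hV : 0 < h^-1 by rewrite invr_gt0.
have := @powexp_mul_le R (- 2) h^-1 (2 * h) (t ^+ 2 / 2) n.+1%:R hV (ltW t2) (ltr0Sn _ _).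
have -> : - 2 + h^-1 * (2 * h) = 0 by field; rewrite gt_eqF.
rewrite -/(fexp t n.+1) => H.
have -> : - 1 - 1 = - 2 :> R by ring.
by rewrite mulrAC ler_pdivlMr ?powR_gt0// mulrC.
Qed.

Lemma cvg_series_norm (t : R) : t != 0 ->
  cvgn (series (fun n => fexp t n.+1 * cos (n.+1%:R * t))).
Proof.
move=> t0; have [C C0 Cf] := fexp_le_inv_sqr t0.
apply: normed_cvg; apply: (@series_le_cvg _ _ (fun n => C * n.+1%:R `^ (- 1 - 1))).
- by move=> n /=.
- by move=> n; rewrite mulr_ge0 ?powR_ge0.
- move=> n /=; apply: le_trans (Cf _ n (lexx _)).
  by rewrite normrM (ger0_norm (fexp_ge0 _ _)) ler_piMr ?fexp_ge0// norm_cos_le1.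
- rewrite (_ : series _ = (fun N => C * series (fun n => n.+1%:R `^ (- 1 - 1)) N)).
    by apply: is_cvgZr; exact: cvg_series_powR.
  by apply/funext => N; rewrite !seriesEnat/= -mulr_sumr.
Qed.

Lemma cvg_fsum (t : R) : t != 0 ->
  fsum t N @[N --> \oo] --> fbm_structure_factor h t.
Proof.
move=> t0; rewrite /fbm_structure_factor -/(fsum t).
suff : cvgn (fsum t) by [].
rewrite (_ : fsum t = (fun N => 1 + 2 * series (fun n => fexp t n.+1 * cos (n.+1%:R * t)) N)).
  apply: is_cvgD; first exact: is_cvg_cst.
  by apply: is_cvgZr; exact: cvg_series_norm.
by apply/funext => N; rewrite fsum_series seriesEnat/= big_mkord.
Qed.

Lemma cvg_fexp (t : R) : t != 0 -> fexp t N @[N --> \oo] --> 0.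
Proof.
move=> t0; have [C C0 Cf] := fexp_le_inv_sqr t0.
rewrite -(cvg_shiftS (fexp t)).
apply: (@squeeze_cvgr _ _ _ _ (cst 0) (fun n : nat => C * n.+1%:R^-1)).
- apply: nearW => n; rewrite /= fexp_ge0/=; apply: (le_trans (Cf _ n (lexx _))).
  have -> : - 1 - 1 = - 2 :> R by ring.
  rewrite ler_wpM2l// powRN powR_mulrn ?ler0n// lef_pV2 ?posrE ?exprn_gt0//.
  by rewrite expr2 ler_peMr ?ler0n// ler1n.
- exact: cvg_cst.
- rewrite -(mulr0 C); apply: cvgM; first exact: cvg_cst.
  exact: cvg_harmonic.
Qed.

Lemma fsum_le_away : exists C : R, forall t N, 1 <= `|t| -> `|fsum t N| <= C.
Proof.
have [C C0 Cf] := fexp_le_inv_sqr (oner_neq0 R).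
exists (1 + 2 * (C * (1 + 1^-1))) => t N t1.
rewrite fsum_series; apply: (le_trans (ler_normD _ _)).
rewrite normr1 lerD2l normrM ger0_norm// ler_pM2l//.
apply: (le_trans (ler_norm_sum _ _ _)).
apply: (@le_trans _ _ (\sum_(n < N) C * n.+1%:R `^ (- 1 - 1))).
  apply: ler_sum => n _.
  rewrite normrM (ger0_norm (fexp_ge0 _ _)).
  apply: (le_trans (ler_piMr (fexp_ge0 _ _) (norm_cos_le1 _))).
  by apply: Cf; rewrite normr1.
by rewrite -mulr_sumr ler_wpM2l// psum_powR_le.
Qed.

(** The exponents come from [exp (- u) <= C u ^ (- h / 2)] with
    [u = t ^ 2 |n| ^ (2 h) / 2]: the power of [|n|] in the second difference is
    then [- 1 - (1 - h) ^ 2 < - 1], and that of [|t|] is [2 - h]. *)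
Let r : R := (1 - h) ^+ 2.
Let th : R := h / 2.

Let r0 : 0 < r.
Proof. by rewrite exprn_even_gt0//= subr_eq0 gt_eqF. Qed.

Let th0 : 0 < th. Proof. by rewrite divr_gt0. Qed.

Lemma powexp_derive_le : exists2 C : R, 0 <= C &
  forall l y, 0 < l -> 0 < y ->
    `|powexp1 0 (2 * h) l y| <= C * l `^ (1 - h / 2) * y `^ (- (1 - h) ^+ 2) /\
    `|powexp2 0 (2 * h) l y| <= C * l `^ (1 - h / 2) * y `^ (- 1 - (1 - h) ^+ 2).
Proof.
rewrite -/r -/th.
pose c1 := th `^ th; pose c2 := (1 + th) `^ (1 + th).
exists (`|2 * h| * c1 + `|2 * h| * `|2 * h - 1| * c1 + `|2 * h| * `|2 * h| * c2).
  by rewrite !addr_ge0// !mulr_ge0// powR_ge0.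
move=> l y l0 y0.
have lE : l = l `^ (1 - th) * l `^ th.
  rewrite -powRD ?subrK ?powRr1 ?ltW//.
  by apply/implyP => _; rewrite gt_eqF.
(* The term of [powexp2] with [l^2] is treated with the exponent [1 + h / 2] instead of [h / 2], so
   that both terms leave the same factor [l^(1 - h / 2)]. *)
have l2E : l * l = l `^ (1 - th) * l `^ (1 + th).
  rewrite -powRD; last by apply/implyP => _; rewrite gt_eqF.
  rewrite (_ : 1 - th + (1 + th) = 2); last by ring.
  by rewrite powR_mulrn ?ltW// expr2.
have b1 e : l * powexp (e + th * (2 * h)) (2 * h) l y <= l `^ (1 - th) * (c1 * y `^ e).
  rewrite {1}lE -mulrA ler_wpM2l ?powR_ge0//.
  by apply: powexp_mul_le => //; exact: ltW.
have b2 e : l * l * powexp (e + (1 + th) * (2 * h)) (2 * h) l y <= l `^ (1 - th) * (c2 * y `^ e).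
  rewrite l2E -mulrA ler_wpM2l ?powR_ge0//.
  by apply: powexp_mul_le => //; [exact: addr_gt0|exact: ltW].
set L := l `^ (1 - th) in b1 b2 *.
have L0 : 0 <= L by exact: powR_ge0.
have c10 : 0 <= c1 by exact: powR_ge0.
have c20 : 0 <= c2 by exact: powR_ge0.
split.
  have -> : powexp1 0 (2 * h) l y = - (2 * h) * (l * powexp (- r + th * (2 * h)) (2 * h) l y).
    rewrite /powexp1 mul0r sub0r.
    have -> : 0 + 2 * h - 1 = - r + th * (2 * h) by rewrite /r /th; field.
    by ring.
  rewrite normrM normrN [X in _ * X]ger0_norm; last first.
    by apply: mulr_ge0; [exact: ltW|exact: powexp_ge0].
  apply: (le_trans (ler_wpM2l (normr_ge0 _) (b1 _))).
  have y0' := powR_ge0 y (- r).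
  have -> : `|2 * h| * (L * (c1 * y `^ (- r))) = (`|2 * h| * c1) * (L * y `^ (- r)) by ring.
  rewrite -[leRHS]mulrA; apply: ler_wpM2r; first exact: mulr_ge0.
  by rewrite -addrA lerDl; apply: addr_ge0; apply: mulr_ge0 => //; apply: mulr_ge0.
have -> : powexp2 0 (2 * h) l y =
   - (2 * h) * (2 * h - 1) * (l * powexp (- 1 - r + th * (2 * h)) (2 * h) l y) +
   (2 * h) * (2 * h) * (l * l * powexp (- 1 - r + (1 + th) * (2 * h)) (2 * h) l y).
  rewrite /powexp2 mul0r sub0r /powexp1.
  have -> : 0 + 2 * h - 1 - 1 = - 1 - r + th * (2 * h) by rewrite /r /th; field.
  have -> : 0 + 2 * h - 1 + 2 * h - 1 = - 1 - r + (1 + th) * (2 * h) by rewrite /r /th; field.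
  by ring.
have B1 := b1 (- 1 - r); have B2 := b2 (- 1 - r).
have p1 : 0 <= l * powexp (- 1 - r + th * (2 * h)) (2 * h) l y.
  by apply: mulr_ge0; [exact: ltW|exact: powexp_ge0].
have p2 : 0 <= l * l * powexp (- 1 - r + (1 + th) * (2 * h)) (2 * h) l y.
  by apply: mulr_ge0; [apply: mulr_ge0; exact: ltW|exact: powexp_ge0].
move: (l * powexp _ _ _ _) (l * l * powexp _ _ _ _) p1 p2 B1 B2 => P1 P2 p1 p2 B1 B2.
apply: (le_trans (ler_normD _ _)).
rewrite [`|_ * P1|]normrM [`|_ * P2|]normrM (ger0_norm p1) (ger0_norm p2).
rewrite [`|- _ * _|]normrM normrN [`|2 * h * (2 * h)|]normrM.
have y0' := powR_ge0 y (- 1 - r).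
move: (y `^ (- 1 - r)) y0' B1 B2 => Y y0' B1 B2.
have hh : 0 <= `|2 * h| * `|2 * h - 1| by exact: mulr_ge0.
have hh2 : 0 <= `|2 * h| * `|2 * h| by exact: mulr_ge0.
apply: (le_trans (lerD (ler_wpM2l hh B1) (ler_wpM2l hh2 B2))).
move: (`|2 * h|) (`|2 * h - 1|) (normr_ge0 (2 * h)) hh hh2 => u v u0 hh hh2.
have -> : u * v * (L * (c1 * Y)) + u * u * (L * (c2 * Y)) =
  (u * v * c1 + u * u * c2) * (L * Y) by ring.
rewrite -[leRHS]mulrA; apply: ler_wpM2r; first exact: mulr_ge0.
by rewrite -addrA lerDr; apply: mulr_ge0.
Qed.

Lemma fexpD_ge0 t n : 0 <= fexpD t n.
Proof.
rewrite subr_ge0 !fexpE ler_expR lerN2 ler_wpM2l ?divr_ge0 ?sqr_ge0//.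
by apply: ge0_ler_powR; rewrite ?nnegrE ?ler_nat ?ler0n// ltW.
Qed.

Let expR_sub (u : R) : 1 - expR (- u) <= u.
Proof. by rewrite lerBlDr -lerBlDl; have := expR_ge1Dx (- u). Qed.

(** For [n > 0] these are the derivative bounds of [powexp_derive_le] at points of [[n, n + 2]]. *)
Lemma fexpD_le : exists2 C : R, 0 <= C & forall t n, t != 0 -> `|t| <= 1 ->
  fexpD t n <= C * (t ^+ 2 / 2) `^ (1 - h / 2) * n.+1%:R `^ (- (1 - h) ^+ 2) /\
  `|fexpD t n - fexpD t n.+1| <=
    C * (t ^+ 2 / 2) `^ (1 - h / 2) * n.+1%:R `^ (- 1 - (1 - h) ^+ 2).
Proof.
have [C C0 CP] := powexp_derive_le; rewrite -/r -/th in CP *.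
(* The cost of replacing [n] by [n + 1] in the powers, by [n + 1 <= 2 n] for [n >= 1]. *)
pose K : R := 2 `^ (1 + r).
have K1 : 1 <= K.
  rewrite -(@powRr0 R 2) ler_powR// ?ler1n// addr_ge0// ltW//.
exists (C * K + 4); first by rewrite addr_ge0// mulr_ge0// powR_ge0.
move=> t n t0 t1.
have l0 : 0 < t ^+ 2 / 2 by rewrite divr_gt0// exprn_even_gt0//= t0.
have l1 : t ^+ 2 / 2 <= 1.
  rewrite ler_pdivrMr// mul1r (@le_trans _ _ 1) ?ler1n//.
  by rewrite -[leLHS]real_normK ?num_real// exprn_ile1.
set l := t ^+ 2 / 2 in l0 l1 *.
set L := l `^ (1 - th).
have L0 : 0 <= L by exact: powR_ge0.
have lL : l <= L.
  rewrite -[leLHS]powRr1 ?(ltW l0)//; apply: ger_powR; rewrite ?l0 ?l1//.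
  by rewrite gerBl ltW.
have r00 := ltW r0.
(* The derivatives of [powexp] are singular at [0], so the first differences are compared directly
   with [l], using [1 - exp (- u) <= u]; the factor [4] bounds [2^(2h)]. *)
case: n => [|n].
  rewrite !powR1 !mulr1.
  have e1 : fexpD t 0 <= l.
    rewrite /fexpD fexp0 fexpE powR1 mulr1; exact: expR_sub.
  have e2 : fexpD t 1 <= 4 * l.
    apply: (@le_trans _ _ (1 - fexp t 2)).
      by rewrite /fexpD lerD2r fexp_le1.
    rewrite fexpE; apply: (le_trans (expR_sub _)).
    rewrite mulrC ler_wpM2r ?(ltW l0)//.
    have -> : 4 = 2 `^ 2 :> R by rewrite powR_mulrn// expr2 -natrM.
    by apply: ler_powR; [rewrite ler1n|rewrite -[leRHS]mulr1 ler_pM2l// ltW].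
  have CK : 0 <= C * K by rewrite mulr_ge0// powR_ge0.
  have d0 := fexpD_ge0 t 0; have d1 := fexpD_ge0 t 1.
  have l4 : 4 * l <= (C * K + 4) * L.
    by apply: ler_pM => //; [exact: ltW|rewrite lerDr].
  have {}e2 := le_trans e2 l4.
  have {}e1 : fexpD t 0 <= (C * K + 4) * L.
    by apply: le_trans l4; apply: (le_trans e1); rewrite ler_peMl ?ler1n// ltW.
  by split; [exact: e1|exact: norm_sub_le].
have n0 : 0 < n.+1%:R :> R by [].
have pw (e : R) : 0 <= e -> e <= 1 + r -> n.+1%:R `^ (- e) <= K * n.+2%:R `^ (- e).
  move=> e0 er; rewrite !powRN ler_pdivlMr ?powR_gt0// mulrC ler_pdivrMr ?powR_gt0//.
  apply: (@le_trans _ _ (2 `^ e * n.+1%:R `^ e)); last first.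
    rewrite ler_wpM2r ?powR_ge0//; apply: ler_powR => //; by rewrite ler1n.
  rewrite -powRM ?ler0n//; apply: ge0_ler_powR; rewrite ?nnegrE ?mulr_ge0 ?ler0n//.
  by rewrite -natrM ler_nat -[n.+2]add2n mulnS leq_add2l leq_pmull.
have pwr : n.+1%:R `^ (- r) <= K * n.+2%:R `^ (- r) by apply: pw => //; rewrite lerDr.
have pwr1 : n.+1%:R `^ (- 1 - r) <= K * n.+2%:R `^ (- 1 - r).
  have -> : - 1 - r = - (1 + r) by ring.
  by apply: pw => //; rewrite addr_ge0.
have CL : 0 <= C * L by rewrite mulr_ge0.
have P0 e : 0 <= n.+2%:R `^ e :> R by exact: powR_ge0.
have fin (e : R) : C * L * (K * n.+2%:R `^ e) <= (C * K + 4) * L * n.+2%:R `^ e.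
  have -> : C * L * (K * n.+2%:R `^ e) = C * K * L * n.+2%:R `^ e by ring.
  rewrite ler_wpM2r// ler_wpM2r// lerDl//.
have mono (e y : R) : 0 <= e -> n.+1%:R <= y -> y `^ (- e) <= n.+1%:R `^ (- e).
  move=> e0 ny; have y0 : 0 < y by exact: lt_le_trans ny.
  rewrite !powRN lef_pV2 ?posrE ?powR_gt0//.
  by apply: ge0_ler_powR; rewrite ?nnegrE ?(ltW y0)// ltW.
split.
  apply: le_trans (fin _); apply: le_trans (ler_wpM2l CL pwr).
  have dd (x : R) : n.+1%:R <= x -> is_derive x 1 (powexp 0 (2 * h) l) (powexp1 0 (2 * h) l x).
    by move=> nx; apply: is_derive_powexp; exact: lt_le_trans nx.
  have [|||c] := @MVT R (powexp 0 (2 * h) l) (powexp1 0 (2 * h) l) n.+1%:R n.+2%:R.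
  - by rewrite ltr_nat.
  - by move=> x; rewrite in_itv/= => /andP[x0 _]; apply: dd; exact: ltW.
  - apply: derivable_within_continuous => x; rewrite in_itv/= => /andP[x0 _].
    by have [] := dd x x0.
  rewrite in_itv/= => /andP[nc cn] E.
  have c0 : 0 < c by apply: lt_trans nc.
  have -> : fexpD t n.+1 = - powexp1 0 (2 * h) l c.
    rewrite /fexpD /fexp -/l -opprB E -[n.+2]addn1 natrD addrAC subrr add0r mulr1.
    by [].
  apply: (le_trans (ler_norm _)); rewrite normrN.
  apply: (le_trans (CP _ _ l0 c0).1); rewrite ler_wpM2l//.
  by apply: mono => //; exact: ltW.
apply: le_trans (fin _); apply: le_trans (ler_wpM2l CL pwr1).
have -> : fexpD t n.+1 - fexpD t n.+2 = powexp 0 (2 * h) l n.+1%:R -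
   powexp 0 (2 * h) l (n.+1%:R + 1) *+ 2 + powexp 0 (2 * h) l (n.+1%:R + 1 *+ 2).
  rewrite /fexpD /fexp -/l natr1 -natrD addn2 mulr2n.
  by move: (powexp _ _ _ _) (powexp _ _ _ _) (powexp _ _ _ _) => u v w; ring.
have -> : C * L * n.+1%:R `^ (- 1 - r) = 1 ^+ 2 * (C * L * n.+1%:R `^ (- 1 - r)).
  by rewrite expr1n mul1r.
apply: (@second_difference_le R _ (powexp1 0 (2 * h) l) (powexp2 0 (2 * h) l)) => //.
- move=> y /andP[ny _]; apply: is_derive_powexp; exact: lt_le_trans ny.
- move=> y /andP[ny _]; apply: is_derive_powexp1; exact: lt_le_trans ny.
- move=> y /andP[ny _]; have y0 : 0 < y by exact: lt_le_trans ny.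
  apply: (le_trans (CP _ _ l0 y0).2); rewrite ler_wpM2l//.
  have -> : - 1 - r = - (1 + r) by ring.
  by apply: mono => //; rewrite addr_ge0.
Qed.

(** The Fejer bound [16 / t^2] meets the factor [(t^2)^(1 - h / 2)] of the coefficients, and the sum
    over [n] converges because [(1 - h)^2 > 0]. The resulting [|t|^(- h)] is integrable at the
    origin. *)
Lemma fsum_near_le : exists2 C : R, 0 <= C & forall t N, t != 0 -> `|t| <= 1 ->
  `|fsum t N - fexp t N * dirichlet t N| <= C * `|t| `^ (- h).
Proof.
have [C C0 CP] := fexpD_le.
have K0 : 0 <= 2 + r^-1 by rewrite addr_ge0// invr_ge0 ltW.
exists (16 * C * (2 + r^-1)); first by apply: mulr_ge0 => //; exact: mulr_ge0.
move=> t N t0 t1.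
have t20 : 0 < t ^+ 2 by rewrite exprn_even_gt0//= t0.
have F0 : 0 <= 16 / t ^+ 2 by rewrite divr_ge0// ltW.
rewrite fsum_dirichlet addrC addKr fsum_fejer.
set L := (t ^+ 2 / 2) `^ (1 - h / 2) in CP *.
have L0 : 0 <= L by exact: powR_ge0.
have CL : 0 <= C * L by exact: mulr_ge0.
apply: (@le_trans _ _ (16 / t ^+ 2 * (C * L * (1 + (1 + r^-1))))).
  apply: (le_trans (ler_normD _ _)).
  rewrite !mulrDr; apply: lerD.
    rewrite normrM mulrC (ger0_norm (fexpD_ge0 _ _)).
    apply: ler_pM => //; [exact: fexpD_ge0|exact: fejer_le|].
    apply: (le_trans (CP _ _ t0 t1).1); rewrite ler_wpM2l//.
    rewrite -[leRHS](powRr0 N.+1%:R); apply: ler_powR; first by rewrite ler1n.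
    by rewrite oppr_le0 sqr_ge0.
  apply: (le_trans (ler_norm_sum _ _ _)).
  rewrite -!mulrDr.
  apply: (@le_trans _ _ (\sum_(n < N) 16 / t ^+ 2 * (C * L * n.+1%:R `^ (- 1 - r)))).
    apply: ler_sum => n _; rewrite normrM mulrC.
    by apply: ler_pM => //; [exact: fejer_le|exact: (CP _ _ t0 t1).2].
  rewrite -!mulr_sumr; apply: ler_wpM2l => //; apply: ler_wpM2l => //.
  exact: psum_powR_le.
have -> : 16 / t ^+ 2 * (C * L * (1 + (1 + r^-1))) = 16 * C * (2 + r^-1) * (L / t ^+ 2).
  by field; rewrite (gt_eqF r0) t0.
apply: ler_wpM2l; first by apply: mulr_ge0 => //; exact: mulr_ge0.
rewrite ler_pdivrMr//.
have tp : 0 < `|t| by rewrite normr_gt0.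
have -> : `|t| `^ (- h) * t ^+ 2 = `|t| `^ (2 * (1 - h / 2)).
  rewrite -[t ^+ 2]real_normK ?num_real// -powR_mulrn// -powRD; last by apply/implyP => _; rewrite normr_eq0.
  by congr (_ `^ _); field.
rewrite powRrM powR_mulrn// real_normK ?num_real//.
apply: ge0_ler_powR; rewrite ?nnegrE ?divr_ge0 ?ltW//.
  by rewrite subr_gt0 ltr_pdivrMr// mul1r (lt_trans h1)// ltr1n.
by rewrite gtr_pMr// invf_lt1// ltr1n.
Qed.

(** What remains of the partial sum once its part concentrating at [0] is
    removed. *)
Definition fsum_rem (t : R) (N : nat) : R :=
  fsum t N - fexp t N * (2 * sin ((N%:R + 2^-1) * t) / t).

Lemma fsum_rem_le : exists2 C : R, 0 <= C & forall t N, t != 0 ->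
  `|fsum_rem t N| <= C * (1 + `|t| `^ (- h)).
Proof.
have [C C0 CP] := fsum_near_le; have [D DP] := fsum_le_away.
have D0 : 0 <= D by apply: (le_trans _ (DP 1 0 _)); rewrite ?normr1.
exists (C + 1 + D + 2); first by rewrite !addr_ge0.
move=> t N t0; have p0 := powR_ge0 `|t| (- h).
have fN : `|fexp t N| <= 1 by rewrite ger0_norm ?fexp_ge0// fexp_le1.
have [t1|t1] := leP `|t| 1.
  have -> : fsum_rem t N = (fsum t N - fexp t N * dirichlet t N) +
     fexp t N * (dirichlet t N - 2 * sin ((N%:R + 2^-1) * t) / t).
    by rewrite /fsum_rem; ring.
  apply: (le_trans (ler_normD _ _)); apply: (le_trans (lerD (CP _ _ t0 t1) (lexx _))).
  rewrite normrM.
  have := ler_pM (normr_ge0 _) (normr_ge0 _) fN (dirichlet_sub_le N t0 t1).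
  rewrite mulr1 => H; apply: (le_trans (lerD (lexx _) H)).
  move: (`|t| `^ (- h)) p0 => p p0.
  have Cp : 0 <= C * p by exact: mulr_ge0.
  have Dp : 0 <= D * p by exact: mulr_ge0.
  rewrite mulrDr mulr1 !mulrDl; move: (C * p) (D * p) Cp Dp => *; lra.
apply: (@le_trans _ _ (D + 2)).
  apply: (le_trans (ler_normB _ _)); apply: lerD; first by apply: DP; exact: ltW.
  rewrite normrM -[leRHS]mul1r; apply: ler_pM => //.
  rewrite -mulrA normrM ger0_norm// -[leRHS]mulr1 ler_wpM2l// normrM.
  rewrite -[leRHS]mulr1; apply: ler_pM => //; first exact: norm_sin_le1.
  by rewrite normfV invf_le1 ?(lt_trans _ t1)// ltW.
have -> : (C + 1 + D + 2) * (1 + `|t| `^ (- h)) = (D + 2) + (C + 1 + (C + 1 + D + 2) * `|t| `^ (- h)) by ring.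
by rewrite lerDl; apply: addr_ge0; [exact: addr_ge0|apply: mulr_ge0 => //; rewrite !addr_ge0].
Qed.

Lemma cvg_fsum_rem (t : R) : t != 0 ->
  fsum_rem t N @[N --> \oo] --> fbm_structure_factor h t.
Proof.
move=> t0; rewrite -[X in _ --> X]subr0; apply: cvgB; first exact: cvg_fsum.
apply/cvgr0Pnorm_le => e e0.
have b0 : 0 < 2 / `|t| by rewrite divr_gt0// normr_gt0.
have /cvgr0Pnorm_le/(_ (e / (2 / `|t|)) (divr_gt0 e0 b0)) := cvg_fexp t0.
apply: filterS => N /= H; rewrite normrM.
have -> : e = e / (2 / `|t|) * (2 / `|t|) by rewrite divfK// gt_eqF.
apply: ler_pM => //; rewrite !normrM normfV ger0_norm//.
by rewrite ler_wpM2r// ler_piMr// norm_sin_le1.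
Qed.

End coefficients.

Lemma integrable_cst_fin (R : realType) (d : measure_display)
    (T : measurableType d) (m : measure T R) (D : set T) (k : R) :
  measurable D -> (m D < +oo)%E -> m.-integrable D (EFin \o cst k).
Proof.
move=> mD Doo; apply/integrableP; split; first exact/measurable_EFinP.
rewrite (eq_integral (cst `|k|%:E)) ?integral_cst//.
by rewrite lte_mul_pinfty// lee_fin.
Qed.

(** * Asymptotics at the origin *)

Section asymptotics.
Context {R : realType}.
Variable h : R.
Hypotheses (h0 : 0 < h) (h1 : h < 1).

Notation mu := (@lebesgue_measure R).

Let z0 : 0 < 2 * h. Proof. by rewrite mulr_gt0. Qed.

(** An exact identity: up to a factor near [1], the value of the sine at the midpoint of a cell is
    its integral over the cell. Comparing the sum with the integral thus causes no error from the
    oscillating factor. *)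
Lemma sin_cell (t x : R) : 0 < t -> t <= 1 ->
  t / 2 / sin (t / 2) * \int[mu]_(y in `]x, x + 1]) sin (t * y) =
  sin ((x + 2^-1) * t).
Proof.
move=> t0 t1.
have s0 : 0 < sin (t / 2).
  by apply: (lt_le_trans _ (sin_half_ge _)); rewrite ?divr_gt0// (ltW t0).
have csin : continuous (fun y : R => sin (t * y)).
  by move=> y; apply: continuous_comp; [exact: cvgM (cvg_cst _) cvg_id|exact: continuous_sin].
have ii : mu.-integrable `[x, x + 1] (EFin \o (fun y : R => sin (t * y))).
  apply: continuous_compact_integrable; first exact: segment_compact.
  exact: continuous_subspaceT.
have xx1 : x < x + 1 by rewrite ltrDl.
rewrite Rintegral_itv_obnd_cbnd; last by apply: integrableS ii => //; exact: subset_itv_oc_cc.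
rewrite (@Rintegral_improper R _ (fun _ => x) (fun _ => x + 1) _ _ _ _
  (fun y => - (t^-1 * cos (t * y))) _ _ _ (- (t^-1 * cos (t * (x + 1))) + (t^-1 * cos (t * x))))//.
- have -> : t * (x + 1) = (x + 2^-1) * t + t / 2 by field.
  have -> : t * x = (x + 2^-1) * t - t / 2 by field.
  by rewrite cosB cosD; field; rewrite !gt_eqF.
- apply/seteqP; split=> y; first by move=> Hy; exists 0%N.
  by case.
- move=> y _; apply: is_derive_eq; rewrite /GRing.scale/=; field; rewrite gt_eqF//.
- by move=> y _; exact: csin.
- by rewrite opprK; exact: cvg_cst.
Qed.

Lemma powexp1_0E (l y : R) : powexp1 0 (2 * h) l y = - (2 * h * l * powexp (2 * h - 1) (2 * h) l y).
Proof. by rewrite /powexp1 mul0r sub0r add0r mulrA [l * _]mulrC. Qed.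

Lemma integrable_powexp1 (l : R) : 0 < l ->
  mu.-integrable `]0, +oo[ (EFin \o powexp1 0 (2 * h) l).
Proof.
move=> l0; rewrite (_ : powexp1 _ _ _ = (fun y => - (2 * h * l) * powexp (2 * h - 1) (2 * h) l y)).
  apply: (@integrableZ_R _ _ (measurableTypeR R) mu) => //; apply: integrable_powexp => //.
  by rewrite ltrBDr addrC subrr.
by apply/funext => y; rewrite powexp1_0E mulNr.
Qed.

Lemma integrable_powexp1_sin (l t : R) : 0 < l ->
  mu.-integrable `]0, +oo[ (EFin \o (fun y => powexp1 0 (2 * h) l y * sin (t * y))).
Proof.
move=> l0; apply: (@le_integrable_R _ _ (measurableTypeR R) mu _ _ (fun y => `|powexp1 0 (2 * h) l y|)) => //.
- apply: measurable_funM.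
    by apply/measurable_EFinP; exact: (measurable_int mu (integrable_powexp1 l0)).
  apply: measurable_funTS; apply: measurableT_comp; last exact: measurable_funM.
  exact: (continuous_measurable_fun (@continuous_sin R)).
- by move=> y _; rewrite normrM ler_piMr// norm_sin_le1.
- rewrite (_ : EFin \o _ = abse \o (EFin \o powexp1 0 (2 * h) l)); last exact/funext.
  by apply: integrable_abse; exact: integrable_powexp1.
Qed.

(** The difference of consecutive coefficients is minus a value of the derivative inside the cell.
    After [sin_cell] the error is only the oscillation of that derivative, which the second
    derivative bounds; the factor [2] bounds [(t / 2) / sin (t / 2)]. *)
Lemma fexpD_cell : exists2 C : R, 0 <= C & forall t n, 0 < t -> t <= 1 ->
  `|fexpD h t n.+1 * sin ((n.+1%:R + 2^-1) * t) + t / 2 / sin (t / 2) *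
    \int[mu]_(y in `]n.+1%:R, n.+1%:R + 1])
      (powexp1 0 (2 * h) (t ^+ 2 / 2) y * sin (t * y))| <=
  C * (t ^+ 2 / 2) `^ (1 - h / 2) * n.+1%:R `^ (- 1 - (1 - h) ^+ 2).
Proof.
have [C C0 CP] := powexp_derive_le h0.
exists (2 * C); first by exact: mulr_ge0.
move=> t n t0 t1.
have s0 : t / 4 <= sin (t / 2) by apply: sin_half_ge; rewrite (ltW t0).
have s1 : 0 < sin (t / 2) by apply: lt_le_trans s0; rewrite divr_gt0.
have c0 : 0 <= t / 2 / sin (t / 2) by rewrite !divr_ge0// ltW.
have c2 : t / 2 / sin (t / 2) <= 2 by rewrite ler_pdivrMr//; lra.
have l0 : 0 < t ^+ 2 / 2 by rewrite divr_gt0// exprn_gt0.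
rewrite -sin_cell// mulrCA.
set l := t ^+ 2 / 2 in l0 *; set c := _ / sin _ in c0 c2 *.
set D := `]n.+1%:R, _]%classic.
have mD : measurable (D : set (measurableTypeR R)) by exact: measurable_itv.
have muD : mu D = 1%:E.
  by rewrite lebesgue_measure_itv/= lte_fin ltrDl ltr01 EFinN -EFinD addrAC subrr add0r.
have isin : mu.-integrable D (EFin \o (fun y : R => sin (t * y))).
  apply: (@le_integrable_R _ _ (measurableTypeR R) mu _ _ (cst 1)) => //.
  - apply: measurable_funTS; apply: measurableT_comp; last exact: measurable_funM.
    exact: (continuous_measurable_fun (@continuous_sin R)).
  - by move=> y _; rewrite norm_sin_le1.
  - by apply: integrable_cst_fin => //; rewrite [X in (X < _)%E]muD ltry.
have iw : mu.-integrable D (EFin \o (fun y : R => powexp1 0 (2 * h) l y * sin (t * y))).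
  apply: integrableS (integrable_powexp1_sin t l0) => //.
  by move=> y; rewrite /D/= !in_itv/= => /andP[+ _]; rewrite andbT; apply: lt_trans.
rewrite -mulrDr -RintegralZl// -RintegralD//; last exact: (integrableZ_R mD).
have dd (x : R) : n.+1%:R <= x -> is_derive x 1 (powexp 0 (2 * h) l) (powexp1 0 (2 * h) l x).
  by move=> nx; apply: is_derive_powexp; exact: lt_le_trans nx.
have [|||xi] := @MVT R (powexp 0 (2 * h) l) (powexp1 0 (2 * h) l) n.+1%:R n.+2%:R.
- by rewrite ltr_nat.
- by move=> x; rewrite in_itv/= => /andP[x0 _]; apply: dd; exact: ltW.
- apply: derivable_within_continuous => x; rewrite in_itv/= => /andP[x0 _].
  by have [] := dd x x0.
rewrite in_itv/= => /andP[nxi xin] E.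
have aE : fexpD h t n.+1 = - powexp1 0 (2 * h) l xi.
  rewrite /fexpD /fexp -/l -opprB E -[n.+2]addn1 natrD addrAC subrr add0r mulr1.
  by [].
pose M := C * l `^ (1 - h / 2) * n.+1%:R `^ (- 1 - (1 - h) ^+ 2).
have M0 : 0 <= M by apply: mulr_ge0; [apply: mulr_ge0 => //|]; exact: powR_ge0.
have osc (y : R) : D y -> `|fexpD h t n.+1 + powexp1 0 (2 * h) l y| <= M.
  rewrite /D/= in_itv/= => /andP[ny yn].
  rewrite aE addrC.
  have yn' : y <= n.+2%:R by rewrite -[n.+2%:R]natr1.
  have b (u : R) : n.+1%:R <= u -> `|powexp2 0 (2 * h) l u| <= M.
    move=> nu; have u0 : 0 < u by exact: lt_le_trans nu.
    apply: (le_trans (CP _ _ l0 u0).2); rewrite ler_wpM2l//.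
      by apply: mulr_ge0 => //; exact: powR_ge0.
    have -> : - 1 - (1 - h) ^+ 2 = - (1 + (1 - h) ^+ 2) by ring.
    rewrite !powRN lef_pV2 ?posrE ?powR_gt0//.
    by apply: ge0_ler_powR; rewrite ?nnegrE ?(ltW u0)// addr_ge0// sqr_ge0.
  have osc1 (u v : R) : n.+1%:R < u -> u < v -> v <= n.+2%:R ->
      `|powexp1 0 (2 * h) l v - powexp1 0 (2 * h) l u| <= M.
    move=> nu uv vn.
    have dd1 (x : R) : u <= x -> is_derive x 1 (powexp1 0 (2 * h) l) (powexp2 0 (2 * h) l x).
      by move=> ux; apply: is_derive_powexp1; apply: lt_le_trans ux; apply: lt_trans nu.
    have [||eta] := @MVT R (powexp1 0 (2 * h) l) (powexp2 0 (2 * h) l) u v uv.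
    - by move=> x; rewrite in_itv/= => /andP[x0 _]; apply: dd1; exact: ltW.
    - apply: derivable_within_continuous => x; rewrite in_itv/= => /andP[x0 _].
      by have [] := dd1 x x0.
    rewrite in_itv/= => /andP[ueta _] ->.
    rewrite normrM (ger0_norm (_ : 0 <= v - u)) ?subr_ge0 ?(ltW uv)//.
    rewrite -[leRHS]mulr1; apply: ler_pM => //; rewrite ?subr_ge0 ?(ltW uv)//.
      by apply: b; apply: ltW; apply: lt_trans ueta.
    by move: vn nu; rewrite -[n.+2%:R]natr1; move: (n.+1%:R) => w vn nu; lra.
  have [xy|yx|->] := ltgtP xi y.
  - exact: osc1.
  - by rewrite distrC; apply: osc1 => //; exact: ltW.
  - by rewrite subrr normr0.
rewrite normrM (ger0_norm c0).
have ->: 2 * C * l `^ (1 - h / 2) * n.+1%:R `^ (- 1 - (1 - h) ^+ 2) = 2 * M by rewrite /M; ring.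
apply: ler_pM => //.
under eq_Rintegral do rewrite -mulrDl.
have ig : mu.-integrable D (EFin \o (fun x : R => (fexpD h t n.+1 + powexp1 0 (2 * h) l x) * sin (t * x))).
  rewrite (_ : (fun x : R => _) = (fun x => fexpD h t n.+1 * sin (t * x) + powexp1 0 (2 * h) l x * sin (t * x))).
    by apply: (integrableD_R mD) => //; exact: (integrableZ_R mD).
  by apply/funext => x; rewrite mulrDl.
apply: (le_trans (le_normr_Rintegral mD ig)).
have -> : M = \int[mu]_(x in D) (cst M) x.
  by rewrite Rintegral_cst// [X in fine X]muD mulr1.
apply: le_Rintegral => //.
- rewrite (_ : EFin \o _ =
    abse \o (EFin \o (fun x : R => (fexpD h t n.+1 + powexp1 0 (2 * h) l x) * sin (t * x)))); last exact/funext.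
  exact: integrable_abse.
- by apply: integrable_cst_fin => //; rewrite [X in (X < _)%E]muD ltry.
- move=> x Dx; rewrite normrM; apply: le_trans (osc x Dx).
  by rewrite ler_piMr// norm_sin_le1.
Qed.

Lemma cvg_Rintegral_pinf (f : R -> R) : mu.-integrable `]0, +oo[ (EFin \o f) ->
  \int[mu]_(x in `]0, N%:R]) f x @[N --> \oo] --> \int[mu]_(x in `]0, +oo[) f x.
Proof.
move=> fi; rewrite Rintegral_mkcond.
under eq_cvg do rewrite Rintegral_mkcond.
have fm : measurable_fun (`]0, +oo[ : set (measurableTypeR R)) f.
  by apply/measurable_EFinP; exact: measurable_int fi.
have sub N : `]0, N%:R]%classic `<=` (`]0, +oo[%classic : set R).
  by move=> x; rewrite /= !in_itv/= andbT => /andP[].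
apply: (@Rdominated_cvg R _ (measurableTypeR R) mu setT _ _ (fun x => `|f \_ `]0, +oo[ x|) _ _ _ _ _ _).2 => //.
- by move=> N; apply/(measurable_restrictT _ (measurable_itv _)); exact: measurable_funS fm.
- by apply/(measurable_restrictT _ (measurable_itv _)).
- apply: nearW => x _; apply: cvg_near_cst.
  near=> N; rewrite !patchE !mem_setE !in_itv/= andbT; case: ltP => //= x0.
  rewrite ifT//; apply: ltW; apply: lt_le_trans (_ : (Num.truncn x).+1%:R <= _).
    exact: truncnS_gt.
  by rewrite ler_nat; near: N; exact: nbhs_infty_ge.
- rewrite (_ : EFin \o _ = abse \o ((EFin \o f) \_ `]0, +oo[)).
    by apply: integrable_abse; rewrite -integrable_mkcond//.
  by apply/funext => x /=; rewrite !patchE; case: ifP => //=; rewrite normr0.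
- move=> N x _; rewrite !patchE; case: ifP => // xN; last by rewrite normr0.
  by rewrite ifT//; apply/mem_set/(sub N)/set_mem.
Unshelve. all: by end_near. Qed.

Lemma fexpD_sum : exists2 C : R, 0 <= C & forall t N, 0 < t -> t <= 1 ->
  `|\sum_(n < N.+1) fexpD h t n * sin ((n%:R + 2^-1) * t) + t / 2 / sin (t / 2) *
    \int[mu]_(y in `]0, N.+1%:R])
      (powexp1 0 (2 * h) (t ^+ 2 / 2) y * sin (t * y))| <=
  C * (t ^+ 2 / 2) `^ (1 - h / 2) * (1 + \sum_(n < N) n.+1%:R `^ (- 1 - (1 - h) ^+ 2)).
Proof.
have [C C0 CP] := fexpD_cell.
have I1 : mu.-integrable `]0, 1] (EFin \o (fun y : R => 2 * h * y `^ (2 * h - 1))).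
  apply: (@integrableZ_R _ _ (measurableTypeR R) mu) => //; apply: integrable_powR_near0 => //.
  by rewrite ltrBDr addrC subrr.
(* On the first cell the second derivative is not bounded, and the sum and the integral are
   estimated separately: the derivative is at most [l] times this integrand. *)
set K := \int[mu]_(y in `]0, 1]) (2 * h * y `^ (2 * h - 1)).
have K0 : 0 <= K by apply: Rintegral_ge0 => y _; rewrite mulr_ge0 ?powR_ge0// ltW.
exists (C + 1 + 2 * K); first by rewrite !addr_ge0// mulr_ge0.
move=> t N t0 t1.
have s0 : t / 4 <= sin (t / 2) by apply: sin_half_ge; rewrite (ltW t0).
have s1 : 0 < sin (t / 2) by apply: lt_le_trans s0; rewrite divr_gt0.
have c0 : 0 <= t / 2 / sin (t / 2) by rewrite !divr_ge0// ltW.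
have c2 : t / 2 / sin (t / 2) <= 2 by rewrite ler_pdivrMr//; lra.
have l0 : 0 < t ^+ 2 / 2 by rewrite divr_gt0// exprn_gt0.
have l1 : t ^+ 2 / 2 <= 1.
  by rewrite ler_pdivrMr// mul1r (@le_trans _ _ 1) ?ler1n// exprn_ile1// ltW.
have a0l : fexpD h t 0 <= t ^+ 2 / 2.
  rewrite /fexpD fexp0// fexpE powR1 mulr1 lerBlDr -lerBlDl.
  by have := expR_ge1Dx (- (t ^+ 2 / 2)).
have iw := integrable_powexp1_sin t l0.
set l := t ^+ 2 / 2 in l0 l1 a0l iw *; set c := _ / sin _ in c0 c2 *.
set L := l `^ (1 - h / 2).
have lL : l <= L.
  rewrite -[leLHS]powRr1 ?(ltW l0)//; apply: ger_powR; rewrite ?l0 ?l1//.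
  by rewrite gerBl divr_ge0// ltW.
have L0 : 0 <= L by exact: powR_ge0.
have sub (a b : R) : 0 <= a -> `]a, b]%classic `<=` (`]0, +oo[%classic : set R).
  by move=> a0 x; rewrite /= !in_itv/= andbT => /andP[+ _]; exact: le_lt_trans.
elim: N => [|N IH].
  rewrite big_ord1 big_ord0 addr0 mulr1.
  apply: (le_trans (ler_normD _ _)).
  apply: (@le_trans _ _ (1 * L + 2 * (K * L))); last first.
    have -> : (C + 1 + 2 * K) * L = C * L + (1 * L + 2 * (K * L)) by ring.
    by rewrite lerDr mulr_ge0.
  apply: lerD.
    rewrite normrM ger0_norm ?fexpD_ge0// mulrC.
    by apply: ler_pM; rewrite ?fexpD_ge0 ?norm_sin_le1// (le_trans a0l).
  rewrite normrM (ger0_norm c0); apply: ler_pM => //.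
  apply: (le_trans (le_normr_Rintegral _ _)) => //.
    by apply: integrableS iw => //; apply: sub.
  apply: (@le_trans _ _ (l * K)); last by rewrite mulrC ler_wpM2l.
  rewrite -RintegralZl//; apply: le_Rintegral => //.
  - rewrite (_ : EFin \o _ = abse \o (EFin \o (fun y : R => powexp1 0 (2 * h) l y * sin (t * y)))); last exact/funext.
    by apply: integrable_abse; apply: integrableS iw => //; apply: sub.
  - by apply: (@integrableZ_R _ _ (measurableTypeR R) mu).
  - move=> y; rewrite /= in_itv/= => /andP[y0 _].
    rewrite normrM; apply: (le_trans (ler_piMr _ (norm_sin_le1 _))) => //.
    rewrite powexp1_0E normrN ger0_norm; last first.
      by apply: mulr_ge0; [apply: mulr_ge0; exact: ltW|exact: powexp_ge0].
    have -> : l * (2 * h * y `^ (2 * h - 1)) = 2 * h * l * y `^ (2 * h - 1) by ring.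
    apply: ler_wpM2l; first by apply: mulr_ge0; exact: ltW.
    rewrite /powexp ler_piMr ?powR_ge0// -expR0 ler_expR oppr_le0.
    by rewrite mulr_ge0 ?powR_ge0// ltW.
rewrite big_ord_recr/= [in leRHS]big_ord_recr/=.
have -> : \int[mu]_(y in `]0, N.+2%:R]) (powexp1 0 (2 * h) l y * sin (t * y)) =
  \int[mu]_(y in `]0, N.+1%:R]) (powexp1 0 (2 * h) l y * sin (t * y)) +
  \int[mu]_(y in `]N.+1%:R, N.+1%:R + 1]) (powexp1 0 (2 * h) l y * sin (t * y)).
  apply/eqP; rewrite addrC -subr_eq; apply/eqP.
  rewrite -[N.+2%:R]natr1 Rintegral_itvB//.
    by apply: integrableS iw => //; apply: sub.
    by rewrite bnd_simp ler0n.
  by rewrite bnd_simp lerDl.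
rewrite mulrDr addrACA.
apply: (le_trans (ler_normD _ _)); rewrite addrA mulrDr; apply: lerD => //.
apply: (le_trans (CP _ _ t0 t1)); rewrite -/l -/L.
rewrite ler_wpM2r ?powR_ge0// ler_wpM2r// -addrA lerDl addr_ge0// mulr_ge0//.
Qed.

(** The error is of order [t^(2 - h)], negligible against the order [t^(2 - 2h)] of the main
    term. *)
Lemma structure_factor_sine_integral : exists2 C : R, 0 <= C & forall t : R, 0 < t -> t <= 1 ->
  `|fbm_structure_factor h t * sin (t / 2) + t / 2 / sin (t / 2) *
    \int[mu]_(y in `]0, +oo[)
      (powexp1 0 (2 * h) (t ^+ 2 / 2) y * sin (t * y))| <=
  C * (t ^+ 2 / 2) `^ (1 - h / 2).
Proof.
have [C C0 CP] := fexpD_sum.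
have r0 : 0 < (1 - h) ^+ 2 by rewrite exprn_even_gt0//= subr_eq0 gt_eqF.
exists (C * (1 + (1 + ((1 - h) ^+ 2)^-1))).
  by apply: mulr_ge0 => //; rewrite !addr_ge0// invr_ge0 ltW.
move=> t t0 t1.
have tn0 : t != 0 by rewrite gt_eqF.
have l0 : 0 < t ^+ 2 / 2 by rewrite divr_gt0// exprn_gt0.
set l := t ^+ 2 / 2 in l0 *; set c := _ / sin _.
set J := \int[mu]_(_ in `]0, +oo[) _.
have lim : (\sum_(n < N.+1) fexpD h t n * sin ((n%:R + 2^-1) * t) + c *
    \int[mu]_(y in `]0, N.+1%:R])
      (powexp1 0 (2 * h) l y * sin (t * y))) @[N --> \oo] -->
    fbm_structure_factor h t * sin (t / 2) + c * J.
  rewrite (cvg_shiftS (fun N => \sum_(n < N) fexpD h t n * sin ((n%:R + 2^-1) * t) + c *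
    \int[mu]_(y in `]0, N%:R]) (powexp1 0 (2 * h) l y * sin (t * y)))).
  apply: cvgD; last first.
    apply: cvgM; first exact: cvg_cst.
    by apply: cvg_Rintegral_pinf; exact: integrable_powexp1_sin.
  rewrite (_ : (fun N => _) = (fun N => fsum h t N * sin (t / 2) -
     fexp h t N * sin ((N%:R + 2^-1) * t))).
    rewrite -[X in _ --> X]subr0; apply: cvgB.
      by apply: cvgM; [exact: cvg_fsum|exact: cvg_cst].
    have /cvgr0Pnorm_le cf := cvg_fexp h0 tn0.
    apply/cvgr0Pnorm_le => e /cf; apply: filterS => N; apply: le_trans.
    by rewrite normrM ler_piMr// norm_sin_le1.
  apply/funext => N; rewrite fsum_dirichlet// mulrDl.
  rewrite mulrAC -mulrA dirichletE addrC addKr mulr_suml.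
  by apply: eq_bigr => n _; rewrite -mulrA [_ * sin (t / 2)]mulrC dirichletE.
move/cvg_norm : lim => lim.
rewrite -(cvg_lim _ lim)//; apply: limr_le; first exact: cvgP lim.
apply: nearW => N; apply: (le_trans (CP t N t0 t1)).
rewrite mulrAC ler_wpM2r ?powR_ge0// ler_wpM2l// lerD2l.
exact: psum_powR_le.
Qed.

Lemma sine_integral_scale (t : R) : 0 < t ->
  \int[mu]_(y in `]0, +oo[) (powexp1 0 (2 * h) (t ^+ 2 / 2) y * sin (t * y)) =
  - (h * t `^ (2 - 2 * h) * \int[mu]_(x in `]0, +oo[)
    (powexp (2 * h - 1) (2 * h) (t `^ (2 - 2 * h) / 2) x * sin x)).
Proof.
move=> t0; have tV0 : 0 < t^-1 by rewrite invr_gt0.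
have l0 : 0 < t ^+ 2 / 2 by rewrite divr_gt0// exprn_gt0.
rewrite [LHS]Rintegral_mkcond [in RHS]Rintegral_mkcond.
rewrite (Rintegral_affine 0 tV0); last first.
  rewrite -restrict_EFin; apply/(integrable_mkcond _ _).1 => //.
  exact: integrable_powexp1_sin.
have i2 : mu.-integrable setT (EFin \o
    ((fun x => powexp (2 * h - 1) (2 * h) (t `^ (2 - 2 * h) / 2) x * sin x) \_ `]0, +oo[)).
  rewrite -restrict_EFin; apply/(integrable_mkcond _ _).1 => //.
  apply: (@le_integrable_R _ _ (measurableTypeR R) mu _ _ (powexp (2 * h - 1) (2 * h) (t `^ (2 - 2 * h) / 2))) => //.
  - by apply: measurable_funTS; apply: measurable_funM; [exact: measurable_powexp|exact: (continuous_measurable_fun (@continuous_sin R))].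
  - by move=> y _; rewrite normrM (ger0_norm (powexp_ge0 _ _ _ _)) ler_piMr ?powexp_ge0// norm_sin_le1.
  - by apply: integrable_powexp => //; [rewrite ltrBDr addrC subrr|rewrite divr_gt0// powR_gt0].
have -> : - (h * t `^ (2 - 2 * h) * \int[mu]_x ((fun x => powexp (2 * h - 1) (2 * h) (t `^ (2 - 2 * h) / 2) x * sin x) \_ `]0, +oo[) x) =
    t^-1 * (- (h * t `^ (2 - 2 * h) * t) * \int[mu]_x ((fun x => powexp (2 * h - 1) (2 * h) (t `^ (2 - 2 * h) / 2) x * sin x) \_ `]0, +oo[) x).
  by field; rewrite gt_eqF.
congr (_ * _); rewrite -RintegralZl//.
apply: eq_Rintegral => x _; rewrite !restrict_pinf addr0 pmulr_rgt0//.
case: ltP => x0; last by rewrite !mulr0.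
rewrite mulrA mulfV ?gt_eqF// mul1r powexp1_0E /powexp.
have E1 : (t^-1 * x) `^ (2 * h - 1) = t `^ (1 - 2 * h) * x `^ (2 * h - 1).
  rewrite powRM ?(ltW tV0) ?(ltW x0)// -(powR_inv1 (ltW t0)) -powRrM.
  by congr (_ `^ _ * _); ring.
have E2 : t ^+ 2 / 2 * (t^-1 * x) `^ (2 * h) = t `^ (2 - 2 * h) / 2 * x `^ (2 * h).
  rewrite powRM ?(ltW tV0) ?(ltW x0)// -(powR_inv1 (ltW t0)) -powRrM.
  rewrite powRD; last by apply/implyP => _; rewrite gt_eqF.
  rewrite (powR_mulrn 2 (ltW t0)).
  have -> : -1 * (2 * h) = - (2 * h) by ring.
  by ring.
rewrite E1 E2.
have E3 : t `^ (2 - 2 * h) = t `^ (1 - 2 * h) * t.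
  rewrite -[X in _ = _ * X]powRr1 ?(ltW t0)// -powRD; last by apply/implyP => _; rewrite gt_eqF.
  by congr (_ `^ _); ring.
move: (expR _) (sin x) => e s.
rewrite E3; move: (t `^ (1 - 2 * h)) (x `^ (2 * h - 1)) => u v.
by field.
Qed.

(** Positivity of [alpha h] depends on it, and the equivalence at the origin is an estimate relative
    to [alpha h * |t|^(1 - 2h)]. *)
Lemma Gamma_gt0 (x : R) : 0 < x -> 0 < Gamma x.
Proof.
move=> x0; rewrite /Gamma.
have -> : \int[mu]_(y in `]0, +oo[) (y `^ (x - 1) * expR (- y)) =
    \int[mu]_(y in `]0, +oo[) powexp (x - 1) 1 1 y.
  apply: eq_Rintegral => y; rewrite inE/= in_itv/= andbT => y0.
  by rewrite /powexp mul1r powRr1// ltW.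
have ip : mu.-integrable `]0, +oo[ (EFin \o powexp (x - 1) 1 1).
  by apply: integrable_powexp => //; rewrite ltrBDr addrC subrr.
(* A lower bound of the integrand on [[1, 2]]; the minimum covers both directions of monotonicity of
   [y^(x - 1)]. *)
pose m := expR (- 2) * Order.min 1 (2 `^ (x - 1)).
have m0 : 0 < m by rewrite mulr_gt0 ?expR_gt0// lt_min ltr01 powR_gt0.
have sub : `[1, 2]%classic `<=` (`]0, +oo[%classic : set R).
  by move=> y; rewrite /= !in_itv/= andbT => /andP[+ _]; exact: lt_le_trans.
have mu12 : mu (`[1, 2]%classic : set R) = 1%:E.
  by rewrite lebesgue_measure_itv/= lte_fin ltr1n -EFinD; congr EFin; ring.
apply: (@lt_le_trans _ _ (\int[mu]_(y in `[1, 2]) powexp (x - 1) 1 1 y)).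
  apply: (@lt_le_trans _ _ (\int[mu]_(y in `[1, 2]) (cst m) y)).
    by rewrite Rintegral_cst// [X in fine X]mu12 mulr1.
  apply: le_Rintegral => //.
  - by apply: integrable_cst_fin => //; rewrite [X in (X < _)%E]mu12 ltry.
  - exact: integrableS ip.
  - move=> y; rewrite /= in_itv/= => /andP[y1 y2].
    have y0 : 0 < y by exact: lt_le_trans y1.
    rewrite /powexp /m mulrC mul1r powRr1 ?(ltW y0)//.
    apply: ler_pM; rewrite ?expR_ge0 ?le_min ?ler01 ?powR_ge0 ?ler_expR ?lerN2//.
    have [x1|x1] := leP 1 x.
      rewrite ge_min; apply/orP; left.
      by rewrite -[leLHS](powRr0 y) ler_powR ?subr_ge0.
    rewrite ge_min; apply/orP; right.
    have -> : x - 1 = - (1 - x) by ring.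
    rewrite !powRN lef_pV2 ?posrE ?powR_gt0//.
    by apply: ge0_ler_powR; rewrite ?nnegrE ?subr_ge0 ?(ltW y0)// ltW.
rewrite /Rintegral; apply: fine_le.
- by apply: integrable_fin_num => //; exact: integrableS ip.
- exact: integrable_fin_num.
- apply: ge0_subset_integral => //; first exact: measurable_int ip.
  by move=> y _; rewrite lee_fin powexp_ge0.
Qed.

Lemma alpha_gt0 : 0 < alpha h.
Proof.
rewrite /alpha; apply: mulr_gt0; last first.
  by apply: sin_gt0_pi; rewrite ?mulr_gt0 ?pi_gt0//= gtr_pMr ?pi_gt0.
by rewrite mulr_gt0// Gamma_gt0.
Qed.

(** Stated along sequences because it relies on dominated convergence; the one-sided limits at [0]
    are recovered from it. *)
Lemma cvg_structure_factor (t_ : nat -> R) :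
  (forall n, 0 < t_ n) -> t_ n @[n --> \oo] --> 0 ->
  fbm_structure_factor h (t_ n) / (t_ n) `^ (1 - 2 * h) @[n --> \oo] --> alpha h.
Proof.
move=> t0 tc.
have [C C0 CP] := structure_factor_sine_integral.
pose I (t : R) := \int[mu]_(x in `]0, +oo[)
    (powexp (2 * h - 1) (2 * h) (t `^ (2 - 2 * h) / 2) x * sin x).
have t1 : \forall n \near \oo, t_ n <= 1.
  have /cvgr0Pnorm_le/(_ 1 ltr01) := tc.
  by apply: filterS => n; apply: le_trans; exact: ler_norm.
have powc (a : R) : 0 < a -> (t_ n) `^ a @[n --> \oo] --> 0.
  by move=> a0; have /cvg_at_rightP := powR_cvg0 a0; apply.
have Ic : I (t_ n) @[n --> \oo] --> Gamma (2 * h) * sin (pi * h).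
  have -> : pi * h = 2 * h * (pi / 2) :> R by field.
  apply: cvg_powexp_sin => //.
  - by rewrite gtr_pMr.
  - by move=> n; rewrite divr_gt0// powR_gt0.
  - rewrite -(mul0r (2^-1 : R)); apply: cvgM; last exact: cvg_cst.
    by apply: powc; rewrite subr_gt0 gtr_pMr.
have sc : t_ n / sin (t_ n / 2) @[n --> \oo] --> (2 : R).
  apply/cvgrPdist_le => e e0.
  have /cvgr0Pnorm_le/(_ e e0) te := powc 2 ltac:(by []).
  near=> n.
  have q4 : t_ n / 4 <= sin (t_ n / 2).
    by apply: sin_half_ge; rewrite (ltW (t0 n))/=; near: n.
  have q0 : 0 < sin (t_ n / 2) by apply: lt_le_trans q4; rewrite divr_gt0.
  have -> : 2 - t_ n / sin (t_ n / 2) = - (t_ n - 2 * sin (t_ n / 2)) / sin (t_ n / 2).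
    by field; rewrite gt_eqF.
  rewrite normrM normrN normfV (ger0_norm (ltW q0)) ler_pdivrMr//.
  apply: (le_trans (sub_sin_half_le _)); rewrite (ger0_norm (ltW (t0 n))).
  apply: (@le_trans _ _ (e * (t_ n / 4))); last by rewrite ler_pM2l.
  have : `|t_ n `^ 2| <= e by near: n.
  rewrite powR_mulrn ?(ltW (t0 n))// ger0_norm ?sqr_ge0//.
  by move: (t_ n) (t0 n) => t t0' te2; rewrite exprS; nra.
(* One factor [t / sin (t / 2)] comes from dividing by [sin (t / 2)], the other from the cells; each
   tends to [2]. With [h / 2] they give the coefficient [2 h], and the error divided by [t^(2 - 2h)]
   is at most [C t^h]. *)
pose g n := t_ n / sin (t_ n / 2) * (t_ n / sin (t_ n / 2) * (h / 2 * I (t_ n)) + 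
   (fbm_structure_factor h (t_ n) * sin (t_ n / 2) + t_ n / 2 / sin (t_ n / 2) *
    \int[mu]_(y in `]0, +oo[)
      (powexp1 0 (2 * h) ((t_ n) ^+ 2 / 2) y * sin (t_ n * y))) / (t_ n) `^ (2 - 2 * h)).
have E : \forall n \near \oo, fbm_structure_factor h (t_ n) / (t_ n) `^ (1 - 2 * h) = g n.
  rewrite /g; near=> n; have tn := t0 n.
  have q0 : 0 < sin (t_ n / 2).
    apply: (lt_le_trans _ (sin_half_ge _)); first by rewrite divr_gt0.
    by rewrite (ltW tn)/=; near: n.
  rewrite (sine_integral_scale tn) -/(I (t_ n)).
  have -> : (t_ n) `^ (2 - 2 * h) = (t_ n) `^ (1 - 2 * h) * t_ n.
    rewrite -[X in _ = _ * X]powRr1 ?(ltW tn)// -powRD; last by apply/implyP => _; rewrite gt_eqF.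
    by congr (_ `^ _); ring.
  have := powR_gt0 (1 - 2 * h) tn.
  move: (t_ n) (fbm_structure_factor _ _) (_ `^ _) (I _) (sin _) tn q0 => t S p i q tn q0 p0.
  by field; rewrite !gt_eqF.
suff H : g n @[n --> \oo] --> alpha h.
  by apply: cvg_trans H; apply: near_eq_cvg; apply: filterS E => n /= ->.
have -> : alpha h = 2 * (2 * (h / 2 * (Gamma (2 * h) * sin (pi * h))) + 0).
  by rewrite /alpha; field.
apply: cvgM => //; apply: cvgD.
  by apply: cvgM => //; apply: cvgM => //; exact: cvg_cst.
apply/cvgr0Pnorm_le => e e0.
have Cp : (C * (t_ n) `^ h) @[n --> \oo] --> 0.
  by rewrite -(mulr0 C); apply: cvgM; [exact: cvg_cst|exact: powc].
near=> n.
apply: (@le_trans _ _ (C * t_ n `^ h)); last first.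
  apply: (le_trans (ler_norm _)); near: n.
  by move/cvgr0Pnorm_le : Cp; apply.
rewrite normrM normfV (ger0_norm (powR_ge0 _ _)) ler_pdivrMr ?powR_gt0//.
apply: (le_trans (CP _ (t0 n) _)).
  by near: n.
rewrite -[leRHS]mulrA; apply: ler_wpM2l => //.
have tn := t0 n; move: (t_ n) tn => t tp.
have -> : t `^ h * t `^ (2 - 2 * h) = t `^ (2 * (1 - h / 2)).
  rewrite -powRD; last by apply/implyP => _; rewrite gt_eqF.
  by congr (_ `^ _); field.
rewrite powRrM powR_mulrn ?(ltW tp)//.
apply: ge0_ler_powR; rewrite ?nnegrE ?divr_ge0 ?sqr_ge0//.
  by rewrite subr_ge0 ler_pdivrMr// mul1r (le_trans (ltW h1))// ler1n.
by rewrite ler_piMr ?sqr_ge0// invf_le1// ler1n.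
Unshelve. all: by end_near. Qed.

Lemma structure_factorN (t : R) : fbm_structure_factor h (- t) = fbm_structure_factor h t.
Proof.
rewrite /fbm_structure_factor; congr (limn _); apply/funext => N.
rewrite -!/(fsum h _ N) !fsumE//; apply: eq_bigr => k _.
by rewrite mulrN cosN !fexpE sqrrN.
Qed.

Lemma structure_factor_equiv :
  (fbm_structure_factor h : R -> R^o) ~_(0^')
    (fun t : R => alpha h * `|t| `^ (1 - 2 * h) : R^o).
Proof.
have a0 := alpha_gt0.
have H : fbm_structure_factor h t / `|t| `^ (1 - 2 * h) @[t --> 0^'] --> alpha h.
  have Hr : fbm_structure_factor h t / `|t| `^ (1 - 2 * h) @[t --> 0^'+] --> alpha h.
    apply/cvg_at_rightP => u [u0 uc].
    under eq_cvg do rewrite (ger0_norm (ltW (u0 _))).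
    exact: cvg_structure_factor.
  have Hl : fbm_structure_factor h t / `|t| `^ (1 - 2 * h) @[t --> 0^'-] --> alpha h.
    apply/cvg_at_leftP => u [u0 uc].
    under eq_cvg do rewrite -structure_factorN ler0_norm ?(ltW (u0 _))//.
    apply: (@cvg_structure_factor (fun n => - u n)).
      by move=> n; rewrite oppr_gt0.
    by rewrite -oppr0; exact: cvgN.
  apply/cvgrPdist_le => e e0.
  move/cvgrPdist_le : Hr => /(_ e e0); rewrite near_withinE => Hr.
  move/cvgrPdist_le : Hl => /(_ e e0); rewrite near_withinE => Hl.
  rewrite near_withinE; near=> t => t0.
  have [tn|tp|E] := ltgtP t 0; last by rewrite E eqxx in t0.
    by have : t < 0 := tn; near: t.
  by have : 0 < t := tp; near: t.
apply/eqaddoP => e e0.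
have ae : 0 < alpha h * e by exact: mulr_gt0.
move/cvgrPdist_le : H => /(_ _ ae) He.
near=> t.
have tn0 : t != 0 by near: t; exact: nbhs_dnbhs_neq.
have p0 : 0 < `|t| `^ (1 - 2 * h) by apply: powR_gt0; rewrite normr_gt0.
have : `|alpha h - fbm_structure_factor h t / `|t| `^ (1 - 2 * h)| <= alpha h * e by near: t.
rewrite !fctE/= [`|alpha h * _|]ger0_norm; last by apply: mulr_ge0; exact: ltW.
rewrite -(ler_pM2r p0) -[X in _ * X <= _](ger0_norm (ltW p0)) -normrM.
rewrite mulrBl divfK ?gt_eqF// distrC => /le_trans; apply.
by rewrite [leRHS]mulrA [e * alpha h]mulrC.
Unshelve. all: by end_near. Qed.

End asymptotics.

(** * Fourier transforms averaged over Gaussian shifts *)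

Section null_modification.
Import HBNNSimple.
Context d {T : measurableType d} {R : realType} (m : {measure set T -> \bar R}).
Local Open Scope ereal_scope.

(** The integral is a supremum over measurable simple functions, so that neither
    side has to be measurable. *)
Lemma ge0_le_integral_null (f g : T -> \bar R) :
  (forall x, 0 <= f x) -> (forall x, 0 <= g x) ->
  {ae m, forall x, f x <= g x} -> \int[m]_x f x <= \int[m]_x g x.
Proof.
move=> f0 g0 [N [mN N0 fgN]].
have mNC : measurable (~` N) by exact: measurableC.
rewrite !ge0_integralTE//; apply: ge_ereal_sup => _ [k kf <-].
have -> : sintegral m k = sintegral m (proj_nnsfun k mNC).
  rewrite -!integralT_nnsfun (ge0_negligible_integral mN) ?setTD//; last first.
  - by move=> x _; rewrite lee_fin.
  - exact: measurableT_comp.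
  by rewrite integral_mkcond; apply: eq_integral => x _; rewrite restrict_EFin/= patchE mindicE; case: (_ \in _); rewrite ?mulr1 ?mulr0.
apply: ereal_sup_ubound; exists (proj_nnsfun k mNC) => // x.
rewrite /= mindicE; have [xN|xN] := boolP (x \in ~` N); last by rewrite mulr0.
rewrite mulr1; apply: (le_trans (kf x)).
apply: contrapT => fg; move: xN; rewrite inE; apply; exact: fgN.
Qed.

Lemma eq_integral_null (f g : T -> \bar R) :
  {ae m, forall x, f x = g x} -> \int[m]_x f x = \int[m]_x g x.
Proof.
move=> fg; rewrite [LHS]integralE [RHS]integralE; congr (_ - _).
- apply/eqP; rewrite eq_le; apply/andP; split; apply: ge0_le_integral_null => //;
  by move: fg; apply: filterS => x fgx; rewrite !funeposE fgx.
- apply/eqP; rewrite eq_le; apply/andP; split; apply: ge0_le_integral_null => //;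
  by move: fg; apply: filterS => x fgx; rewrite !funenegE fgx.
Qed.

End null_modification.

(** The limit [f] comes as an arbitrary function, as it will be an integral over a random set of
    points known only almost surely. It is replaced by [k], which vanishes on a measurable null set
    containing the exceptional points and is everywhere a limit of measurable functions. *)
Lemma ae_dominated_cvg d (T : measurableType d) (R : realType)
    (m : {measure set T -> \bar R}) (f_ : nat -> T -> R) (f : T -> R)
    (g : T -> \bar R) :
  (forall n, measurable_fun setT (f_ n)) ->
  {ae m, forall x, f_ n x @[n --> \oo] --> f x} ->
  m.-integrable setT g -> (forall n x, (`|f_ n x|%:E <= g x)%E) ->
  m.-integrable setT (EFin \o f_ 0%N) /\
  \int[m]_x f_ n x @[n --> \oo] --> \int[m]_x f x.
Proof.
move=> mf [N [mN N0 fN]] ig fg.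
have mNC : measurable (~` N) by exact: measurableC.
pose h n x := f_ n x * \1_(~` N) x; pose k x := f x * \1_(~` N) x.
have hk x : h n x @[n --> \oo] --> k x.
  rewrite /h /k indicE; have [xN|xN] := boolP (x \in ~` N).
    rewrite !mulr1; under eq_cvg do rewrite mulr1.
    by apply: contrapT => H; move: xN; rewrite inE; apply; exact: fN.
  by rewrite mulr0; under eq_cvg do rewrite mulr0; exact: cvg_cst.
have mh n : measurable_fun setT (h n) by exact: measurable_funM.
have mk : measurable_fun setT k.
  by apply: (@measurable_fun_cvg _ _ _ _ h) => // x _; exact: hk.
have aeN : {ae m, forall x, \1_(~` N) x = 1 :> R}.
  exists N; split => // x /=; rewrite indicE => H; apply: contrapT => Nx; apply: H.
  by rewrite mem_set.
have hE n : \int[m]_x f_ n x = \int[m]_x h n x.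
  rewrite /Rintegral; congr fine; apply: eq_integral_null.
  by move: aeN; apply: filterS => x; rewrite /h => ->; rewrite mulr1.
have kE : \int[m]_x f x = \int[m]_x k x.
  rewrite /Rintegral; congr fine; apply: eq_integral_null.
  by move: aeN; apply: filterS => x; rewrite /k => ->; rewrite mulr1.
have hg n x : (`|(h n x)%:E| <= g x)%E.
  apply: le_trans (fg n x); rewrite lee_fin /h normrM indicE ler_piMr//.
  by case: (_ \in _) => /=; rewrite ?normr1 ?normr0.
have if0 n : m.-integrable setT (EFin \o f_ n).
  apply: (le_integrable measurableT _ _ ig); first exact/measurable_EFinP.
  move=> x _; apply: le_trans (fg n x) _; exact: lee_abs.
split; first exact: if0.
have [] := @dominated_convergence _ _ _ m setT measurableT (fun n => EFin \o h n) (EFin \o k) g.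
- by move=> n; exact/measurable_EFinP.
- exact/measurable_EFinP.
- by apply: aeW => x _; apply: cvg_EFin; [exact: nearW|exact: hk].
- exact: ig.
- by apply: aeW => x n _; exact: hg.
move=> ik _ cv; rewrite kE; under eq_cvg do rewrite hE.
have kfin : (\int[m]_x (k x)%:E)%E \is a fin_num by exact: integrable_fin_num ik.
rewrite /Rintegral; apply: fine_cvg; rewrite fineK//.
Qed.
Section fubini_kernel.
Context d1 d2 (T1 : measurableType d1) (T2 : measurableType d2) (R : realType).
Variables (m1 : {sigma_finite_measure set T1 -> \bar R})
          (m2 : {sigma_finite_measure set T2 -> \bar R}).
Variables (u1 : T1 -> R) (u2 : T2 -> R) (K : T1 * T2 -> R) (C : R).
Hypotheses (iu1 : m1.-integrable setT (EFin \o u1))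
           (iu2 : m2.-integrable setT (EFin \o u2))
           (mK : measurable_fun setT K) (KC : forall z, `|K z| <= C).

Let mu1 : measurable_fun setT u1.
Proof. by apply/measurable_EFinP; exact: measurable_int iu1. Qed.

Let mu2 : measurable_fun setT u2.
Proof. by apply/measurable_EFinP; exact: measurable_int iu2. Qed.

Let ik2 x : m2.-integrable setT (EFin \o (fun y => u2 y * K (x, y))).
Proof.
apply: (@le_integrable_R _ _ _ _ _ _ (fun y => C * `|u2 y|)) => //.
- by apply: measurable_funM => //; exact: measurableT_comp mK (pair1_measurable x).
- by move=> y _; rewrite normrM mulrC ler_wpM2r.
- by apply: integrableZ_R => //; exact: (integrable_abse iu2).
Qed.

Let ik1 y : m1.-integrable setT (EFin \o (fun x => u1 x * K (x, y))).
Proof.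
apply: (@le_integrable_R _ _ _ _ _ _ (fun x => C * `|u1 x|)) => //.
- by apply: measurable_funM => //; exact: measurableT_comp mK (pair2_measurable y).
- by move=> x _; rewrite normrM mulrC ler_wpM2r.
- by apply: integrableZ_R => //; exact: (integrable_abse iu1).
Qed.

Lemma Rintegral_fubini_kernel :
  \int[m1]_x (u1 x * \int[m2]_y (u2 y * K (x, y))) =
  \int[m2]_y (u2 y * \int[m1]_x (u1 x * K (x, y))).
Proof.
pose F z := u1 z.1 * (u2 z.2 * K z).
have mF : measurable_fun setT F.
  apply: measurable_funM; first exact: measurableT_comp measurable_fst.
  by apply: measurable_funM => //; exact: measurableT_comp measurable_snd.
have iF : (m1 \x m2)%E.-integrable setT (EFin \o F).
  apply/integrable12ltyP; first exact/measurable_EFinP.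
  have i2 : m2.-integrable setT (EFin \o (fun y => `|u2 y|)) by exact: (integrable_abse iu2).
  have i1 : m1.-integrable setT (EFin \o (fun y => `|u1 y|)) by exact: (integrable_abse iu1).
  pose I2 := \int[m2]_y `|u2 y|.
  have I2E : (\int[m2]_y (`|u2 y|)%:E)%E = I2%:E by rewrite /I2 fineK// integrable_fin_num.
  have /integrableP[_ +] := integrableZ_R measurableT (`|C| * I2) i1.
  apply: le_lt_trans; apply: ge0_le_integral_null => //.
    by move=> x; exact: integral_ge0.
  apply: aeW => x.
  apply: (@le_trans _ _ (\int[m2]_y (`|u1 x| * `|C| * `|u2 y|)%:E)%E).
    apply: ge0_le_integral_null => //.
    apply: aeW => y; rewrite /F/= lee_fin !normrM -!mulrA ler_wpM2l// mulrC ler_wpM2r//.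
    exact: le_trans (KC _) (ler_norm _).
  under eq_integral do rewrite EFinM.
  rewrite ge0_integralZl//; last exact: measurable_int i2.
  rewrite I2E /= -EFinM lee_fin; apply: le_trans (ler_norm _).
  by rewrite [leRHS]mulrC mulrA.
have := Fubini iF => /(congr1 fine).
under eq_integral => x _.
  rewrite (_ : (fun y => _) = (fun y => ((u1 x)%:E * (u2 y * K (x, y))%:E)%E)); last first.
    by apply/funext => y; rewrite /F/= EFinM.
  rewrite integralZl//; last exact: ik2.
  rewrite -[(\int[m2]_y _)%E]fineK; last by apply: integrable_fin_num => //; exact: ik2.
  rewrite -EFinM; over.
move=> E; apply: (etrans E); congr fine; apply: eq_integral => y _.
rewrite (_ : (fun x => _) = (fun x => ((u2 y)%:E * (u1 x * K (x, y))%:E)%E)); last first.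
  by apply/funext => x; rewrite /F/= -EFinM mulrCA.
rewrite integralZl//; last exact: ik1.
rewrite -[(\int[m1]_x _)%E]fineK; last by apply: integrable_fin_num => //; exact: ik1.
by rewrite -EFinM.
Qed.

End fubini_kernel.

(** * Smooth functions of quadratic decay and their Fourier transforms *)

Section lorentz.
Context {R : realType}.
Notation mu := (@lebesgue_measure R).

(** The Cauchy density without its constant: a common integrable majorant for test functions and for
    their transforms. *)
Definition lorentz (x : R) : R := (1 + x ^+ 2)^-1.

Let den_gt0 (x : R) : 0 < 1 + x ^+ 2.
Proof. by rewrite ltr_pwDl// sqr_ge0. Qed.

Lemma lorentz_gt0 x : 0 < lorentz x. Proof. by rewrite invr_gt0. Qed.

Lemma continuous_lorentz : continuous lorentz.
Proof.
move=> x; apply: cvgV; first by rewrite gt_eqF.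
by apply: cvgD; [exact: cvg_cst|exact: exprn_continuous].
Qed.

Lemma measurable_lorentz : measurable_fun setT lorentz.
Proof. exact: continuous_measurable_fun continuous_lorentz. Qed.

Lemma integrable_lorentz : mu.-integrable setT (EFin \o lorentz).
Proof.
apply: (@ge0_integrable_improper R setT (fun n => - n.+1%:R) (fun n => n.+1%:R) _ _ _ _ atan lorentz _ _ pi) => //.
- by move=> n; rewrite gtrN.
- by move=> m n mn; rewrite lerN2 ler_nat.
- by move=> m n mn; rewrite ler_nat.
- apply/seteqP; split=> x // _; exists (Num.truncn `|x|) => //=.
  by rewrite in_itv/= -ler_norml ltW// truncnS_gt.
- by move=> x _; exact: continuous_lorentz.
- by move=> x _; rewrite ltW// lorentz_gt0.
- move=> n; have := atan_ltpi2 (n.+1%:R : R); have := atan_gtNpi2 (- n.+1%:R : R).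
  by move: (atan _) (atan _) => a b; lra.
Qed.

Lemma lorentz_shift (a t y : R) : `|t - y| <= a ->
  lorentz y <= 2 * (1 + a ^+ 2) * lorentz t.
Proof.
move=> ty; rewrite /lorentz -[_ * _^-1]invrK invfM invrK lef_pV2 ?posrE//; last first.
  by rewrite mulr_gt0// invr_gt0 mulr_gt0.
rewrite mulrC ler_pdivrMr ?mulr_gt0//.
have ty2 : (t - y) ^+ 2 <= a ^+ 2.
  rewrite -[leLHS]real_normK ?num_real// lerXn2r ?nnegrE//.
  exact: le_trans ty.
nra.
Qed.

Lemma lorentz_ge (x : R) : `|x| <= 1 -> 2^-1 <= lorentz x.
Proof.
move=> x1; rewrite lef_pV2 ?posrE//.
by have : x ^+ 2 <= 1; [rewrite -[leLHS]real_normK ?num_real// exprn_ile1|lra].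
Qed.

Lemma inv_sqr_le_lorentz (x : R) : 1 <= `|x| -> (x ^+ 2)^-1 <= 2 * lorentz x.
Proof.
move=> x1; have x2 : 1 <= x ^+ 2 by rewrite -[leRHS]real_normK ?num_real// exprn_ege1.
have x0 : 0 < x ^+ 2 by exact: lt_le_trans x2.
rewrite /lorentz ler_pdivlMr// mulrC ler_pdivrMr//; lra.
Qed.

End lorentz.

Section trig_transform.
Context {R : realType}.
Notation mu := (@lebesgue_measure R).

(** What is kept of a Schwartz function: it is twice differentiable, and it and its second
    derivative are of order [1 / (1 + x^2)]. This already gives the transform the same decay. *)
Definition smooth_decay (u : R -> R) := exists u1 u2 : R -> R,
  [/\ forall y : R, is_derive y 1 u (u1 y), forall y : R, is_derive y 1 u1 (u2 y) &
    exists M : R, forall y, `|u y| <= M * lorentz y /\ `|u2 y| <= M * lorentz y].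

Lemma smooth_decay_continuous u : smooth_decay u -> continuous u.
Proof.
move=> [u1 [_ [du _ _]]] x; apply: differentiable_continuous.
by apply/derivable1_diffP; have [] := du x.
Qed.

Lemma smooth_decay_integrable u : smooth_decay u -> mu.-integrable setT (EFin \o u).
Proof.
move=> su; have [u1 [u2 [_ _ [M uM]]]] := su.
apply: (@le_integrable_R _ _ (measurableTypeR R) mu _ _ (fun x => M * lorentz x)) => //.
- exact: (continuous_measurable_fun (smooth_decay_continuous su)).
- by move=> x _; exact: (uM x).1.
- by apply: (@integrableZ_R _ _ (measurableTypeR R) mu) => //; exact: integrable_lorentz.
Qed.

(** Against a kernel that changes sign under a shift by [d], only the second difference of [u]
    counts, and it is of order [d^2]. The bound [4] on [d] covers the half-periods [pi / |x|] with
    [|x| >= 1]; [8] is then the largest distance between the points involved. *)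
Lemma integral_antiperiodic_le u : smooth_decay u ->
  exists2 C : R, 0 <= C & forall (k : R -> R) d, measurable_fun setT k ->
    (forall x, `|k x| <= 1) -> (forall x, k (x + d) = - k x) ->
    0 < d -> d <= 4 -> `|\int[mu]_x (u x * k x)| <= C * d ^+ 2.
Proof.
move=> su; have iu := smooth_decay_integrable su.
have [u1 [u2 [du du1 [M uM]]]] := su.
have M0 : 0 <= M.
  by rewrite -(pmulr_lge0 _ (lorentz_gt0 0)); apply: le_trans (uM 0).1.
pose K := M * (2 * (1 + 8 ^+ 2)).
have K0 : 0 <= K by rewrite !mulr_ge0// addr_ge0.
have I0 : 0 <= \int[mu]_x (lorentz x : R) by apply: Rintegral_ge0 => x _; rewrite ltW// lorentz_gt0.
exists (K * \int[mu]_x lorentz x); first exact: mulr_ge0.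
move=> k d mk k1 kd d0 d4.
rewrite (Rintegral_antiperiodic mk k1 kd iu).
have bd (x : R) : `|(u x - u (x + d) *+ 2 + u (x + d *+ 2)) * k x| <= d ^+ 2 * K * lorentz x.
  rewrite normrM; apply: (le_trans (ler_piMr _ (k1 x))) => //.
  rewrite -mulrA; apply: (@second_difference_le R u u1 u2) => //.
  move=> y /andP[xy yx]; apply: (le_trans (uM y).2).
  rewrite /K -mulrA ler_wpM2l//; apply: lorentz_shift.
  by rewrite distrC ger0_norm ?subr_ge0//; move: yx; rewrite mulr2n; lra.
have mI : measurable_fun setT (fun x : R => (u x - u (x + d) *+ 2 + u (x + d *+ 2)) * k x).
  have mu_ := continuous_measurable_fun (smooth_decay_continuous su).
  apply: measurable_funM => //; apply: measurable_funD.
    apply: measurable_funB => //; under eq_fun do rewrite -mulr_natl.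
    by apply: measurable_funM => //; apply: measurableT_comp => //; exact: measurable_funD.
  by apply: measurableT_comp => //; exact: measurable_funD.
have iK : mu.-integrable setT (EFin \o (fun x => d ^+ 2 * K * lorentz x)).
  by apply: (@integrableZ_R _ _ (measurableTypeR R) mu) => //; exact: integrable_lorentz.
have iI : mu.-integrable setT (EFin \o (fun x : R => (u x - u (x + d) *+ 2 + u (x + d *+ 2)) * k x)).
  by apply: (@le_integrable_R _ _ (measurableTypeR R) mu _ _ _ _ _ _ iK).
have H : `|\int[mu]_x ((u x - u (x + d) *+ 2 + u (x + d *+ 2)) * k x)| <= d ^+ 2 * K * \int[mu]_x lorentz x.
  rewrite -RintegralZl//; last exact: integrable_lorentz.
  apply: (le_trans (le_normr_Rintegral measurableT iI)).
  by apply: le_Rintegral => //; exact: (integrable_abse iI).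
rewrite normrM ger0_norm ?invr_ge0// mulrC ler_pdivrMr//.
apply: (le_trans H); rewrite [d ^+ 2 * K]mulrC mulrAC ler_peMr//; last by rewrite ler1n.
by rewrite mulr_ge0 ?sqr_ge0// mulr_ge0.
Qed.

Variables (u v : R -> R).
Hypotheses (su : smooth_decay u) (sv : smooth_decay v).

(** For [phi = u + i v] this is the real part of the Fourier transform of [phi]; the imaginary part
    is the same expression for the pair [v], [- u]. *)
Definition trig_transform (x : R) : R :=
  \int[mu]_t (u t * cos (x * t) + v t * sin (x * t)).

Lemma integrable_trig (x : R) :
  mu.-integrable setT (EFin \o (fun t => u t * cos (x * t))) /\
  mu.-integrable setT (EFin \o (fun t => v t * sin (x * t))).
Proof.
have mx : measurable_fun setT (fun t : R => x * t) by exact: measurable_funM.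
have [iu iv] := (smooth_decay_integrable su, smooth_decay_integrable sv).
split.
- apply: (@le_integrable_R _ _ (measurableTypeR R) mu _ _ (fun t => `|u t|)) => //.
  + apply: measurable_funM; first exact: (continuous_measurable_fun (smooth_decay_continuous su)).
    by apply: measurableT_comp => //; exact: (continuous_measurable_fun (@continuous_cos R)).
  + by move=> t _; rewrite normrM ler_piMr// norm_cos_le1.
  + exact: (integrable_abse iu).
- apply: (@le_integrable_R _ _ (measurableTypeR R) mu _ _ (fun t => `|v t|)) => //.
  + apply: measurable_funM; first exact: (continuous_measurable_fun (smooth_decay_continuous sv)).
    by apply: measurableT_comp => //; exact: (continuous_measurable_fun (@continuous_sin R)).
  + by move=> t _; rewrite normrM ler_piMr// norm_sin_le1.
  + exact: (integrable_abse iv).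
Qed.

Lemma trig_transformE x : trig_transform x =
  \int[mu]_t (u t * cos (x * t)) + \int[mu]_t (v t * sin (x * t)).
Proof. by have [? ?] := integrable_trig x; rewrite /trig_transform RintegralD. Qed.

Lemma trig_transform_le : exists2 C : R, 0 <= C &
  forall x, `|trig_transform x| <= C * lorentz x.
Proof.
have [C C0 uC] := integral_antiperiodic_le su.
have [D D0 vD] := integral_antiperiodic_le sv.
have I0 (w : R -> R) : 0 <= \int[mu]_x `|w x| by exact: Rintegral_ge0.
pose I := \int[mu]_x `|u x| + \int[mu]_x `|v x|.
have {}I0 : 0 <= I by exact: addr_ge0.
exists (2 * I + 2 * (C + D) * pi ^+ 2).
  apply: addr_ge0; first exact: mulr_ge0.
  by apply: mulr_ge0; rewrite ?sqr_ge0// mulr_ge0// addr_ge0.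
move=> x; have [ic is_] := integrable_trig x; have L0 := lorentz_gt0 x.
rewrite trig_transformE; apply: (le_trans (ler_normD _ _)).
rewrite mulrDl; have [x1|x1] := leP `|x| 1.
  apply: (@le_trans _ _ I).
    apply: lerD.
    - apply: (le_trans (le_normr_Rintegral measurableT ic)); apply: le_Rintegral => //.
      + exact: (integrable_abse ic).
      + exact: (integrable_abse (smooth_decay_integrable su)).
      + by move=> t _; rewrite normrM ler_piMr// norm_cos_le1.
    - apply: (le_trans (le_normr_Rintegral measurableT is_)); apply: le_Rintegral => //.
      + exact: (integrable_abse is_).
      + exact: (integrable_abse (smooth_decay_integrable sv)).
      + by move=> t _; rewrite normrM ler_piMr// norm_sin_le1.
  apply: (@le_trans _ _ (2 * I * lorentz x)); last first.
    by rewrite lerDl; apply: mulr_ge0 (ltW L0); apply: mulr_ge0; rewrite ?sqr_ge0// mulr_ge0// addr_ge0.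
  by have := lorentz_ge x1; move: (lorentz x) L0 => L L0 HL; nra.
have x0 : 0 < `|x| by exact: lt_trans x1.
pose d := pi / `|x|.
have d0 : 0 < d by rewrite divr_gt0// pi_gt0.
have d4 : d <= 4.
  rewrite ler_pdivrMr//; apply: (@le_trans _ _ (4 * 1)); last by rewrite ler_pM2l// ltW.
  by have := pihalf_lt2 R; rewrite ltr_pdivrMr//; move: (pi : R) => p; lra.
have dE : d ^+ 2 = pi ^+ 2 * (x ^+ 2)^-1 by rewrite expr_div_n real_normK ?num_real.
have xd (t : R) : cos (x * (t + d)) = - cos (x * t) /\ sin (x * (t + d)) = - sin (x * t).
  rewrite mulrDr /d; have [xp|xn] := ltrP 0 x.
    rewrite (gtr0_norm xp) mulrCA divff ?gt_eqF// mulr1.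
    by rewrite (@cosDpi R) (@sinDpi R).
  have xn' : x < 0 by rewrite lt_neqAle xn andbT -normr_gt0.
  rewrite ltr0_norm// invrN !mulrN mulrCA divff ?lt_eqF// mulr1.
  by rewrite -[cos (_ - _)]opprK -[sin (_ - _)]opprK -(@cosDpi R) -(@sinDpi R) subrK.
apply: (@le_trans _ _ (2 * (C + D) * pi ^+ 2 * lorentz x)); last first.
  by rewrite lerDr; apply: mulr_ge0 (ltW L0); apply: mulr_ge0.
apply: (@le_trans _ _ ((C + D) * d ^+ 2)).
  rewrite mulrDl; apply: lerD.
  - apply: uC => //.
    + apply: measurableT_comp; first exact: (continuous_measurable_fun (@continuous_cos R)).
      exact: measurable_funM.
    + by move=> t; exact: norm_cos_le1.
    + by move=> t; exact: (xd t).1.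
  - apply: vD => //.
    + apply: measurableT_comp; first exact: (continuous_measurable_fun (@continuous_sin R)).
      exact: measurable_funM.
    + by move=> t; exact: norm_sin_le1.
    + by move=> t; exact: (xd t).2.
rewrite dE.
have -> : 2 * (C + D) * pi ^+ 2 * lorentz x = (C + D) * (pi ^+ 2 * (2 * lorentz x)) by ring.
rewrite ler_wpM2l ?addr_ge0// ler_wpM2l ?sqr_ge0//.
by apply: inv_sqr_le_lorentz; exact: ltW.
Qed.

Lemma continuous_trig_transform : continuous trig_transform.
Proof.
move=> x.
have [iu iv] := (smooth_decay_integrable su, smooth_decay_integrable sv).
have := @continuity_under_integral R _ (measurableTypeR R) mu
  (fun x t => u t * cos (x * t) + v t * sin (x * t)) setT measurableT (x - 1) (x + 1)
  _ _ (fun t => `|u t| + `|v t|) _ _.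
apply.
- move=> y _; have [? ?] := integrable_trig y.
  exact: (@integrableD_R _ _ (measurableTypeR R) mu).
- apply: aeW => t _ y _.
  have c (f : R -> R) : continuous f -> {for y, continuous (fun x : R => f (x * t))}.
    move=> cf; apply: continuous_comp; last exact: cf.
    by apply: cvgM; [exact: cvg_id|exact: cvg_cst].
  apply: cvgD; apply: cvgM; [exact: cvg_cst| |exact: cvg_cst|].
    exact: (c _ (@continuous_cos R)).
  exact: (c _ (@continuous_sin R)).
- apply: (@integrableD_R _ _ (measurableTypeR R) mu) => //; [exact: (integrable_abse iu)|exact: (integrable_abse iv)].
- move=> y _; apply: aeW => t _; apply: (le_trans (ler_normD _ _)).
  by apply: lerD; rewrite normrM ler_piMr// ?norm_cos_le1 ?norm_sin_le1.
- by rewrite inE/= in_itv/= ltrBlDr ltrDl ltr01.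
Qed.

Lemma integrable_trig_transform : mu.-integrable setT (EFin \o trig_transform).
Proof.
have [C C0 HC] := trig_transform_le.
apply: (@le_integrable_R _ _ (measurableTypeR R) mu _ _ (fun x => C * lorentz x)) => //.
- exact: (continuous_measurable_fun continuous_trig_transform).
- by apply: (@integrableZ_R _ _ (measurableTypeR R) mu) => //; exact: integrable_lorentz.
Qed.

End trig_transform.

Section gauss_average.
Context {R : realType}.
Notation mu := (@lebesgue_measure R).
Notation gam := (@normal_prob R 0 1).

Lemma schwartz_smooth_decay (f : R -> R) : schwartzR f -> smooth_decay f.
Proof.
move=> [df bf]; exists (derive1n 1 f), (derive1n 2 f); split.
- by move=> y; have := df 0%N y => /derivableP; rewrite -derive1E.
- by move=> y; have := df 1%N y => /derivableP; rewrite -derive1E.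
have bd k : exists M : R, forall y, `|derive1n k f y| <= M * lorentz y.
  have [M0 H0] := bf 0%N k; have [M2 H2] := bf 2%N k.
  exists (M0 + M2) => y; rewrite /lorentz ler_pdivlMr ?ltr_pwDl ?sqr_ge0//.
  rewrite mulrDr mulr1 lerD//.
    by have := H0 y; rewrite mul1r.
  by have := H2 y; rewrite real_normK ?num_real// mulrC.
have [M0 H0] := bd 0%N; have [M2 H2] := bd 2%N.
exists (`|M0| + `|M2|) => y; split.
- apply: (le_trans (H0 y)); rewrite ler_pM2r ?lorentz_gt0//.
  by apply: (le_trans (ler_norm _)); rewrite lerDl.
- apply: (le_trans (H2 y)); rewrite ler_pM2r ?lorentz_gt0//.
  by apply: (le_trans (ler_norm _)); rewrite lerDr.
Qed.

Lemma smooth_decay0 : smooth_decay (fun=> 0 : R).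
Proof.
exists (fun=> 0), (fun=> 0); split=> [y|y|].
- exact: is_derive_cst.
- exact: is_derive_cst.
by exists 0 => y; rewrite normr0 mul0r.
Qed.

Lemma measurable_cosM : measurable_fun [set: measurableTypeR R * measurableTypeR R]
  (fun z => cos (z.1 * z.2) : R).
Proof.
apply: measurableT_comp; first exact: (continuous_measurable_fun (@continuous_cos R)).
by apply: measurable_funM; [exact: measurable_fst|exact: measurable_snd].
Qed.

Lemma bounded_integrable d (T : measurableType d) (P : probability T R) (f : T -> R) (C : R) :
  measurable_fun setT f -> (forall x, `|f x| <= C) -> P.-integrable setT (EFin \o f).
Proof.
move=> mf fC; apply: (@le_integrable_R _ _ _ _ _ _ (cst C)) => //.
exact: finite_measure_integrable_cst.
Qed.

Lemma bounded_Rintegral_le d (T : measurableType d) (P : probability T R) (f : T -> R) (C : R) :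
  measurable_fun setT f -> (forall x, `|f x| <= C) -> `|\int[P]_x f x| <= C.
Proof.
move=> mf fC; have fi := bounded_integrable P mf fC.
apply: (le_trans (le_normr_Rintegral measurableT fi)).
have -> : C = \int[P]_x cst C x by rewrite Rintegral_cst// [X in fine X]probability_setT mulr1.
apply: le_Rintegral => //; first exact: (integrable_abse fi).
exact: finite_measure_integrable_cst.
Qed.

Let mcos (s : R) : measurable_fun setT (fun y : R => cos (s * y)).
Proof.
apply: measurableT_comp; last exact: measurable_funM.
exact: (continuous_measurable_fun (@continuous_cos R)).
Qed.

Let msin (s : R) : measurable_fun setT (fun y : R => sin (s * y)).
Proof.
apply: measurableT_comp; last exact: measurable_funM.
exact: (continuous_measurable_fun (@continuous_sin R)).
Qed.

Let icos s : gam.-integrable setT (EFin \o (fun y : R => cos (s * y))).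
Proof. exact: (@bounded_integrable _ _ gam _ 1 (mcos s) (fun y => norm_cos_le1 _)). Qed.

Let isin s : gam.-integrable setT (EFin \o (fun y : R => sin (s * y))).
Proof. exact: (@bounded_integrable _ _ gam _ 1 (msin s) (fun y => norm_sin_le1 _)). Qed.

Lemma gauss_cos (x s t : R) :
  \int[gam]_y cos ((x + s * y) * t) = cos (x * t) * expR (- ((s * t) ^+ 2 / 2)).
Proof.
rewrite -gauss_char_cos -(Rintegral_gauss (mcos (s * t))).
transitivity (\int[gam]_y (cos (x * t) * cos (s * t * y) - sin (x * t) * sin (s * t * y))).
  by apply: eq_Rintegral => y _; rewrite mulrDl cosD mulrAC.
rewrite RintegralB//; [|exact: (integrableZ_R measurableT)..].
rewrite !RintegralZl//.
by rewrite [X in _ - _ * X](Rintegral_gauss (msin (s * t))) gauss_char_sin mulr0 subr0.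
Qed.

Lemma gauss_sin (x s t : R) :
  \int[gam]_y sin ((x + s * y) * t) = sin (x * t) * expR (- ((s * t) ^+ 2 / 2)).
Proof.
rewrite -gauss_char_cos -(Rintegral_gauss (mcos (s * t))).
transitivity (\int[gam]_y (sin (x * t) * cos (s * t * y) + cos (x * t) * sin (s * t * y))).
  by apply: eq_Rintegral => y _; rewrite mulrDl sinD mulrAC.
rewrite RintegralD//; [|exact: (integrableZ_R measurableT)..].
rewrite !RintegralZl//.
by rewrite [X in _ + _ * X](Rintegral_gauss (msin (s * t))) gauss_char_sin mulr0 addr0.
Qed.

Let gauss_kernel (k : R -> R) (w : R -> R) (x s : R) : continuous k ->
  (forall y, `|k y| <= 1) -> smooth_decay w ->
  \int[gam]_y (\int[mu]_t (w t * k ((x + s * y) * t))) =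
  \int[mu]_t (w t * \int[gam]_y k ((x + s * y) * t)).
Proof.
move=> ck k1 sw.
have mK : measurable_fun setT (fun z : measurableTypeR R * measurableTypeR R => k ((x + s * z.2) * z.1)).
  apply: measurableT_comp; first exact: (continuous_measurable_fun ck).
  apply: measurable_funM; last exact: measurable_fst.
  by apply: measurable_funD => //; apply: measurable_funM => //; exact: measurable_snd.
have i1 : gam.-integrable setT (EFin \o (cst 1)).
  exact: finite_measure_integrable_cst.
have := @Rintegral_fubini_kernel _ _ (measurableTypeR R) (measurableTypeR R) R mu gam w (cst 1) _ 1
  (smooth_decay_integrable sw) i1 mK (fun z => k1 _).
move=> H; transitivity (\int[gam]_y (cst 1 y * \int[mu]_t (w t * k ((x + s * y) * t)))).
  by apply: eq_Rintegral => y _; rewrite mul1r.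
rewrite -H; apply: eq_Rintegral => t _; congr (_ * _).
by apply: eq_Rintegral => y _; rewrite mul1r.
Qed.

Variables u v : R -> R.
Hypotheses (su : smooth_decay u) (sv : smooth_decay v).

Lemma trig_transform_bounded : exists C : R, forall x, `|trig_transform u v x| <= C.
Proof.
have [C C0 HC] := trig_transform_le su sv; exists C => x; apply: (le_trans (HC x)).
by rewrite ler_piMr// /lorentz invf_le1 ?ltr_pwDl ?sqr_ge0// lerDl sqr_ge0.
Qed.

(** Averaging over a Gaussian shift multiplies the kernels by the characteristic function; with
    [s = |n|^h] the factor is the coefficient [f_t n]. *)
Lemma gauss_trig_transform (x s : R) :
  \int[gam]_y trig_transform u v (x + s * y) =
  \int[mu]_t (u t * (cos (x * t) * expR (- ((s * t) ^+ 2 / 2)))) +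
  \int[mu]_t (v t * (sin (x * t) * expR (- ((s * t) ^+ 2 / 2)))).
Proof.
have s0 := smooth_decay0.
have Cu y : trig_transform u (cst 0) y = \int[mu]_t (u t * cos (y * t)).
  by apply: eq_Rintegral => t _; rewrite mul0r addr0.
have Sv y : trig_transform (cst 0) v y = \int[mu]_t (v t * sin (y * t)).
  by apply: eq_Rintegral => t _; rewrite mul0r add0r.
have iT (u' v' : R -> R) : smooth_decay u' -> smooth_decay v' ->
    gam.-integrable setT (EFin \o (fun y => trig_transform u' v' (x + s * y))).
  move=> su' sv'; have [C C0 HC] := trig_transform_le su' sv'.
  apply: (@bounded_integrable _ _ gam _ C).
    apply: measurableT_comp; first exact: (continuous_measurable_fun (continuous_trig_transform su' sv')).
    by apply: measurable_funD => //; exact: measurable_funM.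
  move=> y; apply: (le_trans (HC _)).
  by rewrite ler_piMr// /lorentz invf_le1 ?ltr_pwDl ?sqr_ge0// lerDl sqr_ge0.
transitivity (\int[gam]_y (trig_transform u (cst 0) (x + s * y) + trig_transform (cst 0) v (x + s * y))).
  by apply: eq_Rintegral => y _; rewrite trig_transformE// Cu Sv.
rewrite RintegralD//; [|exact: iT..].
under eq_Rintegral do rewrite Cu.
under [X in _ + X = _]eq_Rintegral do rewrite Sv.
rewrite (gauss_kernel _ _ (@continuous_cos R) (@norm_cos_le1 R) su).
rewrite (gauss_kernel _ _ (@continuous_sin R) (@norm_sin_le1 R) sv).
by congr (_ + _); apply: eq_Rintegral => t _; rewrite ?gauss_cos ?gauss_sin.
Qed.

End gauss_average.

(** * The mass that concentrates at the origin *)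

Section sinc.
Context {R : realType}.
Notation mu := (@lebesgue_measure R).
Notation gam := (@normal_prob R 0 1).

Lemma integrable_indic_itv (L : R) : mu.-integrable setT (EFin \o \1_(`[- L, L]%classic : set R)).
Proof.
have H : mu.-integrable `[- L, L] (EFin \o cst 1).
  apply: integrable_cst_fin => //; rewrite [X in (X < _)%E]lebesgue_measure_itv/=.
  by case: ifP => _; rewrite ?ltry// -EFinD ltry.
rewrite (_ : EFin \o _ = (EFin \o cst (1 : R)) \_ `[- L, L]); last first.
  by apply/funext => x; rewrite patchE /= indicE; case: (_ \in _).
by rewrite -integrable_mkcond.
Qed.

Lemma integral_itv_cos (L t : R) : 0 < L -> t != 0 ->
  \int[mu]_x (\1_(`[- L, L]%classic : set R) x * cos (x * t)) = 2 * sin (L * t) / t.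
Proof.
move=> L0 t0.
have ccos : continuous (fun y : R => cos (y * t)).
  by move=> y; apply: continuous_comp; [exact: cvgM cvg_id (cvg_cst _)|exact: continuous_cos].
transitivity (\int[mu]_(x in `[- L, L]) cos (x * t)).
  rewrite [RHS]Rintegral_mkcond; apply: eq_Rintegral => x _.
  by rewrite patchE indicE; case: (_ \in _); rewrite ?mul1r ?mul0r.
have LL : - L < L by rewrite gtrN.
rewrite (@Rintegral_improper R _ (fun _ => - L) (fun _ => L) _ _ _ _
  (fun y => t^-1 * sin (y * t)) _ _ _ (t^-1 * sin (L * t) - t^-1 * sin (- L * t)))//.
- by rewrite mulNr sinN; field.
- apply/seteqP; split=> y; first by move=> Hy; exists 0%N.
  by case.
- move=> y _; apply: is_derive_eq; rewrite /GRing.scale/=; field; exact: t0.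
- by move=> y _; exact: ccos.
- apply: continuous_compact_integrable; first exact: segment_compact.
  exact: continuous_subspaceT.
- exact: cvg_cst.
Qed.

Variable u : R -> R.
Hypothesis su : smooth_decay u.
Let psi := trig_transform u (cst 0).

Let cpsi : continuous psi.
Proof. exact: continuous_trig_transform su (@smooth_decay0 R). Qed.

Lemma ae_neq (a : R) : {ae mu, forall x, x != a}.
Proof.
exists [set a]; split; [exact: measurable_set1|exact: lebesgue_measure_set1|].
by move=> x /= /negP; rewrite negbK => /eqP.
Qed.

(** [2 sin (L t) / t] is the transform of the indicator of [[- L, L]]. One exchange of integrals
    moves it to the side of [psi], another brings in the Gaussian shift. *)
Lemma sinc_transform (L s : R) : 0 < L ->
  \int[mu]_t (u t * (expR (- ((s * t) ^+ 2 / 2)) * (2 * sin (L * t) / t))) =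
  \int[gam]_y \int[mu]_x (\1_(`[- L, L]%classic : set R) x * psi (x + s * y)).
Proof.
move=> L0.
have [C psiC] := trig_transform_bounded su (@smooth_decay0 R).
have mp : measurable_fun setT (fun z : measurableTypeR R * measurableTypeR R => psi (z.1 + s * z.2)).
  apply: measurableT_comp; first exact: (continuous_measurable_fun cpsi).
  by apply: measurable_funD; [exact: measurable_fst|apply: measurable_funM => //; exact: measurable_snd].
have i1 : gam.-integrable setT (EFin \o (cst 1)) by exact: finite_measure_integrable_cst.
have := @Rintegral_fubini_kernel _ _ (measurableTypeR R) (measurableTypeR R) R mu gam
  _ (cst 1) _ C (integrable_indic_itv L) i1 mp (fun z => psiC _).
move=> /esym E1.
transitivity (\int[gam]_y (cst 1 y * \int[mu]_x (\1_(`[- L, L]%classic : set R) x * psi (x + s * y)))); last first.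
  by apply: eq_Rintegral => y _; rewrite mul1r.
apply: etrans (esym E1).
pose w (t : R) := expR (- ((s * t) ^+ 2 / 2)).
have iw : mu.-integrable setT (EFin \o (fun t => u t * w t)).
  have iu := smooth_decay_integrable su.
  apply: (@le_integrable_R _ _ (measurableTypeR R) mu _ _ (fun t => `|u t|)) => //.
  - apply: measurable_funM; first exact: (continuous_measurable_fun (smooth_decay_continuous su)).
    apply: measurableT_comp => //; apply: measurableT_comp => //.
    by apply: measurable_funM => //; apply: measurable_funX; exact: measurable_funM.
  - move=> t _; rewrite normrM ler_piMr// ger0_norm ?expR_ge0// -expR0 ler_expR.
    by rewrite oppr_le0 divr_ge0// sqr_ge0.
  - exact: (integrable_abse iu).
have := @Rintegral_fubini_kernel _ _ (measurableTypeR R) (measurableTypeR R) R mu mu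
  _ _ _ 1 (integrable_indic_itv L) iw (@measurable_cosM R) (fun z => norm_cos_le1 _).
move=> E2.
transitivity (\int[mu]_x (\1_(`[- L, L]%classic : set R) x * \int[mu]_y (u y * w y * cos (x * y)))); last first.
  apply: eq_Rintegral => x _; congr (_ * _).
  transitivity (\int[gam]_y psi (x + s * y)); last first.
    by apply: eq_Rintegral => y _; rewrite mul1r.
  rewrite gauss_trig_transform//; last exact: smooth_decay0.
  rewrite [X in _ + X](_ : _ = 0); last first.
    by rewrite /Rintegral integral0_eq// => t _; rewrite mul0r.
  by rewrite addr0; apply: eq_Rintegral => t _; rewrite -mulrA [w t * _]mulrC.
apply: etrans (esym E2).
(* At [t = 0] the quotient is [0] by convention, whereas the integral of the indicator is [2 L]; a
   single point is negligible. *)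
rewrite /Rintegral; congr fine; apply: eq_integral_null.
have [N [mN N0 HN]] := ae_neq 0; exists N; split=> // t Ht; apply: HN => /= t0.
by apply: Ht; rewrite /= mulrA -(integral_itv_cos L0 t0).
Qed.

(** The condition on [L] and [s] says that for fixed [y] the interval [[- L, L]] shifted by [s y]
    eventually contains any given point. Domination is by [|psi|] in [x] and then by a constant in
    [y]. *)
Lemma cvg_sinc_transform (L s : nat -> R) : (forall n, 0 < L n) ->
  (forall K : R, \forall n \near \oo, K + K * s n <= L n) -> (forall n, 0 <= s n) ->
  \int[mu]_t (u t * (expR (- ((s n * t) ^+ 2 / 2)) * (2 * sin (L n * t) / t))) @[n --> \oo]
    --> \int[mu]_x psi x.
Proof.
move=> L0 Ls s0; under eq_cvg do rewrite sinc_transform//.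
have [C psiC] := trig_transform_bounded su (@smooth_decay0 R).
have ipsi := integrable_trig_transform su (@smooth_decay0 R).
have mind n : measurable_fun setT (\1_(`[- L n, L n]%classic : set R) : R -> R).
  exact: measurable_indic.
have mshift n y : measurable_fun setT (fun x : R => psi (x + s n * y)).
  apply: measurableT_comp; first exact: (continuous_measurable_fun cpsi).
  exact: measurable_funD.
pose I n y := \int[mu]_x (\1_(`[- L n, L n]%classic : set R) x * psi (x + s n * y)).
have Ib n : mu.-integrable setT (EFin \o (fun x => C * \1_(`[- L n, L n]%classic : set R) x)).
  by apply: (@integrableZ_R _ _ (measurableTypeR R) mu) => //; exact: integrable_indic_itv.
have ii n y : mu.-integrable setT (EFin \o (fun x => \1_(`[- L n, L n]%classic : set R) x * psi (x + s n * y))).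
  apply: (@le_integrable_R _ _ (measurableTypeR R) mu _ _ (fun x => C * \1_(`[- L n, L n]%classic : set R) x)) => //.
  - by apply: measurable_funM; [exact: mind|exact: mshift].
  - move=> x _; rewrite normrM mulrC ler_pM// indicE; case: (_ \in _); rewrite ?normr1 ?normr0//.
have IE n y : I n y = \int[mu]_x (\1_(`[- L n, L n]%classic : set R) (x - s n * y) * psi x).
  rewrite (@Rintegral_affine R 1 (s n * y)) ?ltr01//; last first.
    apply: (@le_integrable_R _ _ (measurableTypeR R) mu _ _ (fun x => `|psi x|)) => //.
    - apply: measurable_funM; last exact: (continuous_measurable_fun cpsi).
      by apply: measurableT_comp => //; exact: measurable_funD.
    - by move=> x _; rewrite normrM ler_piMl// indicE; case: (_ \in _); rewrite ?normr1 ?normr0.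
    - exact: (integrable_abse ipsi).
  by rewrite mul1r; apply: eq_Rintegral => x _; rewrite mul1r addrK.
have Ile n y : `|I n y| <= \int[mu]_x `|psi x|.
  rewrite IE.
  have ii' : mu.-integrable setT (EFin \o (fun x => \1_(`[- L n, L n]%classic : set R) (x - s n * y) * psi x)).
    apply: (@le_integrable_R _ _ (measurableTypeR R) mu _ _ (fun x => `|psi x|)) => //.
    - apply: measurable_funM; last exact: (continuous_measurable_fun cpsi).
      by apply: measurableT_comp => //; exact: measurable_funD.
    - by move=> x _; rewrite normrM ler_piMl// indicE; case: (_ \in _); rewrite ?normr1 ?normr0.
    - exact: (integrable_abse ipsi).
  apply: (le_trans (le_normr_Rintegral measurableT ii')); apply: le_Rintegral => //.
  - exact: (integrable_abse ii').
  - exact: (integrable_abse ipsi).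
  - by move=> x _; rewrite normrM ler_piMl// indicE; case: (_ \in _); rewrite ?normr1 ?normr0.
(* Continuity in [y] is established for the sake of measurability. *)
have cI n : continuous (I n).
  move=> y.
  have := @continuity_under_integral R _ (measurableTypeR R) mu
    (fun y x => \1_(`[- L n, L n]%classic : set R) x * psi (x + s n * y)) setT measurableT (y - 1) (y + 1)
    _ _ (fun x => C * \1_(`[- L n, L n]%classic : set R) x) _ _.
  apply.
  - by move=> z _; exact: ii.
  - apply: aeW => x _ z _; apply: cvgM; first exact: cvg_cst.
    have A : x + s n * y' @[y' --> z] --> x + s n * z.
      by apply: cvgD; [exact: cvg_cst|apply: cvgM; [exact: cvg_cst|exact: cvg_id]].
    exact: (cvg_comp _ _ A (@cpsi _)).
  - exact: Ib.
  - move=> z _; apply: aeW => x _; rewrite normrM mulrC ler_pM// indicE.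
    by case: (_ \in _); rewrite ?normr1 ?normr0.
  - by rewrite inE/= in_itv/= ltrBlDr ltrDl ltr01.
have cvI y : I n y @[n --> \oo] --> \int[mu]_x psi x.
  under eq_cvg do rewrite IE.
  apply: (@Rdominated_cvg R _ (measurableTypeR R) mu setT _ _ (fun x => `|psi x|) _ _ _ _ _ _).2 => //.
  - move=> n; apply: measurable_funM; last exact: (continuous_measurable_fun cpsi).
    by apply: measurableT_comp => //; exact: measurable_funD.
  - exact: (continuous_measurable_fun cpsi).
  - apply: aeW => x _; apply: cvg_near_cst.
    have := Ls (`|x| + `|y|); apply: filterS => n Hn.
    rewrite indicE mem_set ?mul1r//= in_itv/= -ler_norml.
    apply: le_trans Hn; apply: (le_trans (ler_normB _ _)); apply: lerD.
      by rewrite lerDl.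
    by rewrite normrM (ger0_norm (s0 n)) mulrC ler_wpM2r// lerDr.
  - exact: (integrable_abse ipsi).
  - by move=> n x _; rewrite normrM ler_piMl// indicE; case: (_ \in _); rewrite ?normr1 ?normr0.
have := @ae_dominated_cvg _ (measurableTypeR R) R gam I (fun=> \int[mu]_x psi x)
  (fun=> (\int[mu]_x `|psi x|)%:E) _ _ _ _.
have -> : \int[gam]_x (\int[mu]_x psi x) = \int[mu]_x psi x.
  by rewrite Rintegral_cst// [X in fine X]probability_setT mulr1.
move=> H; apply: (H _ _ _ _).2.
- by move=> n; exact: (continuous_measurable_fun (cI n)).
- by apply: aeW => y; exact: cvI.
- exact: finite_measure_integrable_cst.
- by move=> n y; rewrite lee_fin.
Qed.

End sinc.

(** * The density of the Bartlett spectrum *)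

Section pairsum.
Context {R : realType}.

(** The terms of index [N] and [- N] together, so that symmetric partial sums become partial sums of
    a series over the natural numbers. *)
Definition pairsum (g : int -> R) (N : nat) : R :=
  if N is k.+1 then g k.+1%:Z + g (- k.+1%:Z) else g 0.

Lemma symsumE g N : symsum g N = \sum_(k < N.+1) pairsum g k.
Proof.
elim: N => [|N IH]; first by rewrite symsum0 big_ord1.
by rewrite symsumS IH [RHS]big_ord_recr.
Qed.

Lemma norm_pairsum_le g k : `|pairsum g k| <= pairsum (fun n => `|g n|) k.
Proof. by case: k => [//|k]; exact: ler_normD. Qed.

Lemma pairsum_le f g k : (forall n, f n <= g n) -> pairsum f k <= pairsum g k.
Proof. by move=> fg; case: k => [|k] /=; rewrite ?lerD. Qed.

Lemma pairsum_ge0 g k : (forall n, 0 <= g n) -> 0 <= pairsum g k.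
Proof. by move=> g0; case: k => [|k] //=; rewrite addr_ge0. Qed.

Lemma pairsumZ c g k : pairsum (fun n => c * g n) k = c * pairsum g k.
Proof. by case: k => [|k] //=; rewrite mulrDr. Qed.

End pairsum.

Section counting_range.
Context {R : realType}.
Local Notation count := (@counting R R).

Lemma counting_set1 (a : R) : count [set a] = 1%E.
Proof.
by rewrite /counting asboolT ?finite_set1// fset_set1 finmap.cardfs1.
Qed.

Lemma integral_counting_set1 (f : R -> R) (a : R) :
  (\int[count]_(x in [set a]) (f x)%:E = (f a)%:E)%E.
Proof.
rewrite (eq_integral (cst (f a)%:E)); last by move=> x; rewrite inE => ->.
rewrite integral_cst; last exact: measurable_set1.
by rewrite [X in (_ * X)%E]counting_set1 mule1.
Qed.

Definition int_pair (e : int -> R) (k : nat) : set R :=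
  if k is j.+1 then [set e j.+1%:Z] `|` [set e (- j.+1%:Z)] else [set e 0].

Lemma int_pair_bigcup e : range e = \bigcup_k int_pair e k.
Proof.
apply/seteqP; split=> [_ [n _ <-]|x [k _]].
  exists `|n|%N => //; case: n => [[|n]|n] //=; first by left.
  by right; rewrite NegzE.
by case: k => [->|k [->|->]]; eexists.
Qed.

Lemma measurable_int_pair e k : measurable (int_pair e k : set (measurableTypeR R)).
Proof.
by case: k => [|k] /=; [exact: measurable_set1|apply: measurableU; exact: measurable_set1].
Qed.

Section injective_enumeration.
Variable e : int -> R.
Hypothesis ie : injective e.

Lemma trivIset_int_pair : trivIset setT (int_pair e).
Proof.
have ab k x : int_pair e k x -> exists2 n : int, x = e n & `|n|%N = k.
  by case: k => [->|k [->|->]]; eexists => //; rewrite ?abszN.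
move=> i j _ _ [x [/ab[n -> <-] /ab[m /ie -> <-]]]; by [].
Qed.

Lemma ge0_integral_int_pair (f : R -> R) k : (forall x, 0 <= f x) -> measurable_fun setT f ->
  (\int[count]_(x in int_pair e k) (f x)%:E = (pairsum (f \o e) k)%:E)%E.
Proof.
move=> f0 mf; case: k => [|k]; first exact: integral_counting_set1.
rewrite ge0_integral_setU; try exact: measurable_set1.
- by rewrite !integral_counting_set1 -EFinD.
- by apply/measurable_EFinP; exact: measurable_funTS.
- by move=> x _; rewrite lee_fin.
apply/disj_setPS => x [-> /ie]; lia.
Qed.

Variable f : R -> R.
Hypothesis mf : measurable_fun setT f.
Variable M : R.
Hypothesis fM : forall N, \sum_(k < N) pairsum (fun n => `|f (e n)|) k <= M.

Let mD : measurable (range e : set (measurableTypeR R)).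
Proof.
by rewrite int_pair_bigcup; apply: bigcup_measurable => k _; exact: measurable_int_pair.
Qed.

Lemma integrable_counting_range : count.-integrable (range e) (EFin \o f).
Proof.
apply/integrableP; split; first by apply/measurable_EFinP; exact: measurable_funTS.
rewrite [X in integral _ X]int_pair_bigcup ge0_integral_bigcup//.
- apply: (@le_lt_trans _ _ M%:E); last exact: ltry.
  apply: lime_le; first by apply: is_cvg_ereal_nneg_natsum => k _; exact: integral_ge0.
  apply: nearW => N; rewrite big_mkord; apply: le_trans (_ : (\sum_(k < N) pairsum (fun n => `|f (e n)|) k)%:E <= _)%E; last by rewrite lee_fin.
  rewrite -sumEFin; apply: lee_sum => k _.
  by rewrite (ge0_integral_int_pair k (f := fun x => `|f x|))//; exact: measurableT_comp.
- by move=> k; exact: measurable_int_pair.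
- by apply: measurableT_comp => //; apply/measurable_EFinP; exact: measurable_funTS.
- exact: trivIset_int_pair.
Qed.

(** An integral over a set counts each point once; injectivity of [e] makes it agree with the sum
    over the indices. The bound [M] provides absolute convergence. *)
Lemma cvg_counting_range :
  symsum (f \o e) N @[N --> \oo] --> \int[count]_(x in range e) f x.
Proof.
have iD := integrable_counting_range.
have E : (\int[count]_(x in range e) (f x)%:E = \big[+%E/0%E]_(0 <= k <oo) (pairsum (f \o e) k)%:E)%E.
  rewrite [X in integral _ X]int_pair_bigcup integral_bigcup.
  - apply: eq_eseriesr => k _; case: k => [|k]; first exact: integral_counting_set1.
    rewrite integral_setU_EFin.
    + by rewrite !integral_counting_set1 -EFinD.
    + exact: measurable_set1.
    + exact: measurable_set1.
    + exact: measurable_funTS.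
    + by apply/disj_setPS => x [-> /ie]; lia.
  - exact: trivIset_int_pair.
  - by move=> k; exact: measurable_int_pair.
  - by rewrite -int_pair_bigcup.
have cs : cvgn (series (pairsum (f \o e))).
  apply: normed_cvg.
  suff : cvgn (series (fun k => `|pairsum (f \o e) k|)) by [].
  apply: nondecreasing_is_cvgn.
    by apply/nondecreasing_seqP => n; rewrite seriesEnat/= big_nat_recr//= lerDl.
  exists M => _ [N _ <-]; rewrite seriesEnat/= big_mkord; apply: le_trans (fM N).
  by apply: ler_sum => k _; exact: norm_pairsum_le.
have -> : \int[count]_(x in range e) f x = limn (series (pairsum (f \o e))).
  rewrite /Rintegral E; apply: (congr1 fine (y := (limn (series (pairsum (f \o e))))%:E)).
  rewrite -EFin_lim//; congr (limn _); apply/funext => N.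
  by rewrite /= seriesEnat/= sumEFin.
under eq_cvg do rewrite symsumE.
have := cs; rewrite -(cvg_shiftS (series _)).
apply: cvg_trans; apply: near_eq_cvg; apply: nearW => N.
by rewrite /= seriesEnat/= big_mkord.
Qed.

End injective_enumeration.

End counting_range.
Lemma ae_eq_measure d (T : measurableType d) (R : realType)
    (m : {measure set T -> \bar R}) (A B : set T) : measurable A -> measurable B ->
  {ae m, forall w, A w <-> B w} -> m A = m B.
Proof.
move=> mA mB [N [mN N0 HN]].
rewrite -[A]setIT -[B]setIT -!integral_indic//; apply: eq_integral_null.
exists N; split=> // w Hw; apply: HN => /= AB; apply: Hw => /=.
rewrite !indicE; congr (_%:R%:E); congr nat_of_bool.
by apply/idP/idP; rewrite !inE => /AB.
Qed.

Section fbm_integers.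
Context {R : realType} d' (T' : measurableType d') (Q : probability T' R).
Notation mu := (@lebesgue_measure R).
Notation gam := (@normal_prob R 0 1).
Variables (h : R) (B : R -> T' -> R).
Hypotheses (h0 : 0 < h) (h1 : h < 1) (fbmB : fractional_brownian_motion Q h B).

Lemma fbm_Rlaw (t : R) (f : R -> R) : measurable_fun setT f ->
  \int[Q]_w f (B t w) = \int[gam]_y f (`|t| `^ h * y).
Proof.
move=> mf; rewrite /Rintegral; congr fine.
by apply: (fbm_law fbmB t (f := EFin \o f)); exact/measurable_EFinP.
Qed.

Lemma fbm_singleton (t c : R) : t != 0 -> Q [set w | B t w = c] = 0%E.
Proof.
move=> t0; have mB := fbm_measurable fbmB t.
have s0 : `|t| `^ h != 0 by rewrite gt_eqF//; apply: powR_gt0; rewrite normr_gt0.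
pose i : R -> R := \1_([set c] : set R).
have mi : measurable_fun setT i by exact: measurable_indic.
have := fbm_law fbmB t (f := EFin \o i).
have -> : (\int[Q]_w (EFin \o i) (B t w) = Q [set w | B t w = c])%E.
  have mA : measurable [set w | B t w = c].
    by have := mB measurableT _ (measurable_set1 c); rewrite setTI.
  by rewrite -[X in _ = Q X]setIT -integral_indic.
move=> -> //; last exact/measurable_EFinP.
rewrite (integral_gauss (f := (fun y => (i (`|t| `^ h * y))%:E))); last first.
  by apply/measurable_EFinP; apply: measurableT_comp => //; exact: measurable_funM.
have -> : (0 = \int[mu]_y (cst 0 y))%E by rewrite integral0.
apply: eq_integral_null.
have [N [mN N0 HN]] := ae_neq (c / `|t| `^ h); exists N; split=> // y Hy; apply: HN => /= yn.
apply: Hy => /=; rewrite /i indicE memNset ?mul0e//= => E; move/eqP: yn; apply.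
by rewrite -E mulrAC divff ?mul1r.
Qed.

(** Stationarity of the increments moves the pair [s], [t] to [0], [t - s]; as [B 0] vanishes almost
    surely, what remains is a normal variable of positive variance, which has no atoms. *)
Lemma fbm_increment_singleton (s t c : R) : s != t -> Q [set w | B t w - B s w = c] = 0%E.
Proof.
move=> st; have := fbm_stationary_increments fbmB s [tuple of [:: t - s]].
move=> /(_ [set x | tnth x ord0 = c]).
have mE : measurable [set x : 1.-tuple R | tnth x ord0 = c].
  by have := measurable_tnth (ord0 : 'I_1) measurableT (measurable_set1 c); rewrite setTI.
move=> /(_ mE).
have -> : [set w | [set x : 1.-tuple R | tnth x ord0 = c]
    [tuple B (s + tnth [tuple t - s] i) w - B s w | i < 1]] = [set w | B t w - B s w = c].
  apply/seteqP; split=> w /=; rewrite tnth_mktuple (tnth_nth 0)/= addrCA subrr addr0//.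
move=> ->.
have -> : [set w | [set x : 1.-tuple R | tnth x ord0 = c]
    [tuple B (tnth [tuple t - s] i) w - B 0 w | i < 1]] = [set w | B (t - s) w - B 0 w = c].
  apply/seteqP; split=> w /=; rewrite tnth_mktuple (tnth_nth 0)//.
rewrite -(@fbm_singleton (t - s) c) ?subr_eq0 1?eq_sym//.
have [N [mN N0 HN]] := fbm_start fbmB.
have m1 r : measurable [set w | B r w = c].
  have := fbm_measurable fbmB r measurableT (measurable_set1 c); rewrite setTI; exact.
have m2 : measurable [set w | B (t - s) w - B 0 w = c].
  have := measurable_funB (fbm_measurable fbmB (t - s)) (fbm_measurable fbmB 0).
  by move=> /(_ measurableT _ (measurable_set1 c)); rewrite setTI.
apply: ae_eq_measure => //.
by exists N; split=> // w Hw; apply: HN => /= B0; apply: Hw => /=; rewrite B0 subr0.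
Qed.

Definition perturbed (w : T') (n : int) : R := n%:~R + B n%:~R w.

Lemma measurable_perturbed n : measurable_fun setT (perturbed ^~ n).
Proof. by apply: measurable_funD => //; exact: fbm_measurable fbmB _. Qed.

(** A coincidence of two points prescribes the value of an increment of [B], an event of probability
    zero, and there are countably many pairs. *)
Lemma perturbed_inj : {ae Q, forall w, injective (perturbed w)}.
Proof.
(* Codes of no pair default to [(0, 0)], whose event is empty because of the condition
   [p.1 != p.2]. *)
pose F (k : nat) := let p := odflt (0, 0) (unpickle k : option (int * int)) in
  [set w | p.1 != p.2 /\ perturbed w p.1 = perturbed w p.2].
have FN k : Q.-negligible (F k).
  rewrite /F; move: (odflt _ _) => [n m] /=.
  have [->|nm] := eqVneq n m.
    rewrite (_ : [set w | _] = set0); first exact: negligible_set0.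
    by apply/seteqP; split=> // w [].
  rewrite (_ : [set w | _] = [set w | B m%:~R w - B n%:~R w = n%:~R - m%:~R]); last first.
    apply/seteqP; split=> w; rewrite /perturbed/=; first by case=> _; lra.
    by move=> E; split=> //; move: E; lra.
  exists [set w | B m%:~R w - B n%:~R w = n%:~R - m%:~R]; split=> //; last first.
    by apply: fbm_increment_singleton; rewrite eqr_int.
  have := measurable_funB (fbm_measurable fbmB m%:~R) (fbm_measurable fbmB n%:~R).
  by move=> /(_ measurableT _ (measurable_set1 (n%:~R - m%:~R))); rewrite setTI.
apply: negligibleS (negligible_bigcup FN) => w /= Hw.
apply: contrapT => H; apply: Hw => n m nm; apply: contrapT => /eqP nm'; apply: H.
by exists (pickle (n, m)) => //; rewrite /F pickleK.
Qed.

Let inj_abs (n : int) : `|n%:~R| = `|n|%N%:R :> R.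
Proof. by rewrite -intr_norm pmulrn abszE. Qed.

Section trig_sum.
Variables u v : R -> R.
Hypotheses (su : smooth_decay u) (sv : smooth_decay v).
Let psi := trig_transform u v.

Let mpsi : measurable_fun setT psi.
Proof. exact: (continuous_measurable_fun (continuous_trig_transform su sv)). Qed.

Lemma continuous_fexp n : continuous (fun t => fexp h t n).
Proof.
move=> t; under eq_fun do rewrite fexpE.
apply: continuous_comp; last exact: continuous_expR.
apply: cvgN; apply: cvgM; last exact: cvg_cst.
by apply: cvgM; [exact: exprn_continuous|exact: cvg_cst].
Qed.

Let ifexp (w k : R -> R) (n : nat) (x : R) : smooth_decay w -> continuous k ->
  (forall y, `|k y| <= 1) ->
  mu.-integrable setT (EFin \o (fun t => w t * (k (x * t) * fexp h t n))).
Proof.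
move=> sw ck k1.
apply: (@le_integrable_R _ _ (measurableTypeR R) mu _ _ (fun t => `|w t|)) => //.
- apply: measurable_funM; first exact: (continuous_measurable_fun (smooth_decay_continuous sw)).
  apply: measurable_funM; last exact: (continuous_measurable_fun (@continuous_fexp n)).
  by apply: measurableT_comp; [exact: (continuous_measurable_fun ck)|exact: measurable_funM].
- move=> t _; rewrite normrM ler_piMr// normrM (ger0_norm (fexp_ge0 _ _ _)).
  by rewrite mulr_ile1// ?fexp_ge0// fexp_le1.
- exact: (integrable_abse (smooth_decay_integrable sw)).
Qed.

Lemma fbm_trig_transform (n : int) :
  \int[Q]_w psi (perturbed w n) =
  \int[mu]_t (u t * (cos (n%:~R * t) * fexp h t `|n|%N)) +
  \int[mu]_t (v t * (sin (n%:~R * t) * fexp h t `|n|%N)).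
Proof.
have mf : measurable_fun setT (fun y : R => psi (n%:~R + y)).
  by apply: measurableT_comp => //; exact: measurable_funD.
rewrite (fbm_Rlaw n%:~R mf) gauss_trig_transform//.
have E t : expR (- ((`|n%:~R| `^ h * t) ^+ 2 / 2)) = fexp h t `|n|%N.
  rewrite fexpE inj_abs [2 * h]mulrC powRrM powR_mulrn ?powR_ge0//.
  by congr (expR (- _)); rewrite exprMn; ring.
by congr (_ + _); apply: eq_Rintegral => t _; rewrite E.
Qed.

Lemma integrable_perturbed (f : R -> R) (C : R) n : measurable_fun setT f ->
  (forall x, `|f x| <= C) -> Q.-integrable setT (EFin \o (fun w => f (perturbed w n))).
Proof.
move=> mf fC; apply: (@bounded_integrable _ _ _ Q _ C) => //.
exact: measurableT_comp (measurable_perturbed n).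
Qed.

Lemma integrable_fsum N : mu.-integrable setT (EFin \o (fun t => u t * fsum h t N)).
Proof.
elim: N => [|N IH].
  rewrite (_ : (fun t => _) = u); first exact: smooth_decay_integrable.
  by apply/funext => t; rewrite fsum0// mulr1.
rewrite (_ : (fun t => _) = (fun t => u t * fsum h t N + 2 * (u t * (cos (N.+1%:R * t) * fexp h t N.+1)))).
  apply: (@integrableD_R _ _ (measurableTypeR R) mu) => //.
  apply: (@integrableZ_R _ _ (measurableTypeR R) mu) => //.
  by apply: ifexp => //; [exact: continuous_cos|exact: norm_cos_le1].
by apply/funext => t; rewrite fsumS//; ring.
Qed.

(** The sine terms of [n] and [- n] cancel, which leaves [u] against the real partial sum [S_N]. *)
Lemma fbm_symsum_trig_transform N :
  Q.-integrable setT (EFin \o (fun w => symsum (fun n => psi (perturbed w n)) N)) /\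
  \int[Q]_w symsum (fun n => psi (perturbed w n)) N = \int[mu]_t (u t * fsum h t N).
Proof.
have [C psiC] := trig_transform_bounded su sv.
have ip n : Q.-integrable setT (EFin \o (fun w => psi (perturbed w n))).
  exact: integrable_perturbed.
have [ccos csin] := (@continuous_cos R, @continuous_sin R).
elim: N => [|N [IHi IH]].
  rewrite (_ : (fun w => _) = (fun w => psi (perturbed w 0))); last first.
    by apply/funext => w; rewrite symsum0.
  split; first exact: ip.
  rewrite fbm_trig_transform absz0.
  rewrite [X in _ + X](_ : _ = 0); last first.
    by rewrite /Rintegral integral0_eq// => t _; rewrite mul0r sin0 mul0r mulr0.
  rewrite addr0; apply: eq_Rintegral => t _.
  by rewrite mul0r cos0 mul1r fexp0// fsum0.
rewrite (_ : (fun w => _) = (fun w => symsum (fun n => psi (perturbed w n)) N +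
   (psi (perturbed w N.+1%:Z) + psi (perturbed w (- N.+1%:Z))))); last first.
  by apply/funext => w; rewrite symsumS.
have i2 : Q.-integrable setT (EFin \o (fun w => psi (perturbed w N.+1%:Z) + psi (perturbed w (- N.+1%:Z)))).
  exact: integrableD_R.
split; first exact: integrableD_R.
rewrite RintegralD// IH RintegralD// !fbm_trig_transform.
rewrite abszN mulrNz.
have ic := ifexp N.+1 N.+1%:R su ccos (@norm_cos_le1 R).
have is_ := ifexp N.+1 N.+1%:R sv csin (@norm_sin_le1 R).
rewrite [X in _ + (_ + (X + _)) = _](_ : _ = \int[mu]_t (u t * (cos (N.+1%:R * t) * fexp h t N.+1))); last first.
  by apply: eq_Rintegral => t _; rewrite mulNr cosN.
rewrite [X in _ + (_ + (_ + X)) = _](_ : _ = - \int[mu]_t (v t * (sin (N.+1%:R * t) * fexp h t N.+1))); last first.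
  transitivity (- 1 * \int[mu]_t (v t * (sin (N.+1%:R * t) * fexp h t N.+1))); last by rewrite mulN1r.
  by rewrite -RintegralZl//; apply: eq_Rintegral => t _; rewrite mulNr sinN mulNr mulrN mulN1r.
rewrite (_ : \int[mu]_t (u t * fsum h t N.+1) =
  \int[mu]_t (u t * fsum h t N + 2 * (u t * (cos (N.+1%:R * t) * fexp h t N.+1)))); last first.
  by apply: eq_Rintegral => t _; rewrite fsumS//; ring.
rewrite [RHS]RintegralD//; [|exact: integrable_fsum|exact: (@integrableZ_R _ _ (measurableTypeR R) mu)].
rewrite RintegralZl//.
by move: (\int[mu]_t _) (\int[mu]_t _) (\int[mu]_t _) => a b c; ring.
Qed.

End trig_sum.

(** Either [|y| <= n / 2], and [x + y] is still at distance at least [n / 2] from [0], or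
    [2 |y| / n > 1], and any power of this ratio is a bound. *)
Lemma lorentz_add_le (n x y : R) k : 0 < n -> `|x| = n ->
  lorentz (x + y) <= 4 / n ^+ 2 + (2 * `|y| / n) ^+ k.
Proof.
move=> n0 xn; have L1 (z : R) : lorentz z <= 1.
  by rewrite /lorentz invf_le1 ?ltr_pwDl ?sqr_ge0// lerDl sqr_ge0.
have [yn|yn] := leP (2 * `|y|) n.
  apply: (@le_trans _ _ (4 / n ^+ 2)); last by rewrite lerDl exprn_ge0// divr_ge0// ?mulr_ge0// ltW.
  have xy : n / 2 <= `|x + y|.
    have := lerB_dist x (- y); rewrite opprK normrN xn; apply: le_trans; lra.
  rewrite /lorentz -[4 / _]invrK invf_div lef_pV2 ?posrE ?ltr_pwDl ?sqr_ge0 ?divr_gt0 ?exprn_gt0//.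
  have : (n / 2) ^+ 2 <= `|x + y| ^+ 2 by rewrite lerXn2r ?nnegrE// divr_ge0// ltW.
  by rewrite real_normK ?num_real// expr_div_n -natrX; lra.
apply: (le_trans (L1 _)); rewrite -[leLHS]add0r; apply: lerD.
  by rewrite divr_ge0// sqr_ge0.
by apply: exprn_ege1; rewrite ler_pdivlMr// mul1r ltW.
Qed.

Lemma fbm_lorentz : exists2 C : R, 0 <= C & forall (n : int) k, `|n|%N = k.+1 ->
  \int[Q]_w lorentz (perturbed w n) <= C * k.+1%:R `^ (- 1 - 1).
Proof.
have hc : 0 < 1 - h by rewrite subr_gt0.
(* The moment of order [2 p] of [B_n / n] is of order [n^(- 2 p (1 - h))], hence at most of order
   [n^(- 2)]. *)
pose p := (Num.truncn (1 - h)^-1).+1.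
have p1 : 1 <= p%:R * (1 - h) by rewrite -ler_pdivrMr// div1r ltW// truncnS_gt.
pose m := \int[gam]_y (y ^+ (p.*2)).
have evp (y : R) : 0 <= y ^+ (p.*2) by rewrite -muln2 exprM sqr_ge0.
have im : gam.-integrable setT (EFin \o (fun y => y ^+ (p.*2))).
  by apply: integrable_gauss; [exact: measurable_funX|exact: integrable_gauss_density_pow].
have m0 : 0 <= m by apply: Rintegral_ge0.
exists (4 + 2 ^+ (p.*2) * m); first by rewrite addr_ge0// mulr_ge0.
move=> n k nk; set N := k.+1%:R.
have N0 : 0 < N :> R by [].
have mf : measurable_fun setT (fun y : R => lorentz (n%:~R + y)).
  by apply: measurableT_comp; [exact: measurable_lorentz|exact: measurable_funD].
rewrite (fbm_Rlaw n%:~R mf) inj_abs nk -/N.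
have L1 (z : R) : `|lorentz z| <= 1.
  by rewrite ger0_norm ?(ltW (lorentz_gt0 _))// /lorentz invf_le1 ?ltr_pwDl ?sqr_ge0// lerDl sqr_ge0.
pose c := 2 ^+ (p.*2) * (N `^ h / N) ^+ (p.*2).
apply: (@le_trans _ _ (\int[gam]_y (cst (4 / N ^+ 2) y + c * y ^+ (p.*2)))).
  apply: le_Rintegral => //.
  - apply: (@bounded_integrable _ _ _ gam _ 1) => //.
    by apply: measurableT_comp; [exact: measurable_lorentz|apply: measurable_funD => //; exact: measurable_funM].
  - apply: integrableD_R => //; first exact: finite_measure_integrable_cst.
    exact: integrableZ_R.
  - move=> y _; apply: (le_trans (lorentz_add_le _ (p.*2) N0 _)); first by rewrite inj_abs nk.
    rewrite lerD2l /c -exprMn -exprMn normrM (ger0_norm (powR_ge0 _ _)).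
    have -> : 2 * (N `^ h * `|y|) / N = 2 * (N `^ h / N) * `|y| by field; rewrite gt_eqF.
    by rewrite !exprMn -normrX (ger0_norm (evp _)).
rewrite RintegralD//; [|exact: finite_measure_integrable_cst|exact: integrableZ_R].
rewrite Rintegral_cst// [X in fine X]probability_setT mulr1 RintegralZl// -/m.
have N2 : N `^ (- 1 - 1) = (N ^+ 2)^-1.
  by rewrite (_ : - 1 - 1 = - 2)%R; [rewrite powRN powR_mulrn// ltW|ring].
have -> : (4 + 2 ^+ (p.*2) * m) * N `^ (- 1 - 1) = 4 / N ^+ 2 + 2 ^+ (p.*2) * N ^- 2 * m.
  by rewrite N2; move: (N ^- 2) => q; ring.
rewrite lerD2l; apply: ler_wpM2r => //.
apply: ler_wpM2l => //.
rewrite -N2 (_ : N `^ h / N = N `^ (h - 1)); last first.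
  rewrite powRD ?powR_inv1 ?(ltW N0)//; by apply/implyP => _; rewrite gt_eqF.
rewrite -powR_mulrn ?powR_ge0// -powRrM; apply: ler_powR; first by rewrite /N ler1n.
by rewrite -muln2 natrM; nra.
Qed.

End fbm_integers.

Lemma integrable_opp (R : realType) (f : R -> R) :
  (@lebesgue_measure R).-integrable setT (EFin \o f) ->
  (@lebesgue_measure R).-integrable setT (EFin \o (fun x => f (- x))).
Proof.
move=> /integrableP[mf If]; apply/integrableP; split.
  by apply: (measurableT_comp mf); exact: oppr_measurable.
by rewrite -(ge0_integral_opp (f := fun x => `|(f x)%:E|%E))//; exact: measurableT_comp.
Qed.

Section structure_factor_density.
Context {R : realType} d' (T' : measurableType d') (Q : probability T' R).
Notation mu := (@lebesgue_measure R).
Local Notation count := (@counting R R).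
Variables (h : R) (B : R -> T' -> R).
Hypotheses (h0 : 0 < h) (h1 : h < 1) (fbmB : fractional_brownian_motion Q h B).

Let P k w := pairsum (fun n => lorentz (perturbed B w n)) k.

Let P0 k w : 0 <= P k w.
Proof. by apply: pairsum_ge0 => n; rewrite ltW// lorentz_gt0. Qed.

Let lorentz_le1 (z : R) : `|lorentz z| <= 1.
Proof.
by rewrite ger0_norm ?(ltW (lorentz_gt0 _))// /lorentz invf_le1 ?ltr_pwDl ?sqr_ge0// lerDl sqr_ge0.
Qed.

Let iL n : Q.-integrable setT (EFin \o (fun w => lorentz (perturbed B w n))).
Proof. exact: (integrable_perturbed fbmB n measurable_lorentz lorentz_le1). Qed.

Let iP k : Q.-integrable setT (EFin \o P k).
Proof. by case: k => [|k]; [exact: iL|exact: integrableD_R]. Qed.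

(** A random majorant for all partial sums of [psi] over the points. It has finite mean but may be
    infinite on a null set, whence the extended values. *)
Definition lorentz_sum (w : T') : \bar R := (\big[+%E/0]_(0 <= k <oo) (P k w)%:E)%E.

Lemma lorentz_sum_ge w N : ((\sum_(k < N) P k w)%:E <= lorentz_sum w)%E.
Proof.
rewrite /lorentz_sum -sumEFin -(big_mkord xpredT (fun k => (P k w)%:E)).
by apply: nneseries_lim_ge => k _; rewrite lee_fin.
Qed.

Lemma integrable_lorentz_sum : Q.-integrable setT lorentz_sum.
Proof.
have [C C0 CP] := fbm_lorentz h1 fbmB.
have mP k : measurable_fun setT (EFin \o P k) by exact: measurable_int (iP k).
apply/integrableP; split; first by apply: (@ge0_emeasurable_sum _ _ _ _ (fun k w => (P k w)%:E) xpredT) => [k w _ _|k _]; [rewrite lee_fin|exact: mP].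
rewrite (eq_integral lorentz_sum); last first.
  by move=> w _; rewrite gee0_abs// nneseries_ge0// => k _; rewrite lee_fin.
rewrite integral_nneseries//; last by move=> k w _; rewrite lee_fin.
pose M := 1 + 2 * (C * (1 + 1^-1)).
apply: (@le_lt_trans _ _ M%:E); last exact: ltry.
apply: lime_le; first by apply: is_cvg_ereal_nneg_natsum => k _; apply: integral_ge0 => w _; rewrite lee_fin.
apply: nearW => N; rewrite big_mkord.
have b0 : (\int[Q]_w (P 0 w)%:E <= 1%:E)%E.
  rewrite -[leLHS]fineK; last exact: integrable_fin_num (iP 0).
  rewrite lee_fin; apply: (le_trans (ler_norm _)); apply: bounded_Rintegral_le.
    by apply/measurable_EFinP.
  by move=> w; exact: lorentz_le1.
have bS k : (\int[Q]_w (P k.+1 w)%:E <= (2 * (C * k.+1%:R `^ (- 1 - 1)))%:E)%E.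
  rewrite -[leLHS]fineK; last exact: integrable_fin_num (iP k.+1).
  rewrite lee_fin -/(Rintegral _ _ _) /P/= RintegralD//.
  by rewrite mulr_natl mulr2n; apply: lerD; apply: CP; rewrite ?abszN.
case: N => [|N]; first by rewrite big_ord0 lee_fin /M addr_ge0// !mulr_ge0// addr_ge0.
rewrite big_ord_recl /M EFinD; apply: leeD => //.
apply: (@le_trans _ _ (\sum_(k < N) (2 * (C * k.+1%:R `^ (- 1 - 1)))%:E)%E).
  by apply: lee_sum => k _; exact: bS.
rewrite sumEFin lee_fin -!mulr_sumr ler_pM2l// ler_wpM2l//.
exact: psum_powR_le.
Qed.

Section transform.
Variables u v : R -> R.
Hypotheses (su : smooth_decay u) (sv : smooth_decay v).
Let psi := trig_transform u v.

(** On the event that the points are distinct and [lorentz_sum] is finite, the partial sums converge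
    to the integral over the set of points; a multiple of [lorentz_sum] dominates them. *)
Lemma cvg_expected_sum :
  \int[Q]_w symsum (fun n => psi (perturbed B w n)) N @[N --> \oo] -->
  \int[Q]_w \int[count]_(x in perturbed_integers B w) psi x.
Proof.
have [C C0 psiC] := trig_transform_le su sv.
have mpsi : measurable_fun setT psi by exact: (continuous_measurable_fun (continuous_trig_transform su sv)).
apply: (@ae_dominated_cvg _ _ R Q _ _ (fun w => C%:E * lorentz_sum w)%E _ _ _ _).2.
- move=> N; apply/measurable_EFinP.
  exact: measurable_int (fbm_symsum_trig_transform h0 fbmB su sv N).1.
- have [N1 [mN1 N10 HN1]] := perturbed_inj fbmB.
  have [N2 [mN2 N20 HN2]] := integrable_ae measurableT integrable_lorentz_sum.
  exists (N1 `|` N2); split; first exact: measurableU.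
    by apply/eqP; rewrite measureU0//; apply/eqP.
  move=> w Hw; apply: contrapT => /not_orP[H1 H2]; apply: Hw => /=.
  have inj : injective (perturbed B w) by apply: contrapT => H; apply: H1; exact: HN1.
  have fin : lorentz_sum w \is a fin_num.
    by apply: contrapT => H; apply: H2; apply: HN2 => /= H'; apply: H; exact: H'.
  apply: (@cvg_counting_range R _ inj _ mpsi (C * fine (lorentz_sum w))).
  move=> N; apply: (@le_trans _ _ (C * \sum_(k < N) P k w)); last first.
    by rewrite ler_wpM2l// -lee_fin fineK// lorentz_sum_ge.
  rewrite mulr_sumr; apply: ler_sum => k _; rewrite -pairsumZ.
  by apply: pairsum_le => n; exact: psiC.
- exact: integrableZl integrable_lorentz_sum.
- move=> N w; apply: (@le_trans _ _ (C%:E * (\sum_(k < N.+1) P k w)%:E)%E); last first.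
    by apply: lee_wpmul2l; [rewrite lee_fin|exact: lorentz_sum_ge].
  rewrite -EFinM lee_fin symsumE; apply: (le_trans (ler_norm_sum _ _ _)).
  rewrite mulr_sumr; apply: ler_sum => k _.
  apply: (le_trans (norm_pairsum_le _ _)); rewrite -pairsumZ.
  by apply: pairsum_le => n; exact: psiC.
Qed.

Lemma Rintegral_sin_transform : \int[mu]_x trig_transform (cst 0) v x = 0.
Proof.
have s0 := @smooth_decay0 R.
have iT := integrable_trig_transform s0 sv.
have E : \int[mu]_x trig_transform (cst 0) v x = - 1 * \int[mu]_x trig_transform (cst 0) v x.
  rewrite -RintegralZl// [in LHS]/Rintegral integral_opp; last exact: measurable_int iT.
  apply: eq_Rintegral => x _.
  rewrite /trig_transform -RintegralZl//; last first.
    have [a b] := integrable_trig s0 sv x.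
    exact: (@integrableD_R _ _ (measurableTypeR R) mu).
  apply: eq_Rintegral => t _; rewrite !mul0r !add0r mulNr sinN; ring.
by move: E; lra.
Qed.

Lemma Rintegral_trig_transform :
  \int[mu]_x trig_transform u v x = \int[mu]_x trig_transform u (cst 0) x.
Proof.
have s0 := @smooth_decay0 R.
transitivity (\int[mu]_x trig_transform u (cst 0) x + \int[mu]_x trig_transform (cst 0) v x); last first.
  by rewrite Rintegral_sin_transform addr0.
rewrite -RintegralD//.
- apply: eq_Rintegral => x _; rewrite !trig_transformE//.
  rewrite [X in _ = _ + X + _](_ : _ = 0); last first.
    by rewrite /Rintegral integral0_eq// => t _; rewrite mul0r.
  rewrite [X in _ = _ + (X + _)](_ : _ = 0); last first.
    by rewrite /Rintegral integral0_eq// => t _; rewrite mul0r.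
  by rewrite addr0 add0r.
- exact: integrable_trig_transform.
- exact: integrable_trig_transform.
Qed.

Lemma measurable_fsum N : measurable_fun setT (fun t => fsum h t N).
Proof.
elim: N => [|N IH]; first by under eq_fun do rewrite fsum0//; exact: measurable_cst.
under eq_fun do rewrite fsumS//.
apply: measurable_funD => //; apply: measurable_funM => //; apply: measurable_funM.
  exact: (continuous_measurable_fun (@continuous_fexp _ h N.+1)).
by apply: measurableT_comp; [exact: (continuous_measurable_fun (@continuous_cos R))|exact: measurable_funM].
Qed.

(** The function is a pointwise limit of continuous functions except at [0], where the series
    diverges; the point [0] is split off. *)
Lemma measurable_structure_factor : measurable_fun setT (fbm_structure_factor h).
Proof.
pose nz (t : R) : R := \1_(~` [set 0] : set R) t.
have mnz : measurable_fun setT nz by apply: measurable_indic; apply: measurableC; exact: measurable_set1.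
have mg : measurable_fun setT (fun t => nz t * fbm_structure_factor h t).
  apply: (@measurable_fun_cvg _ _ _ _ (fun N t => nz t * fsum h t N)).
    by move=> N; apply: measurable_funM => //; exact: measurable_fsum.
  move=> t _; have [->|t0] := eqVneq t 0.
    rewrite /nz indicE memNset/=; last by apply.
    by under eq_cvg do rewrite mul0r; rewrite mul0r; exact: cvg_cst.
  by apply: cvgM; [exact: cvg_cst|exact: cvg_fsum].
have -> : fbm_structure_factor h = (fun t => nz t * fbm_structure_factor h t +
    fbm_structure_factor h 0 * \1_([set 0] : set R) t).
  apply/funext => t; rewrite /nz !indicE; have [->|t0] := eqVneq t 0.
    by rewrite memNset ?mem_set/= ?mul0r ?add0r ?mulr1//; apply.
  rewrite mem_set ?memNset/= ?mul1r ?mulr0 ?addr0//.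
    by move=> E; rewrite E eqxx in t0.
  by move=> E; rewrite E eqxx in t0.
by apply: measurable_funD => //; exact: measurable_funM.
Qed.

Lemma integrable_decay_powR : mu.-integrable setT (EFin \o (fun t => `|u t| * (1 + `|t| `^ (- h)))).
Proof.
have iu := smooth_decay_integrable su.
have mu_ := continuous_measurable_fun (smooth_decay_continuous su).
have [u1 [u2 [_ _ [M uM]]]] := su.
have M0 : 0 <= M.
  by rewrite -(pmulr_lge0 _ (lorentz_gt0 (0 : R))); apply: le_trans (uM 0).1.
pose nr : R -> R := (fun t => t `^ (- h)) \_ `]0, 1].
have inr : mu.-integrable setT (EFin \o nr).
  have H : mu.-integrable `]0, 1] (EFin \o (fun t : R => t `^ (- h))).
    by apply: integrable_powR_near0 => //; rewrite ltrN2.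
  by rewrite /nr -restrict_EFin; apply/(integrable_mkcond _ _).1.
have inr' : mu.-integrable setT (EFin \o (fun t => nr (- t))) by exact: integrable_opp.
have nr0 t : 0 <= nr t by rewrite /nr patchE; case: ifP => // _; exact: powR_ge0.
apply: (@le_integrable_R _ _ (measurableTypeR R) mu _ _ (fun t => 2 * `|u t| + M * (nr t + nr (- t)))) => //.
- apply: measurable_funM; first exact: measurableT_comp.
  by apply: measurable_funD => //; exact: (measurableT_comp (measurable_powR (- h))).
- move=> t _; rewrite normrM normr_id (ger0_norm (addr_ge0 ler01 (powR_ge0 _ _))).
  rewrite mulrDr mulr1 mulr_natl mulr2n -addrA lerD2l.
  have [->|t0] := eqVneq t 0.
    by rewrite normr0 powR0 ?oppr_eq0 ?gt_eqF// mulr0 addr_ge0// mulr_ge0// addr_ge0.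
  have tp : 0 < `|t| by rewrite normr_gt0.
  have [t1|t1] := leP `|t| 1; last first.
    rewrite -[leLHS]addr0; apply: lerD; last by rewrite mulr_ge0// addr_ge0.
    rewrite ler_piMr// powRN invf_le1 ?powR_gt0// -[leLHS](powRr0 `|t|).
    by apply: ler_powR; exact: ltW.
  rewrite -[leLHS]add0r; apply: lerD => //; apply: ler_pM; rewrite ?powR_ge0//.
    apply: (le_trans (uM t).1); rewrite ler_piMr//.
    by rewrite /lorentz invf_le1 ?ltr_pwDl ?sqr_ge0// lerDl sqr_ge0.
  have [tpos|tneg] := ltrP 0 t.
    rewrite gtr0_norm//; apply: (@le_trans _ _ (nr t)); last by rewrite lerDl.
    by rewrite /nr patchE mem_set//= in_itv/= tpos -(gtr0_norm tpos).
  rewrite ler0_norm//; apply: (@le_trans _ _ (nr (- t))); last by rewrite lerDr.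
  by rewrite /nr patchE mem_set//= in_itv/= -(ler0_norm tneg) tp.
- apply: (@integrableD_R _ _ (measurableTypeR R) mu) => //; apply: (@integrableZ_R _ _ (measurableTypeR R) mu) => //.
    exact: (integrable_abse iu).
  exact: (@integrableD_R _ _ (measurableTypeR R) mu).
Qed.

Lemma cvg_fsum_rem_integral :
  [/\ mu.-integrable setT (EFin \o (fun t => u t * fbm_structure_factor h t)),
    forall N, mu.-integrable setT (EFin \o (fun t => u t * fsum_rem h t N)) &
    \int[mu]_t (u t * fsum_rem h t N) @[N --> \oo] -->
      \int[mu]_t (u t * fbm_structure_factor h t)].
Proof.
have [C C0 CP] := fsum_rem_le h0 h1.
have mu_ := continuous_measurable_fun (smooth_decay_continuous su).
(* Written as [t |t|^(- 2)], which is also right at [t = 0], where both sides are [0]. *)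
have minv : measurable_fun setT (fun t : R => t^-1).
  rewrite (_ : (fun t => _) = (fun t : R => t * `|t| `^ (- 2))).
    by apply: measurable_funM => //; exact: (measurableT_comp (measurable_powR (- 2))).
  apply/funext => t; have [->|t0] := eqVneq t 0; first by rewrite invr0 mul0r.
  by rewrite powRN powR_mulrn// real_normK ?num_real//; field.
have mrem N : measurable_fun setT (fun t => u t * fsum_rem h t N).
  apply: measurable_funM => //; apply: measurable_funB; first exact: measurable_fsum.
  apply: measurable_funM; first exact: (continuous_measurable_fun (@continuous_fexp _ h N)).
  apply: measurable_funM => //; apply: measurable_funM => //.
  by apply: measurableT_comp; [exact: (continuous_measurable_fun (@continuous_sin R))|exact: measurable_funM].
(* Multiplication by [nz] removes the origin, where neither the bound on the remainder nor its
   convergence is available, and leaves the integrals unchanged. *)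
pose nz (t : R) : R := \1_(~` [set 0] : set R) t.
have mnz : measurable_fun setT nz by apply: measurable_indic; apply: measurableC; exact: measurable_set1.
have iC : mu.-integrable setT (EFin \o (fun t => C * (`|u t| * (1 + `|t| `^ (- h))))).
  by apply: (@integrableZ_R _ _ (measurableTypeR R) mu) => //; exact: integrable_decay_powR.
have nzae (f : R -> R) : {ae mu, forall t, (f t)%:E = (nz t * f t)%:E}.
  have [N [mN N0 HN]] := ae_neq (0 : R); exists N; split=> // t Ht; apply: HN => /= t0.
  by apply: Ht; rewrite /= /nz indicE mem_set ?mul1r// => E; rewrite E eqxx in t0.
have nzE (f : R -> R) : \int[mu]_t f t = \int[mu]_t (nz t * f t).
  by rewrite /Rintegral; congr fine; apply: eq_integral_null; exact: nzae.
have nzi (f : R -> R) : measurable_fun setT f -> mu.-integrable setT (EFin \o (fun t => nz t * f t)) ->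
    mu.-integrable setT (EFin \o f).
  move=> mf /integrableP[_ If]; apply/integrableP; split; first exact/measurable_EFinP.
  apply: le_lt_trans If; rewrite le_eqVlt; apply/orP; left; apply/eqP.
  apply: eq_integral_null; have [N [mN N0 HN]] := nzae f; exists N; split=> // t Ht; apply: HN => /= E.
  by apply: Ht; exact: (congr1 (fun y => `|y|%E) E).
have bd N (t : R) : `|nz t * (u t * fsum_rem h t N)| <= C * (`|u t| * (1 + `|t| `^ (- h))).
  rewrite /nz indicE; have [->|t0] := eqVneq t 0.
    rewrite memNset/=; last by apply.
    by rewrite mul0r normr0 mulr_ge0// mulr_ge0// addr_ge0// powR_ge0.
  rewrite mem_set/= ?mul1r; last by move=> E; rewrite E eqxx in t0.
  by rewrite normrM mulrCA ler_wpM2l//; exact: CP.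
have [] := @Rdominated_cvg R _ (measurableTypeR R) mu setT
  (fun N t => nz t * (u t * fsum_rem h t N)) (fun t => nz t * (u t * fbm_structure_factor h t))
  (fun t => C * (`|u t| * (1 + `|t| `^ (- h)))) measurableT.
- by move=> N; exact: (measurable_funM mnz (mrem N)).
- exact: (measurable_funM mnz (measurable_funM mu_ measurable_structure_factor)).
- apply: aeW => t _; have [->|t0] := eqVneq t 0.
    rewrite /nz indicE memNset/=; last by apply.
    by under eq_cvg do rewrite mul0r; rewrite mul0r; exact: cvg_cst.
  apply: cvgM; first exact: cvg_cst.
  by apply: cvgM; [exact: cvg_cst|exact: cvg_fsum_rem].
- exact: iC.
- by move=> N t _; exact: bd.
move=> ilim cv; split.
- by apply: nzi ilim; apply: measurable_funM => //; exact: measurable_structure_factor.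
- move=> N; apply: nzi => //.
  apply: (@le_integrable_R _ _ (measurableTypeR R) mu _ _ (fun t => C * (`|u t| * (1 + `|t| `^ (- h))))) => //.
  exact: (measurable_funM mnz (mrem N)).
- rewrite nzE; move: cv; apply: cvg_trans; apply: near_eq_cvg; apply: nearW => N.
  by rewrite /= -nzE.
Qed.

(** For each [N] the integral of [u] against the remainder is the expected partial sum minus the
    integral against the concentrating term. All three converge, and comparing the limits gives the
    identity. *)
Lemma structure_factor_density : \int[mu]_t (u t * fbm_structure_factor h t) =
  \int[Q]_w \int[count]_(x in perturbed_integers B w) psi x - \int[mu]_x psi x.
Proof.
have [_ irem crem] := cvg_fsum_rem_integral.
have cE := cvg_expected_sum.
pose L (N : nat) : R := N%:R + 2^-1.
pose s (N : nat) : R := N%:R `^ h.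
have fE t N : fexp h t N = expR (- ((s N * t) ^+ 2 / 2)).
  rewrite fexpE /s [2 * h]mulrC powRrM powR_mulrn ?powR_ge0//.
  by congr (expR (- _)); rewrite exprMn; ring.
have cS : \int[mu]_t (u t * (expR (- ((s N * t) ^+ 2 / 2)) * (2 * sin (L N * t) / t))) @[N --> \oo]
    --> \int[mu]_x psi x.
  rewrite /psi Rintegral_trig_transform; apply: cvg_sinc_transform => //.
  - by move=> N; rewrite /L ltr_wpDl.
  (* The window [N + 1/2] has to exceed [K + K N^h]. This holds once [N >= K' + K'^(1 / (1 - h))],
     each of the two terms being then at most [N / 2]. *)
  - move=> K; have hc : 0 < 1 - h by rewrite subr_gt0.
    have [K' K'0 KE] : exists2 K' : R, 0 < K' & K' = 2 * (`|K| + 1).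
      by exists (2 * (`|K| + 1)) => //; rewrite mulr_gt0// ltr_wpDl.
    have Kn := ler_norm K.
    near=> N.
    have N0 : 0 < N%:R :> R by rewrite ltr0n; near: N; exact: nbhs_infty_gt.
    have NK : K' + K' `^ (1 - h)^-1 <= N%:R.
      near: N; exists (Num.truncn (K' + K' `^ (1 - h)^-1)).+1 => // n /= Hn.
      by apply: ltW; apply: lt_le_trans (truncnS_gt _) _; rewrite ler_nat.
    have k1 : K <= N%:R / 2.
      by have := powR_ge0 K' (1 - h)^-1; move: NK; rewrite KE; lra.
    have k2 : K * s N <= N%:R / 2.
      apply: (@le_trans _ _ (K' / 2 * s N)).
        apply: ler_wpM2r; first exact: powR_ge0.
        by rewrite KE; lra.
      rewrite mulrAC ler_pM2r//.
      have -> : N%:R = N%:R `^ (1 - h) * s N :> R.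
        by rewrite /s -powRD ?subrK ?powRr1// gt_eqF// implybT.
      apply: ler_wpM2r; first exact: powR_ge0.
      have -> : K' = (K' `^ (1 - h)^-1) `^ (1 - h) by rewrite -powRrM mulVf ?gt_eqF// powRr1 // ltW.
      apply: ge0_ler_powR; rewrite ?nnegrE ?powR_ge0 ?(ltW hc) ?(ltW N0)//.
      by apply: le_trans NK; rewrite lerDr ltW.
    by apply: (le_trans (lerD k1 k2)); rewrite /L -splitr lerDl.
  - by move=> N; exact: powR_ge0.
have E N : \int[mu]_t (u t * fsum_rem h t N) =
    \int[Q]_w symsum (fun n => psi (perturbed B w n)) N -
    \int[mu]_t (u t * (expR (- ((s N * t) ^+ 2 / 2)) * (2 * sin (L N * t) / t))).
  rewrite (fbm_symsum_trig_transform h0 fbmB su sv N).2.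
  have ifs := integrable_fsum h0 su N.
  have E t : u t * (expR (- ((s N * t) ^+ 2 / 2)) * (2 * sin (L N * t) / t)) =
     u t * fsum h t N - u t * fsum_rem h t N.
    by rewrite /fsum_rem fE /L; ring.
  rewrite [X in _ = _ - X](_ : _ = \int[mu]_t (u t * fsum h t N - u t * fsum_rem h t N)); last first.
    by apply: eq_Rintegral => t _; rewrite E.
  by rewrite RintegralB// opprB addrC subrK.
apply: (cvg_unique _ crem) => //=; under eq_cvg do rewrite E.
exact: cvgB.
Unshelve. all: by end_near. Qed.

End transform.

End structure_factor_density.
Section structure_factor.
Context {R : realType}.
Notation mu := (@lebesgue_measure R).

Lemma smooth_decayN (u : R -> R) : smooth_decay u -> smooth_decay (fun x => - u x).
Proof.
move=> [u1 [u2 [d1 d2 [M uM]]]]; exists (fun x => - u1 x), (fun x => - u2 x); split.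
- by move=> y; exact: is_deriveN.
- by move=> y; exact: is_deriveN.
- by exists M => y; rewrite !normrN.
Qed.

Lemma ReM_complex (z : R[i]) (x : R) : complex.Re (z * Complex x 0) = complex.Re z * x.
Proof. by case: z => a b /=; rewrite mulr0 subr0. Qed.

Lemma ImM_complex (z : R[i]) (x : R) : complex.Im (z * Complex x 0) = complex.Im z * x.
Proof. by case: z => a b /=; rewrite mulr0 add0r. Qed.

Lemma Re_fourier (phi : R -> R[i]) x : complex.Re (fourier phi x) =
  trig_transform (fun t => complex.Re (phi t)) (fun t => complex.Im (phi t)) x.
Proof.
apply: eq_Rintegral => t _; case: (phi t) => a b /=.
by rewrite cosN sinN mulrN opprK.
Qed.

Lemma Im_fourier (phi : R -> R[i]) x : complex.Im (fourier phi x) =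
  trig_transform (fun t => complex.Im (phi t)) (fun t => - complex.Re (phi t)) x.
Proof.
apply: eq_Rintegral => t _; case: (phi t) => a b /=.
by rewrite cosN sinN mulrN addrC mulNr.
Qed.

Lemma Re_sub (x y : R[i]) : complex.Re (x - y) = complex.Re x - complex.Re y.
Proof. by case: x; case: y. Qed.

Lemma Im_sub (x y : R[i]) : complex.Im (x - y) = complex.Im x - complex.Im y.
Proof. by case: x; case: y. Qed.

(** The density is real, so the real and imaginary parts separate; the second case is the first one
    with the pair [v], [- u] in place of [u], [v]. *)
Lemma fbm_is_structure_factor (h : R) (h0 : 0 < h) (h1 : h < 1)
    d' (T' : measurableType d') (Q : probability T' R)
    (B : R -> T' -> R) (fbmB : fractional_brownian_motion Q h B)
    d (T : measurableType d) (P : probability T R) (xi : T -> config R) :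
  intensity P xi = 1%E -> is_palm P xi Q (perturbed_integers B) ->
  is_structure_factor P xi Q (perturbed_integers B) (fbm_structure_factor h).
Proof.
move=> intxi palmxi; split=> // phi [sRe sIm].
have su := schwartz_smooth_decay sRe; have sv := schwartz_smooth_decay sIm.
have sNu := smooth_decayN su.
split.
  split.
    rewrite (_ : (fun t => _) = EFin \o (fun t => complex.Re (phi t) * fbm_structure_factor h t)).
      by have [] := cvg_fsum_rem_integral h0 h1 su.
    by apply/funext => t; rewrite ReM_complex.
  rewrite (_ : (fun t => _) = EFin \o (fun t => complex.Im (phi t) * fbm_structure_factor h t)).
    by have [] := cvg_fsum_rem_integral h0 h1 sv.
  by apply/funext => t; rewrite ImM_complex.
have cE : Complex (fine (intensity P xi)) 0 = 1 :> R[i] by rewrite intxi.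
have EQ (f : R -> R) (g : R -> R) : f =1 g ->
    \int[Q]_w \int[@counting R R]_(x in perturbed_integers B w) f x - \int[mu]_x f x =
    \int[Q]_w \int[@counting R R]_(x in perturbed_integers B w) g x - \int[mu]_x g x.
  by move=> /funext ->.
apply/eqP; rewrite eq_complex; apply/andP; split; apply/eqP.
- rewrite /bartlett_spectrum /palm_covariance cE mul1r Re_sub.
  transitivity (\int[mu]_t (complex.Re (phi t) * fbm_structure_factor h t)).
    by apply: eq_Rintegral => t _; rewrite ReM_complex.
  rewrite (structure_factor_density h0 h1 fbmB su sv).
  exact: (EQ _ _ (fun x => esym (Re_fourier phi x))).
- rewrite /bartlett_spectrum /palm_covariance cE mul1r Im_sub.
  transitivity (\int[mu]_t (complex.Im (phi t) * fbm_structure_factor h t)).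
    by apply: eq_Rintegral => t _; rewrite ImM_complex.
  rewrite (structure_factor_density h0 h1 fbmB sv sNu).
  exact: (EQ _ _ (fun x => esym (Im_fourier phi x))).
Qed.

End structure_factor.

(** * Second moment of the number of points *)

Section counting_sets.
Context {R : realType}.
Local Notation cnt := (@counting R R).

Lemma counting_ge0 (A : set R) : (0 <= cnt A)%E.
Proof. by rewrite /counting; case: ifP => // _; rewrite lee_fin. Qed.

Lemma counting_le (A B : set R) : A `<=` B -> (cnt A <= cnt B)%E.
Proof.
move=> AB; rewrite /counting; case: asboolP => [Af|Ai]; case: asboolP => [Bf|Bi]; rewrite ?leey//.
  rewrite lee_fin ler_nat; apply: finmap.fsubset_leq_card.
  by rewrite -fset_set_sub.
by exfalso; apply: Ai; apply: sub_finite_set Bf.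
Qed.

Lemma counting_image (f g : R -> R) (A : set R) : cancel f g -> cnt (f @` A) = cnt A.
Proof.
move=> fg; rewrite /counting; case: asboolP => [fAf|fAi]; case: asboolP => [Af|Ai] //.
- by congr (_%:R%:E); rewrite fset_set_image// finmap.card_imfset//; exact: can_inj fg.
- exfalso; apply: Ai; have := finite_image g fAf.
  by rewrite image_comp (_ : g \o f = id) ?image_id//; apply/funext => x /=; rewrite fg.
- by exfalso; apply: fAi; exact: finite_image.
Qed.

(** The extreme points of a finite subset leave room on both sides for rational endpoints. *)
Lemma finite_set_itvoo (a b : R) (A : set R) : finite_set A -> A `<=` `]a, b[%classic ->
  exists p q : rat, [/\ a < ratr p, ratr q < b & A `<=` `[ratr p, ratr q]%classic].
Proof.
move=> Af Aab.
suff [al [be [aal beb H]]] : exists al be : R, [/\ a < al, be < b & A `<=` `[al, be]%classic].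
  have [p] := rat_in_itvoo aal; rewrite in_itv/= => /andP[ap pal].
  have [q] := rat_in_itvoo beb; rewrite in_itv/= => /andP[qbe qb].
  exists p, q; split=> // x /H; rewrite /= !in_itv/= => /andP[x1 x2].
  by rewrite (ltW (lt_le_trans pal x1)) (ltW (le_lt_trans x2 qbe)).
have memE x : (x \in finmap.enum_fset (fset_set A)) = (x \in A) := in_fset_set Af x.
have : forall x, x \in finmap.enum_fset (fset_set A) -> a < x < b.
  by move=> x; rewrite memE inE => /Aab; rewrite /= in_itv.
have AE : A `<=` [set x | x \in finmap.enum_fset (fset_set A)].
  by move=> x Ax /=; rewrite memE inE.
suff {AE} S (s : seq R) : (forall x, x \in s -> a < x < b) ->
    exists al be : R, [/\ a < al, be < b & [set` s] `<=` `[al, be]%classic].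
  by move=> /S[al [be [? ? H]]]; exists al, be; split=> //; exact: subset_trans AE H.
elim: s => [|x s IH] H.
  (* Any two numbers on the right sides of [a] and [b] do for the empty list, even if they are in
     the wrong order. *)
  exists (a + 1), (b - 1); split; rewrite ?ltrDl// ?ltrBlDr ?ltrDl//.
have [|al [be [aal beb sab]]] := IH.
  by move=> y ys; apply: H; rewrite inE ys orbT.
have /andP[ax xb] : a < x < b by apply: H; rewrite inE eqxx.
exists (Num.min al x), (Num.max be x); split.
- by rewrite lt_min aal ax.
- by rewrite gt_max beb xb.
move=> y /=; rewrite inE in_itv/= => /orP[/eqP->|ys].
  by rewrite ge_min le_max lexx !orbT.
have := sab y ys; rewrite /= in_itv/= => /andP[y1 y2].
by rewrite ge_min le_max y1 y2.
Qed.

(** Joint measurability in [(A, t)] of the number of points of [A] in an open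
    interval depending on [t] comes from these rational intervals. *)
Definition rat_itv (k : nat) : rat * rat := odflt (0, 0) (unpickle k).

(** Each finite subset of [A] in the open interval lies in one of the rational closed intervals
    inside it, so the supremum reaches the count, and it is infinite when the set is. *)
Lemma counting_itvoo (a b : R) (A : set R) :
  cnt (A `&` `]a, b[) = esups (fun k => let p := rat_itv k in
    cnt (A `&` `[ratr p.1, ratr p.2]) *
    ((a < ratr p.1) && (ratr p.2 < b))%:R%:E)%E 0%N.
Proof.
set u := (X in esups X); apply/eqP; rewrite eq_le; apply/andP; split; last first.
  apply: ge_ereal_sup => _ [k _ <-]; rewrite /u/=.
  case: (ltP a _) => [ap|_]; last by rewrite mule0 counting_ge0.
  case: (ltP _ b) => [pb|_]; last by rewrite mule0 counting_ge0.
  rewrite mule1; apply: counting_le => x [Ax]; rewrite /= !in_itv/= => /andP[x1 x2]; split=> //.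
  by rewrite (lt_le_trans ap x1) (le_lt_trans x2 pb).
have fin (S : set R) : finite_set S -> S `<=` A `&` `]a, b[ -> (cnt S <= esups u 0%N)%E.
  move=> Sf SA; have [p [q [ap qb H]]] : exists p q : rat,
      [/\ a < ratr p, ratr q < b & S `<=` `[ratr p, ratr q]%classic].
    by apply: finite_set_itvoo => // x /SA[].
  apply: (@le_trans _ _ (u (pickle (p, q)))); last first.
    by apply: ereal_sup_ubound; exists (pickle (p, q)).
  rewrite /u /rat_itv pickleK/= ap qb mule1; apply: counting_le => x Sx; split; last exact: H.
  by have [] := SA x Sx.
have [Af|Ai] := pselect (finite_set (A `&` `]a, b[)); first exact: fin.
rewrite [X in (X <= _)%E]/counting asboolF//.
rewrite leye_eq; apply/eqP/eqyP => M M0.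
have [B BA Bn] := infinite_set_fset (Num.truncn M).+1 Ai.
have Bf := finite_fset B.
apply: le_trans (fin _ Bf BA).
rewrite /counting asboolT// lee_fin set_fsetK.
by apply: (le_trans (ltW (truncnS_gt M))); rewrite ler_nat.
Qed.

Lemma measurable_counting_config (I : set R) : measurable I ->
  measurable_fun setT (fun A : config R => cnt ((A : set R) `&` I)).
Proof.
move=> mI _ V mV; rewrite setTI; apply: sub_sigma_algebra.
by exists I => //; exists V.
Qed.

Lemma measurable_counting_shifted (a b : R) : measurable_fun setT
  (fun z : config R * R => cnt ((z.1 : set R) `&` `]a - z.2, b - z.2[)).
Proof.
rewrite (_ : (fun z => _) = (fun z : config R * R => esups (fun k => let p := rat_itv k in
    (cnt ((z.1 : set R) `&` `[ratr p.1, ratr p.2]) *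
    ((a - z.2 < ratr p.1) && (ratr p.2 < b - z.2))%:R%:E)%E) 0%N)); last first.
  by apply/funext => z; exact: counting_itvoo.
apply: (measurable_fun_esups (f := fun k (z : config R * R) => let p := rat_itv k in
    (cnt ((z.1 : set R) `&` `[ratr p.1, ratr p.2]) *
    ((a - z.2 < ratr p.1) && (ratr p.2 < b - z.2))%:R%:E)%E)) => k.
apply: emeasurable_funM.
  apply: (measurableT_comp (measurable_counting_config _)); last exact: measurable_fst.
  exact: measurable_itv.
apply/measurable_EFinP.
rewrite (_ : (fun z => _) =
  (\1_(`](a - ratr (rat_itv k).1), (b - ratr (rat_itv k).2)[%classic : set R) : R -> R) \o snd).
  apply: measurableT_comp; last exact: measurable_snd.
  by apply: measurable_indic; exact: measurable_itv.
apply/funext => z /=; rewrite indicE; congr (nat_of_bool _)%:R.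
apply/idP/idP => [/andP[x1 x2]|/set_mem].
  by apply/mem_set; rewrite /= in_itv/=; apply/andP; split; lra.
by rewrite /= in_itv/= => /andP[x1 x2]; apply/andP; split; lra.
Qed.

End counting_sets.

Section palm_moments.
Context {R : realType} d (T : measurableType d) (P : probability T R).
Context d' (T' : measurableType d') (Q : probability T' R).
Notation mu := (@lebesgue_measure R).
Local Notation cnt := (@counting R R).
Variables (xi : T -> config R) (xihat : T' -> config R).
Hypotheses (ppxi : point_process xi) (intxi : intensity P xi = 1%E)
  (palmxi : is_palm P xi Q xihat).

Lemma locally_finite_measurable (A : set R) : locally_finite A ->
  measurable (A : set (measurableTypeR R)).
Proof.
move=> Af; have -> : A = \bigcup_n (A `&` `[- n%:R, n%:R]).
  apply/seteqP; split=> [x Ax|x [n _ []//]].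
  exists (Num.truncn `|x|).+1 => //; split=> //.
  by rewrite /= in_itv/= -ler_norml ltW// truncnS_gt.
apply: bigcup_measurable => n _; apply: countable_measurable.
  by move=> t; exact: measurable_set1.
by apply: finite_set_countable; exact: Af.
Qed.

Lemma integral_counting_indic (A I : set R) : locally_finite A -> measurable I ->
  (\int[cnt]_(t in A) (\1_I t)%:E = cnt (A `&` I))%E.
Proof.
move=> Af mI; rewrite integral_indic//; last exact: locally_finite_measurable.
by rewrite setIC.
Qed.

(** The Palm formula for a test function of [t] alone, the indicator of [I]. *)
Lemma palm_mean (I : set R) : measurable I ->
  (\int[P]_w cnt ((xi w : set R) `&` I) = mu I)%E.
Proof.
move=> mI; have [_ _] := palmxi.
pose f (z : config R * R) := ((\1_I z.2 : R)%:E)%E.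
have mf : measurable_fun setT f.
  apply/measurable_EFinP; apply: (measurableT_comp (f := (\1_I : R -> R))).
    exact: measurable_indic.
  exact: measurable_snd.
move=> /(_ f mf (fun z => _)); rewrite /f => /(_ _)/= H.
rewrite (eq_integral (fun w => \int[cnt]_(t in (xi w : set R)) (\1_I t)%:E)%E); last first.
  by move=> w _; rewrite integral_counting_indic//; exact: ppxi.2.
rewrite H; last by move=> z; rewrite lee_fin.
rewrite intxi mul1e (eq_integral (cst (mu I))); last first.
  by move=> w _; rewrite integral_indic// setIT.
by rewrite integral_cst// [X in (_ * X)%E]probability_setT mule1.
Qed.

Lemma counting_shift_config (r t : R) (A : config R) :
  cnt ((shift_config t A : set R) `&` `]- r - t, r - t[) = cnt ((A : set R) `&` `]- r, r[).
Proof.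
rewrite -[RHS](counting_image (f := fun x => x - t) (g := fun x => x + t)); last first.
  by move=> x; rewrite subrK.
congr cnt; apply/seteqP; split=> [_ [[x Ax <-]]|_ [x [Ax H] <-]].
  by rewrite /= in_itv/= !ltrD2r => H; exists x => //; split; rewrite //= in_itv.
split; first by exists x.
by move: H; rewrite /= !in_itv/= !ltrD2r.
Qed.

(** One factor counts a closed interval, the other an open one: the Palm formula needs the second
    jointly measurable in the configuration and the shift, which is established for open intervals.
    The endpoints carry no points almost surely. *)
Lemma palm_second_moment (r : R) :
  (\int[P]_w (cnt ((xi w : set R) `&` `[(- r)%R, r]) *
     cnt ((xi w : set R) `&` `](- r)%R, r[)) =
   \int[Q]_w \int[mu]_t ((\1_(`[(- r)%R, r]%classic : set R) t)%:E *
      cnt ((xihat w : set R) `&` `](- r - t)%R, (r - t)%R[)))%E.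
Proof.
have [_ _] := palmxi.
pose f (z : config R * R) := ((\1_(`[(- r)%R, r]%classic : set R) z.2 : R)%:E *
  cnt ((z.1 : set R) `&` `](- r - z.2)%R, (r - z.2)%R[))%E.
have mf : measurable_fun setT f.
  apply: emeasurable_funM; last exact: measurable_counting_shifted.
  apply/measurable_EFinP; apply: (measurableT_comp (f := (\1_(`[- r, r]%classic : set R) : R -> R))).
    by apply: measurable_indic; exact: measurable_itv.
  exact: measurable_snd.
have f0 z : (0 <= f z)%E by rewrite mule_ge0 ?counting_ge0// lee_fin.
move=> /(_ f mf f0); rewrite intxi mul1e => <-.
apply: eq_integral => w _.
rewrite (eq_integral (fun t => (\1_(`[(- r)%R, r]%classic : set R) t)%:E *
  cnt ((xi w : set R) `&` `](- r)%R, r[))%E); last first.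
  by move=> t _; rewrite /f/= counting_shift_config.
have mxi : measurable (xi w : set (measurableTypeR R)) by apply: locally_finite_measurable; exact: ppxi.2.
rewrite ge0_integralZr//.
- by rewrite (integral_counting_indic (ppxi.2 w)).
- by apply/measurable_EFinP; apply: measurable_funTS; apply: measurable_indic; exact: measurable_itv.
Qed.

End palm_moments.

Section tent.
Context {R : realType}.
Notation mu := (@lebesgue_measure R).

Definition tent (L x : R) : R := Num.max 0 (L - `|x|).

Lemma tent_ge0 L x : 0 <= tent L x. Proof. by rewrite le_max lexx. Qed.

Lemma tent_le L x : 0 <= L -> tent L x <= L.
Proof. by move=> L0; rewrite ge_max L0 gerBl normr_ge0. Qed.

Lemma continuous_tent L : continuous (tent L).
Proof.
move=> x; apply: (@continuous_max R R (cst 0) (fun x => L - `|x|) x); first exact: cvg_cst.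
by apply: cvgB; [exact: cvg_cst|exact: norm_continuous].
Qed.

Lemma measurable_tent L : measurable_fun setT (tent L).
Proof. exact: continuous_measurable_fun (@continuous_tent L). Qed.

Lemma tentN L x : tent L (- x) = tent L x.
Proof. by rewrite /tent normrN. Qed.

(** Up to endpoints, the integrand is the indicator that [t] and [t + x] both lie in the window of
    length [2 r], and such [t] form an interval of length [2 r - |x|] if this is positive. *)
Lemma integral_overlap (r x : R) :
  (\int[mu]_t ((\1_(`[(- r)%R, r]%classic : set R) t)%:E *
     (\1_(`](- r - t)%R, (r - t)%R[%classic : set R) x)%:E) = (tent (2 * r) x)%:E)%E.
Proof.
pose a := Num.max (- r) (- r - x); pose b := Num.min r (r - x).
have E : {ae mu, forall t, ((\1_(`[(- r)%R, r]%classic : set R) t)%:E *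
     (\1_(`](- r - t)%R, (r - t)%R[%classic : set R) x)%:E)%E = (\1_(`]a, b[%classic : set R) t : R)%:E}.
  have [N1 [mN1 N10 HN1]] := ae_neq (- r); have [N2 [mN2 N20 HN2]] := ae_neq r.
  exists (N1 `|` N2); split; first exact: measurableU.
    by apply/eqP; rewrite measureU0//; apply/eqP.
  move=> t Ht; apply: contrapT => /not_orP[H1 H2]; apply: Ht => /=.
  have t1 : t != - r by apply: contrapT => H; apply: H1; exact: HN1.
  have t2 : t != r by apply: contrapT => H; apply: H2; exact: HN2.
  rewrite -EFinM !indicE -natrM mulnb; congr (nat_of_bool _)%:R%:E.
  apply/idP/idP => [/andP[/set_mem + /set_mem]|/set_mem].
    rewrite /= !in_itv/= => /andP[x1 x2] /andP[x3 x4]; apply/mem_set.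
    rewrite /= in_itv/= gt_max lt_min; apply/andP; split; apply/andP; split.
    - by rewrite lt_neqAle eq_sym t1.
    - lra.
    - by rewrite lt_neqAle t2.
    - lra.
  rewrite /= in_itv/= gt_max lt_min => /andP[/andP[x1 x2] /andP[x3 x4]].
  by apply/andP; split; apply/mem_set; rewrite /= in_itv/=; apply/andP; split; lra.
rewrite (eq_integral_null E) integral_indic// ?setIT.
apply: (etrans (lebesgue_measure_itv `]a, b[)); rewrite /= lte_fin /a /b /tent -EFinD.
have [x0|x0] := leP 0 x.
  rewrite (ger0_norm x0) (max_l (_ : - r - x <= - r)) ?gerBl// (min_r (_ : r - x <= r)) ?gerBl//.
  by case: ltP => H; congr EFin; [rewrite max_r; lra|rewrite max_l; lra].
rewrite (ltr0_norm x0) max_r ?min_l; [|lra|lra].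
by case: ltP => H; congr EFin; [rewrite max_r; lra|rewrite max_l; lra].
Qed.

End tent.

Section second_moment.
Context {R : realType} d (T : measurableType d) (P : probability T R).
Context d' (T' : measurableType d') (Q : probability T' R).
Notation mu := (@lebesgue_measure R).
Notation gam := (@normal_prob R 0 1).
Local Notation cnt := (@counting R R).
Variables (h : R) (B : R -> T' -> R).
Hypotheses (h0 : 0 < h) (h1 : h < 1) (fbmB : fractional_brownian_motion Q h B).
Variable xi : T -> config R.
Hypotheses (ppxi : point_process xi) (intxi : intensity P xi = 1%E)
  (palmxi : is_palm P xi Q (perturbed_integers B)).

Lemma counting_range (e : int -> R) (J : set R) : injective e -> measurable J ->
  (cnt (range e `&` J) =
   \big[+%E/0]_(0 <= k <oo) (pairsum (fun n => \1_J (e n)) k)%:E)%E.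
Proof.
move=> ie mJ.
have mD : measurable (range e : set (measurableTypeR R)).
  by rewrite int_pair_bigcup; apply: bigcup_measurable => k _; exact: measurable_int_pair.
rewrite setIC -[LHS](@integral_indic _ _ _ cnt _ mD)//.
rewrite [X in integral _ X]int_pair_bigcup ge0_integral_bigcup//.
- apply: eq_eseriesr => k _.
  by rewrite (ge0_integral_int_pair ie k (f := (\1_J : R -> R)))//; exact: measurable_indic.
- by move=> k; exact: measurable_int_pair.
- by apply/measurable_EFinP; apply: measurable_funTS; exact: measurable_indic.
- exact: trivIset_int_pair.
Qed.

(** The expectation of [tent L (n + B_n)], written with the standard normal law. *)
Definition overlap (L : R) (n : int) : R :=
  \int[gam]_y tent L (n%:~R + `|n%:~R| `^ h * y).

Let itent L n : 0 <= L -> Q.-integrable setT (EFin \o (fun w => tent L (perturbed B w n))).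
Proof.
move=> L0; apply: (integrable_perturbed fbmB n (@measurable_tent R L) (C := L)).
by move=> x; rewrite ger0_norm ?tent_ge0// tent_le.
Qed.

(** For distinct points, the integral over [t] contributes [tent (2 r) (n + B_n)] for each [n];
    nonnegativity permits the exchanges of sums and integrals. *)
Lemma second_moment_series (r : R) : 0 <= r ->
  (\int[P]_w (cnt ((xi w : set R) `&` `[(- r)%R, r]) *
     cnt ((xi w : set R) `&` `](- r)%R, r[)) =
   \big[+%E/0]_(0 <= k <oo) (pairsum (overlap (2 * r)) k)%:E)%E.
Proof.
move=> r0; rewrite (palm_second_moment ppxi intxi palmxi).
have L0 : 0 <= 2 * r by exact: mulr_ge0.
have mJ t : measurable (`](- r - t)%R, (r - t)%R[%classic : set R) by exact: measurable_itv.
have mker (x : R) : measurable_fun setT (fun t : R => (\1_(`](- r - t)%R, (r - t)%R[%classic : set R) x : R)).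
  rewrite (_ : (fun t => _) = \1_(`](- r - x), (r - x)[%classic : set R)).
    by apply: measurable_indic; exact: measurable_itv.
  apply/funext => t; rewrite !indicE; congr (nat_of_bool _)%:R.
  by apply/idP/idP => /set_mem; rewrite /= in_itv/= => /andP[x1 x2]; apply/mem_set; rewrite /= in_itv/=; apply/andP; split; lra.
have mI : measurable_fun setT (fun t => (\1_(`[(- r)%R, r]%classic : set R) t : R)).
  by apply: measurable_indic; exact: measurable_itv.
transitivity (\int[Q]_w \big[+%E/0]_(0 <= k <oo) (pairsum (fun n => tent (2 * r) (perturbed B w n)) k)%:E)%E.
  apply: eq_integral_null; move: (perturbed_inj fbmB); apply: filterS => w inj.
  transitivity (\int[mu]_t \big[+%E/0]_(0 <= k <oo)
     ((\1_(`[(- r)%R, r]%classic : set R) t)%:E *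
      (pairsum (fun n => \1_(`](- r - t)%R, (r - t)%R[%classic : set R) (perturbed B w n)) k)%:E))%E.
    apply: eq_integral => t _; rewrite nneseriesZl; last first.
      by move=> k _; rewrite lee_fin; apply: pairsum_ge0 => n.
    by congr (_ * _)%E; exact: (counting_range inj (mJ t)).
  rewrite integral_nneseries//; last 2 first.
  - move=> k; apply: emeasurable_funM; apply/measurable_EFinP => //.
    by case: k => [|k] /=; [exact: mker|apply: measurable_funD; exact: mker].
  - move=> k t _; apply: mule_ge0; rewrite lee_fin//.
    by apply: pairsum_ge0 => n.
  apply: eq_eseriesr => k _; case: k => [|k] /=; first exact: integral_overlap.
  under eq_integral do rewrite EFinD ge0_muleDr ?lee_fin//.
  rewrite ge0_integralD//; last 2 first.
  - by apply: emeasurable_funM; apply/measurable_EFinP; [exact: mI|exact: mker].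
  - by apply: emeasurable_funM; apply/measurable_EFinP; [exact: mI|exact: mker].
  by rewrite !integral_overlap.
rewrite integral_nneseries//; last 2 first.
- move=> k; apply: (measurable_int Q); case: k => [|k] /=; first exact: itent.
  by apply: (@integrableD_R _ _ T' Q) => //; exact: itent.
- by move=> k w _; rewrite lee_fin; apply: pairsum_ge0 => n; exact: tent_ge0.
have E n : \int[Q]_w tent (2 * r) (perturbed B w n) = overlap (2 * r) n.
  have := fbm_Rlaw fbmB n%:~R (f := fun y => tent (2 * r) (n%:~R + y)); apply.
  by apply: measurableT_comp; [exact: measurable_tent|exact: measurable_funD].
apply: eq_eseriesr => k _.
rewrite -[LHS]fineK; last first.
  apply: integrable_fin_num => //; case: k => [|k] /=; first exact: itent.
  by apply: (@integrableD_R _ _ T' Q) => //; exact: itent.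
congr EFin; case: k => [|k] /=; first by rewrite -E.
by rewrite -!E -RintegralD//; exact: itent.
Qed.

End second_moment.

(** * Sums of tents *)

Section tent_sums.
Context {R : realType}.

Lemma tent_second_difference (L x : R) : 0 <= L ->
  tent L x = (`|x + L| + `|x - L|) / 2 - `|x|.
Proof.
move=> L0; rewrite /tent maxElt.
case: (ger0P x) => ?; case: (ger0P (x + L)) => ?; case: (ger0P (x - L)) => ?;
  by case: ltP => ?; lra.
Qed.

Lemma norm_add_sub (x b : R) : `|x + b| + `|x - b| = 2 * (`|x| + tent `|b| x).
Proof.
rewrite /tent maxElt.
case: (ger0P x) => ?; case: (ger0P b) => ?; case: (ger0P (x + b)) => ?;
  by case: (ger0P (x - b)) => ?; case: ltP => ?; lra.
Qed.

(** [tent L] is a second difference of the absolute value, and second differences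
    with steps [L] and [b] commute. *)
Lemma tent_overlap (L x b : R) : 0 <= L ->
  (tent L (x + b) + tent L (x - b)) / 2 + tent `|b| x =
  tent L x + (tent `|b| (x + L) + tent `|b| (x - L)) / 2.
Proof.
move=> L0; rewrite (tent_second_difference (x + b) L0) (tent_second_difference (x - b) L0).
rewrite (tent_second_difference x L0).
have h1 := norm_add_sub x b; have h2 := norm_add_sub (x + L) b.
have h3 := norm_add_sub (x - L) b.
rewrite [x + b + L]addrAC [x + b - L]addrAC [x - b + L]addrAC [x - b - L]addrAC.
lra.
Qed.

(** The tent vanishes unless [a > |x|], and then the powers of [a / |x|] only increase the bound
    [a]. This converts high Gaussian moments into decay in [x]. *)
Lemma tent_pow_le (a x : R) q : 0 <= a -> 0 < `|x| -> tent a x <= `|x| * (a / `|x|) ^+ q.+1.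
Proof.
move=> a0 x0; have [ax|ax] := leP a `|x|.
  rewrite /tent max_l ?subr_le0// mulr_ge0// exprn_ge0// divr_ge0//.
apply: (@le_trans _ _ a).
  by rewrite /tent ge_max a0 gerBl ltW.
have e1 : 1 <= a / `|x| by rewrite ler_pdivlMr// mul1r ltW.
rewrite -ler_pdivrMl// mulrC exprS ler_peMr ?divr_ge0// ?(ltW x0)//.
exact: exprn_ege1.
Qed.

Lemma tent_le_l (a b x : R) : a <= b -> tent a x <= tent b x.
Proof. by move=> ab; rewrite /tent ge_max !le_max lexx lerB// orbT. Qed.

Lemma tent_le_r (a x y : R) : `|y| <= `|x| -> tent a x <= tent a y.
Proof. by move=> xy; rewrite /tent ge_max !le_max lexx lerB// orbT. Qed.

(** Half of a sum of tents over the nonzero integers. The quadratics [(c - 1/2)^2] and [c^2 - c]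
    that bound [2 D] decrease by exactly [2 (c - 1)] when [c] is replaced by [c - 1], the same
    amount as [2 D] in [DS]. *)
Let D (N : nat) (c : R) : R := \sum_(k < N) Num.max 0 (c - k.+1%:R).

Let DS N c : D N.+1 c = Num.max 0 (c - 1) + D N (c - 1).
Proof.
rewrite /D big_ord_recl; congr (_ + _); apply: eq_bigr => k _.
by congr Num.max; rewrite /bump/= -[(1 + k).+1%:R]natr1 add1n; ring.
Qed.

Let D_lt1 N c : c < 1 -> D N c = 0.
Proof.
move=> c1; rewrite /D big1// => k _; rewrite max_l// subr_le0.
by apply: (le_trans (ltW c1)); rewrite ler1n.
Qed.

Let D_le N c : 0 <= c -> 2 * D N c <= (c - 2^-1) ^+ 2.
Proof.
elim: N c => [|N IH] c c0; first by rewrite /D big_ord0 mulr0 sqr_ge0.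
have [c1|c1] := ltP c 1; first by rewrite D_lt1// mulr0 sqr_ge0.
have c10 : 0 <= c - 1 by rewrite subr_ge0.
rewrite DS max_r// mulrDr; have := IH _ c10; nra.
Qed.

Let D_ge N c : 0 <= c -> c <= N.+1%:R -> c ^+ 2 - c <= 2 * D N c.
Proof.
elim: N c => [|N IH] c c0 cN.
  by rewrite /D big_ord0 mulr0; nra.
have [c1|c1] := ltP c 1; first by rewrite D_lt1// mulr0; nra.
have c10 : 0 <= c - 1 by rewrite subr_ge0.
have cN' : c - 1 <= N.+1%:R by rewrite lerBlDr natr1.
rewrite DS max_r// mulrDr; have := IH _ c10 cN'; nra.
Qed.

Let symsum_tent (c : R) N : 0 <= c -> symsum (fun n => tent c n%:~R) N = c + 2 * D N c.
Proof.
move=> c0; elim: N => [|N IH].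
  by rewrite symsum0 /D big_ord0 mulr0 addr0 /tent normr0 subr0 max_r.
rewrite symsumS IH /D big_ord_recr/= mulrDr -addrA; congr (_ + (_ + _)).
rewrite mulrNz tentN /tent (ger0_norm (_ : 0 <= N.+1%:~R)) ?ler0n//.
by rewrite mulr_natl mulr2n.
Qed.

(** The value [c^2] is the integral of the tent; the sum over the integers exceeds it by at most a
    bounded amount. The variance subtracts exactly this square. *)
Lemma symsum_tent_le (c : R) N : 0 <= c -> symsum (fun n => tent c n%:~R) N <= c ^+ 2 + 1.
Proof. by move=> c0; rewrite symsum_tent//; have := D_le N c0; nra. Qed.

Lemma symsum_tent_ge (c : R) N : 0 <= c -> c <= N.+1%:R -> c ^+ 2 <= symsum (fun n => tent c n%:~R) N.
Proof. by move=> c0 cN; rewrite symsum_tent//; have := D_ge c0 cN; lra. Qed.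

Lemma symsum_shift_le (f : int -> R) m N : (forall n, 0 <= f n) ->
  symsum (fun n => f (n - m%:Z)) N <= symsum f (N + m).
Proof.
elim: m f N => [|m IH] f N f0.
  by rewrite addn0 le_eqVlt; apply/orP; left; apply/eqP; apply: eq_bigr => k _; rewrite subr0.
apply: (@le_trans _ _ (symsum (fun n => f (n - 1)) (N + m))).
  apply: le_trans (IH (fun n => f (n - 1)) N _) => //.
  rewrite le_eqVlt; apply/orP; left; apply/eqP; apply: eq_bigr => k _.
  by congr f; lia.
rewrite addnS /symsum doubleS [in leRHS]big_ord_recr [in leRHS]big_ord_recr/= -addrA.
apply: (@le_trans _ _ (\sum_(i < (N + m).*2.+1) f (i%:Z - (N + m).+1%:Z))).
  by rewrite le_eqVlt; apply/orP; left; apply/eqP; apply: eq_bigr => k _; congr f; lia.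
by rewrite lerDl addr_ge0.
Qed.

Lemma symsum_le f g N : (forall n, f n <= g n) -> symsum f N <= symsum g N :> R.
Proof. by move=> fg; apply: ler_sum. Qed.

Lemma symsumD (f g : int -> R) N : symsum (fun n => f n + g n) N = symsum f N + symsum g N.
Proof. exact: big_split. Qed.

Lemma symsumZ (c : R) (f : int -> R) N : symsum (fun n => c * f n) N = c * symsum f N.
Proof. by rewrite /symsum mulr_sumr. Qed.

Lemma symsumN (f : int -> R) N : symsum (fun n => f (- n)) N = symsum f N.
Proof.
rewrite !symsumE; apply: eq_bigr => -[[|k] /= _] _; first by rewrite oppr0.
by rewrite opprK addrC.
Qed.

(** [L] is replaced by its integer part, which a tent higher by [1] compensates; an integer shift is
    then absorbed by enlarging the range of summation. *)
Lemma symsum_tent_shift_le (a L : R) N : 0 <= a -> 0 <= L ->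
  symsum (fun n => tent a (n%:~R - L)) N <= (a + 1) ^+ 2 + 1.
Proof.
move=> a0 L0; pose m := Num.truncn L.
have /andP[mL Lm] := truncn_itv L0.
apply: (@le_trans _ _ (symsum (fun n => tent (a + 1) (n - m%:Z)%:~R) N)).
  apply: symsum_le => n; rewrite /tent ge_max !le_max lexx/=.
  apply/orP; right; rewrite lerBlDr -addrA -lerBlDl.
  have -> : (n - m%:Z)%:~R = (n%:~R - L) + (L - m%:R) :> R.
    by rewrite intrB addrA subrK.
  have := ler_normD (n%:~R - L) (L - m%:R).
  have : `|L - m%:R| <= 1.
    by rewrite ger0_norm ?subr_ge0// lerBlDr addrC natr1 ltW.
  by move: (`|_|) (`|_|) (`|_|) => x y z; lra.
apply: (le_trans (symsum_shift_le (f := fun n => tent (a + 1) n%:~R) m N _)).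
  by move=> n; exact: tent_ge0.
by apply: symsum_tent_le; rewrite addr_ge0.
Qed.

Lemma Rintegral_symsum d (T : measurableType d) (m : {measure set T -> \bar R})
    (f : int -> T -> R) N : (forall n, m.-integrable setT (EFin \o f n)) ->
  m.-integrable setT (EFin \o (fun x => symsum (f ^~ x) N)) /\
  \int[m]_x symsum (f ^~ x) N = symsum (fun n => \int[m]_x f n x) N.
Proof.
move=> fi; elim: N => [|N [IHi IH]].
  rewrite symsum0 (_ : (fun x => _) = f 0)//.
  by apply/funext => x; rewrite symsum0.
have i2 : m.-integrable setT (EFin \o (fun x => f N.+1%:Z x + f (- N.+1%:Z) x)).
  exact: integrableD_R.
rewrite symsumS (_ : (fun x => _) = (fun x => symsum (f ^~ x) N + (f N.+1%:Z x + f (- N.+1%:Z) x))).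
  split; first exact: integrableD_R.
  by rewrite RintegralD// IH RintegralD.
by apply/funext => x; rewrite symsumS.
Qed.

End tent_sums.

Section gauss_tent.
Context {R : realType}.
Notation gam := (@normal_prob R 0 1).
Notation mu := (@lebesgue_measure R).

Lemma integrable_gauss_pow k : gam.-integrable setT (EFin \o (fun y : R => y ^+ k)).
Proof.
apply: integrable_gauss; first exact: measurable_funX.
exact: integrable_gauss_density_pow.
Qed.

Lemma gauss_second_moment : \int[gam]_y (y ^+ 2) = 1 :> R.
Proof. by rewrite Rintegral_gauss ?gauss_variance//; exact: measurable_funX. Qed.

Lemma Rintegral_gauss_opp (f : R -> R) : measurable_fun setT f ->
  \int[gam]_y f y = \int[gam]_y f (- y).
Proof.
move=> mf; have mf' : measurable_fun setT (fun y : R => f (- y)).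
  exact: (measurableT_comp mf (@oppr_measurable R setT)).
rewrite !Rintegral_gauss// /Rintegral; congr fine; rewrite integral_opp.
  by apply: eq_integral => y _; rewrite gauss_density_opp.
by apply/measurable_EFinP; apply: measurable_funM => //; exact: measurable_gauss_density.
Qed.

Lemma integrable_gauss_cst (c : R) : gam.-integrable setT (EFin \o (fun _ : R => c)).
Proof. exact: finite_measure_integrable_cst. Qed.

Lemma Rintegral_gauss_cst (c : R) : \int[gam]_y c = c.
Proof. by rewrite Rintegral_cst//= [X in fine X]probability_setT mulr1. Qed.

Lemma integrable_gauss_norm : gam.-integrable setT (EFin \o (fun y : R => `|y|)).
Proof.
apply: (@le_integrable_R _ _ _ gam _ _ (fun y : R => 1 + y ^+ 2)) => //.
- exact: normr_measurable.
- by move=> y _; rewrite normr_id; case: (ger0P y) => ?; nra.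
- apply: integrableD_R => //; first exact: integrable_gauss_cst.
  exact: integrable_gauss_pow.
Qed.

Lemma gauss_norm_gt0 : 0 < \int[gam]_y `|y|.
Proof.
have [m4 m4E] : exists m4, m4 = \int[gam]_y (y ^+ 4) by eexists.
have m40 : 0 <= m4 by rewrite m4E; apply: Rintegral_ge0 => y _; exact: exprn_even_ge0.
(* [e y^2 - e^3 y^4 <= |y|] for every [e > 0]; a small [e] makes the left mean positive. *)
have [e eE] : exists e, e = (1 + m4)^-1 by eexists.
have e0 : 0 < e by rewrite eE invr_gt0 ltr_wpDr.
have em : e * (1 + m4) = 1 by rewrite eE mulVf// gt_eqF// ltr_wpDr.
have i2 := integrableZ_R measurableT e (integrable_gauss_pow 2).
have i4 := integrableZ_R measurableT (- e ^+ 3) (integrable_gauss_pow 4).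
have : \int[gam]_y (e * y ^+ 2 + - e ^+ 3 * y ^+ 4) <= \int[gam]_y `|y|.
  apply: le_Rintegral => //; [exact: integrableD_R|exact: integrable_gauss_norm|].
  move=> y _; rewrite -(real_normK (num_real y)) (_ : y ^+ 4 = `|y| ^+ 4); last first.
    by rewrite (exprM y 2 2) -(real_normK (num_real y)) -exprM.
  have : 0 <= e * `|y| by rewrite mulr_ge0// ltW.
  move: `|y| => u eu; rewrite -(ler_pM2l e0) (_ : e * (e * u ^+ 2 + _) = (e * u) ^+ 2 - (e * u) ^+ 4); last by ring.
  move: (e * u) eu => v v0.
  by have [v1|v1] := leP v 1; nra.
rewrite RintegralD//; rewrite RintegralZl ?RintegralZl//; [|exact: integrable_gauss_pow..].
rewrite gauss_second_moment -m4E; apply: lt_le_trans.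
have -> : e * 1 + - e ^+ 3 * m4 = e - e ^+ 2 * (e * m4) by ring.
have -> : e * m4 = 1 - e by rewrite -em; ring.
by nra.
Qed.

(** For [a >= 0], the mean of the excess of [|a Y|] over [|x|], with [Y] standard normal. *)
Definition gauss_tent (a x : R) : R := \int[gam]_y tent (a * `|y|) x.

Lemma integrable_gauss_tent (a x : R) : 0 <= a ->
  gam.-integrable setT (EFin \o (fun y => tent (a * `|y|) x)).
Proof.
move=> a0; apply: (@le_integrable_R _ _ _ gam _ _ (fun y => a * `|y|)) => //.
- apply: measurable_maxr => //; apply: measurable_funB => //.
  by apply: measurable_funM => //; exact: normr_measurable.
- by move=> y _; rewrite ger0_norm ?tent_ge0// tent_le// mulr_ge0.
- by apply: integrableZ_R => //; exact: integrable_gauss_norm.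
Qed.

Lemma gauss_tent_ge0 (a x : R) : 0 <= gauss_tent a x.
Proof. by apply: Rintegral_ge0 => y _; exact: tent_ge0. Qed.

Lemma gauss_tent_le_l (a b x : R) : 0 <= a -> a <= b -> gauss_tent a x <= gauss_tent b x.
Proof.
move=> a0 ab; have b0 := le_trans a0 ab; apply: le_Rintegral => //.
- exact: integrable_gauss_tent.
- exact: integrable_gauss_tent.
- by move=> y _; apply: tent_le_l; rewrite ler_wpM2r.
Qed.

Lemma gauss_tent_le_r (a x y : R) : 0 <= a -> `|y| <= `|x| ->
  gauss_tent a x <= gauss_tent a y.
Proof.
move=> a0 xy; apply: le_Rintegral => //.
- exact: integrable_gauss_tent.
- exact: integrable_gauss_tent.
- by move=> z _; exact: tent_le_r.
Qed.

Lemma gauss_tentN (a x : R) : gauss_tent a (- x) = gauss_tent a x.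
Proof. by apply: eq_Rintegral => y _; rewrite tentN. Qed.

Lemma gauss_tent_ge (a x : R) : 0 <= a ->
  a * \int[gam]_y `|y| - `|x| <= gauss_tent a x.
Proof.
move=> a0; have i1 := integrableZ_R measurableT a integrable_gauss_norm.
rewrite -RintegralZl//; last exact: integrable_gauss_norm.
rewrite -[X in _ - X]Rintegral_gauss_cst -RintegralB//; last exact: integrable_gauss_cst.
apply: le_Rintegral => //.
- by apply: integrableB_R => //; exact: integrable_gauss_cst.
- exact: integrable_gauss_tent.
- by move=> y _; rewrite /tent le_max lexx orbT.
Qed.

Lemma gauss_tent_overlap (L x a : R) : 0 <= L -> 0 <= a ->
  \int[gam]_y tent L (x + a * y) + gauss_tent a x =
  tent L x + (gauss_tent a (x + L) + gauss_tent a (x - L)) / 2.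
Proof.
move=> L0 a0; pose f y := tent L (x + a * y).
have mf : measurable_fun setT f.
  apply: measurableT_comp; first exact: measurable_tent.
  by apply: measurable_funD => //; exact: measurable_funM.
have mf' : measurable_fun setT (fun y : R => f (- y)).
  exact: (measurableT_comp mf (@oppr_measurable R setT)).
have f_le y : `|f y| <= L by rewrite ger0_norm ?tent_ge0// tent_le.
have i1 : gam.-integrable setT (EFin \o f) by exact: (bounded_integrable gam mf f_le).
have i2 : gam.-integrable setT (EFin \o (fun y : R => f (- y))).
  by apply: (bounded_integrable gam mf') => y; exact: f_le.
have i3 b : gam.-integrable setT (EFin \o (fun y => tent (a * `|y|) b)).
  exact: integrable_gauss_tent.
have i4 := integrableZ_R measurableT 2 (i3 x).
have i5 := integrableD_R measurableT (i3 (x + L)) (i3 (x - L)).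
have : \int[gam]_y ((f y + f (- y)) + 2 * tent (a * `|y|) x) =
    \int[gam]_y (2 * tent L x + (tent (a * `|y|) (x + L) + tent (a * `|y|) (x - L))).
  apply: eq_Rintegral => y _; have := tent_overlap x (a * y) L0.
  by rewrite normrM (ger0_norm a0) /f mulrN; lra.
rewrite RintegralD//; last exact: integrableD_R.
rewrite RintegralD// RintegralZl// RintegralD//; last exact: integrable_gauss_cst.
rewrite RintegralD// Rintegral_gauss_cst -(Rintegral_gauss_opp mf) -!/(gauss_tent _ _).
by rewrite -/f; lra.
Qed.

End gauss_tent.

Section overlap_sums.
Context {R : realType}.
Notation gam := (@normal_prob R 0 1).
Variable h : R.
Hypotheses (h0 : 0 < h) (h1 : h < 1).

Local Notation scale := (fun n : int => `|n%:~R : R| `^ h).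

(** An identity for every [N], by averaging [tent_overlap]; the symmetry [n |-> - n] merges the
    terms centred at [L] and [- L]. The sum centred at [0] is bounded, so the sum centred at [L]
    decides the growth of the variance. *)
Lemma symsum_overlap (L : R) N : 0 <= L ->
  symsum (overlap h L) N + symsum (fun n => gauss_tent (scale n) n%:~R) N =
  symsum (fun n => tent L n%:~R) N +
  symsum (fun n => gauss_tent (scale n) (n%:~R - L)) N.
Proof.
move=> L0; rewrite -symsumD.
transitivity (symsum (fun n => tent L n%:~R + 2^-1 * (gauss_tent (scale n) (n%:~R + L) +
    gauss_tent (scale n) (n%:~R - L))) N).
  apply: eq_bigr => k _.
  by rewrite /overlap gauss_tent_overlap ?powR_ge0// [2^-1 * _]mulrC.
rewrite symsumD symsumZ symsumD -(symsumN (fun n => gauss_tent (scale n) (n%:~R + L))).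
have -> : symsum (fun n => gauss_tent (scale (- n)) ((- n)%:~R + L)) N =
    symsum (fun n => gauss_tent (scale n) (n%:~R - L)) N.
  apply: eq_bigr => k _; move: (_ - _) => n.
  by rewrite mulrNz normrN -gauss_tentN opprD opprK.
by lra.
Qed.

(** The height [|n| `^ h * |y|] exceeds [|n| / 2] only when [|y|] is large, so that
    a Gaussian moment of order [3 / (1 - h)] makes the sum converge. *)
Lemma symsum_gauss_tent_half : exists2 K : R, 0 <= K &
  forall N, symsum (fun n => gauss_tent (scale n) (n%:~R / 2)) N <= K.
Proof.
have h10 : 0 < 1 - h by rewrite subr_gt0.
(* The bound on the term of index [n] is of order [n * n^(- 2 (p + 1) (1 - h))], which this [p]
   makes at most of order [n^(- 2)]. *)
have [p Hp] : exists p : nat, 3 <= 2 * (p.+1%:R) * (1 - h).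
  exists (Num.truncn (3 / (1 - h))).
  have := truncnS_gt (3 / (1 - h)); rewrite ltr_pdivrMr//; lra.
have [M ME] : exists M, M = \int[gam]_y (y ^+ p.+1.*2) by eexists.
have M0 : 0 <= M by rewrite ME; apply: Rintegral_ge0 => y _; rewrite exprn_even_ge0// odd_double.
have [C CE] : exists C : R, C = 2 ^+ p.+1.*2 * M by eexists.
have C0 : 0 <= C by rewrite CE mulr_ge0// exprn_ge0.
have H (k : nat) : gauss_tent (k.+1%:R `^ h) (k.+1%:R / 2) <= C * k.+1%:R `^ (- 1 - 1).
  have k0 : 0 < k.+1%:R :> R by rewrite ltr0n.
  have x0 : 0 < `|k.+1%:R / 2| :> R by rewrite normr_gt0 gt_eqF// divr_gt0.
  apply: (@le_trans _ _ (\int[gam]_y ((k.+1%:R / 2 * (2 * k.+1%:R `^ (h - 1)) ^+ p.+1.*2) * y ^+ p.+1.*2))).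
    apply: le_Rintegral => //.
    - by apply: integrable_gauss_tent; rewrite powR_ge0.
    - by apply: integrableZ_R => //; exact: integrable_gauss_pow.
    move=> y _; apply: (le_trans (tent_pow_le p.*2.+1 _ x0)); first by rewrite mulr_ge0 ?powR_ge0.
    rewrite -doubleS ger0_norm ?divr_ge0// -[leRHS]mulrA; apply: ler_wpM2l; first by rewrite divr_ge0.
    have -> : k.+1%:R `^ h * `|y| / (k.+1%:R / 2) = 2 * k.+1%:R `^ (h - 1) * `|y|.
      rewrite powRB ?(gt_eqF k0) ?implybT// powRr1 ?ltW// invf_div; field; exact: lt0r_neq0.
    by rewrite exprMn -[p.+1.*2]mul2n [_ ^+ (2 * p.+1) in X in _ <= _ * X]exprM [`|y| ^+ _]exprM (real_normK (num_real y)).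
  rewrite RintegralZl// -?ME; last exact: integrable_gauss_pow.
  rewrite exprMn -(powR_mulrn _ (powR_ge0 _ _)) -powRrM.
  apply: (@le_trans _ _ (C * (k.+1%:R * k.+1%:R `^ ((h - 1) * p.+1.*2%:R)))).
    rewrite CE; have := powR_ge0 k.+1%:R ((h - 1) * p.+1.*2%:R : R).
    move: (_ `^ _) => q q0; have : 0 <= C * (k.+1%:R * q) by apply: mulr_ge0 => //; exact: mulr_ge0.
    rewrite CE.
    by lra.
  apply: ler_wpM2l => //; rewrite -{1}[k.+1%:R]powRr1 ?(ltW k0)// -powRD; last by rewrite (gt_eqF k0) implybT.
  apply: ler_powR; first by rewrite ler1n.
  by rewrite -mul2n natrM; lra.
exists (2 * C * (1 + 1^-1)); first by rewrite mulr_ge0// mulr_ge0.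
move=> N; rewrite symsumE big_ord_recl/= mulr0z normr0 powR0 ?gt_eqF// mul0r.
have -> : gauss_tent 0 0 = 0 :> R.
  rewrite /gauss_tent -[RHS](Rintegral_gauss_cst 0); apply: eq_Rintegral => y _.
  by rewrite mul0r /tent normr0 subrr maxxx.
rewrite add0r; apply: le_trans (ler_wpM2l _ (psum_powR_le N ltr01)); last exact: mulr_ge0.
rewrite mulr_sumr; apply: ler_sum => k _.
rewrite /bump/= add0n mulrNz normrN mulNr gauss_tentN.
have -> : (k.+1%:Z)%:~R = k.+1%:R :> R by [].
rewrite ger0_norm//; have := H k; lra.
Qed.

(** For [|n| <= 2 L] all scales are at most [(2 L)^h]; for larger [|n|] one has
    [|n - L| >= |n| / 2], and the summable tail applies. *)
Lemma symsum_overlap_le : exists K : R, forall (L : R) N, 0 <= L ->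
  symsum (overlap h L) N <= L ^+ 2 + 2 * (2 * L) `^ h ^+ 2 + K.
Proof.
have [K K0 HK] := symsum_gauss_tent_half; exists (4 + K) => L N L0.
have [s sE] : exists s, s = (2 * L) `^ h by eexists.
have s0 : 0 <= s by rewrite sE powR_ge0.
have H1 : symsum (fun n => gauss_tent (scale n) (n%:~R - L)) N <=
    symsum (fun n => gauss_tent s (n%:~R - L)) N +
    symsum (fun n => gauss_tent (scale n) (n%:~R / 2)) N.
  rewrite -symsumD; apply: symsum_le => n.
  have [nL|nL] := leP `|n%:~R| (2 * L).
    rewrite ler_wpDr ?gauss_tent_ge0//; apply: gauss_tent_le_l; first exact: powR_ge0.
    by rewrite sE; apply: ge0_ler_powR; rewrite ?nnegrE ?mulr_ge0// ltW.
  rewrite ler_wpDl ?gauss_tent_ge0//; apply: gauss_tent_le_r; first exact: powR_ge0.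
  rewrite normrM [`|2^-1|]ger0_norm//.
  have := lerB_dist (n%:~R : R) L; rewrite (ger0_norm L0); lra.
have H2 : symsum (fun n => gauss_tent s (n%:~R - L)) N <= 2 * s ^+ 2 + 3.
  (* The sum is taken before the mean: for fixed [y] it is a sum of tents of equal height [s |y|],
     of order [s^2 y^2], and [y^2] has mean [1]. *)
  have [i1 <-] := Rintegral_symsum (m := gam) (f := fun n (y : R) => tent (s * `|y|) (n%:~R - L)) N
    (fun n => integrable_gauss_tent (n%:~R - L) s0).
  have i2 := integrableZ_R measurableT (2 * s ^+ 2) (integrable_gauss_pow 2).
  apply: (@le_trans _ _ (\int[gam]_y (2 * s ^+ 2 * y ^+ 2 + 3))).
    apply: le_Rintegral => //; first by apply: integrableD_R => //; exact: integrable_gauss_cst.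
    move=> y _; apply: (le_trans (symsum_tent_shift_le N _ L0)); first exact: mulr_ge0.
    rewrite -(real_normK (num_real y)); move: (`|y|) => u.
    by have := sqr_ge0 (s * u - 1); lra.
  rewrite RintegralD//; last exact: integrable_gauss_cst.
  by rewrite RintegralZl ?gauss_second_moment ?Rintegral_gauss_cst ?mulr1//; exact: integrable_gauss_pow.
have H3 : 0 <= symsum (fun n => gauss_tent (scale n) n%:~R) N.
  by apply: sumr_ge0 => k _; exact: gauss_tent_ge0.
have := symsum_overlap N L0; have := symsum_tent_le N L0; have := HK N.
rewrite -sE; lra.
Qed.

(** The tents around [L] of the about [c * L `^ h] integers following [L] have mean
    at least [c * L `^ h] each. *)
Lemma symsum_overlap_ge : 2^-1 <= h -> exists c K L0 : R, [/\ 0 < c, 0 < L0 &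
  forall L : R, L0 <= L -> exists N, L ^+ 2 + c * L - K <= symsum (overlap h L) N].
Proof.
move=> h2; have [K K0 HK] := symsum_gauss_tent_half.
(* Half of the mean of [|Y|]: at distance at most [c S] from [L] the mean tent is at least
   [2 c S - c S]. *)
have [c cE] : exists c, c = (\int[gam]_y `|y|) / 2 by eexists.
have c0 : 0 < c by rewrite cE divr_gt0// gauss_norm_gt0.
(* The threshold ensures [L >= 1] and, through [S^2 >= L], also [c S >= 2]; truncating [c S] to an
   integer then loses at most half of it. *)
exists (c ^+ 2 / 2), K, (1 + (2 / c) ^+ 2); split.
- by rewrite divr_gt0// exprn_gt0.
- by rewrite ltr_wpDr// sqr_ge0.
move=> L HL; have L1 : 1 <= L by apply: le_trans HL; rewrite lerDl sqr_ge0.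
have L0 : 0 <= L by exact: le_trans L1.
have [S SE] : exists S, S = L `^ h by eexists.
have S0 : 0 <= S by rewrite SE powR_ge0.
have SL : L <= S ^+ 2.
  rewrite SE -powR_mulrn ?powR_ge0// -powRrM -{1}[L]powRr1//; apply: ler_powR => //; lra.
have cS : 2 <= c * S.
  rewrite mulrC -ler_pdivrMr//; rewrite -(@ler_pXn2r _ 2)// ?nnegrE ?divr_ge0// ?(ltW c0)//.
  by apply: le_trans SL; apply: le_trans HL; rewrite lerDr.
(* [m] is the first integer beyond [L], and the [J] integers from [m] on lie within distance [c S]
   of [L]. *)
pose m := (Num.truncn L).+1; pose J := Num.truncn (c * S).
have cS0 : 0 <= c * S by exact: le_trans cS.
have /andP[mL Lm] := truncn_itv L0; have /andP[JS SJ] := truncn_itv cS0.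
exists (m + J)%N.
have T1 := symsum_overlap (m + J) L0.
have T2 : L ^+ 2 <= symsum (fun n => tent L n%:~R) (m + J).
  apply: symsum_tent_ge => //; apply: (le_trans (ltW Lm)).
  by rewrite ler_nat /m ltnS ltnW// ltnS leq_addr.
have T3 : symsum (fun n => gauss_tent (scale n) n%:~R) (m + J) <= K.
  apply: le_trans (HK (m + J)%N); apply: symsum_le => n.
  apply: gauss_tent_le_r; first exact: powR_ge0.
  by rewrite normrM [`|2^-1|]ger0_norm//; have := normr_ge0 (n%:~R : R); lra.
have T4 : (c * S) *+ J <= symsum (fun n => gauss_tent (scale n) (n%:~R - L)) (m + J).
  pose g (n : int) := gauss_tent (scale n) (n%:~R - L).
  have g0 n : 0 <= g n by exact: gauss_tent_ge0.
  apply: (@le_trans _ _ (\sum_(m <= k < m + J) g k%:Z)).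
    rewrite -[in leLHS](addKn m J) -sumr_const_nat; apply: ler_sum_nat => k /andP[mk kJ].
    have Lk : L <= k%:R by apply: (le_trans (ltW Lm)); rewrite ler_nat.
    have kL : k%:R - L <= c * S.
      apply: le_trans JS; rewrite lerBlDr.
      apply: (@le_trans _ _ (J%:R + (Num.truncn L)%:R)); last by rewrite lerD2l.
      by rewrite -natrD ler_nat addnC -ltnS -addSn.
    apply: le_trans (gauss_tent_ge _ (powR_ge0 _ _)).
    have -> : (k%:Z)%:~R = k%:R :> R by [].
    rewrite (ger0_norm (ler0n _ k)) ger0_norm ?subr_ge0//.
    have : S <= k%:R `^ h by rewrite SE; apply: ge0_ler_powR; rewrite ?nnegrE// ltW.
    have -> : \int[gam]_y `|y| = 2 * c by rewrite cE mulrC divfK.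
    by move: (_ `^ _) => q Sq; nra.
  rewrite symsumE -(big_mkord xpredT (pairsum g)) [leRHS](@big_cat_nat _ _ _ m)//=; last first.
    by rewrite -addnS leq_addr.
  rewrite ler_wpDl ?sumr_ge0// => [k _|]; first exact: pairsum_ge0.
  apply: (@le_trans _ _ (\sum_(m <= k < m + J) pairsum g k)); last first.
    by rewrite [leRHS]big_nat_recr ?leq_addr// lerDl; exact: pairsum_ge0.
  apply: ler_sum => -[|k] _ //=.
  by rewrite lerDl.
have T5 : c ^+ 2 / 2 * L <= (c * S) *+ J.
  rewrite -[leRHS]mulr_natr [leLHS]mulrAC; have : c * S - 1 <= J%:R by rewrite lerBlDr natr1 ltW.
  have : c ^+ 2 * L <= (c * S) ^+ 2 by rewrite exprMn ler_wpM2l// sqr_ge0.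
  move: (c * S) cS (J%:R) (c ^+ 2 * L) => x x2 j q q1 q2.
  by nra.
lra.
Qed.

End overlap_sums.

(** * Number variance *)

Section number_variance.
Context {R : realType} d (T : measurableType d) (P : probability T R).
Context d' (T' : measurableType d') (Q : probability T' R).
Notation mu := (@lebesgue_measure R).
Local Notation cnt := (@counting R R).
Variables (h : R) (B : R -> T' -> R).
Hypotheses (h0 : 0 < h) (h1 : h < 1) (fbmB : fractional_brownian_motion Q h B).
Variable xi : T -> config R.
Hypotheses (ppxi : point_process xi) (intxi : intensity P xi = 1%E)
  (palmxi : is_palm P xi Q (perturbed_integers B)).

Let counting_fin w (r : R) :
  cnt ((xi w : set R) `&` `[(- r)%R, r]) = (num_points xi `[(- r)%R, r] w)%:E.
Proof.
rewrite /num_points fineK// /counting; case: asboolP => // H.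
by exfalso; apply: H; exact: (ppxi.2 w).
Qed.

Lemma measurable_num_points (r : R) : measurable_fun setT (num_points xi `[(- r)%R, r]).
Proof.
apply/measurable_EFinP.
rewrite (_ : _ \o _ = (fun A : config R => cnt ((A : set R) `&` `[(- r)%R, r])) \o xi).
  by apply: measurableT_comp; [exact: measurable_counting_config|exact: ppxi.1].
by apply/funext => w /=; rewrite counting_fin.
Qed.

Lemma ae_counting_null (I : set R) : measurable I -> mu I = 0%E ->
  {ae P, forall w, cnt ((xi w : set R) `&` I) = 0%E}.
Proof.
move=> mI I0; have mf : measurable_fun setT (fun w => cnt ((xi w : set R) `&` I)).
  apply: (measurableT_comp (measurable_counting_config mI)); exact: ppxi.1.
have := palm_mean ppxi intxi palmxi mI; rewrite I0 => H.
have /ae_eq_integral_abs : (\int[P]_w `|cnt ((xi w : set R) `&` I)| = 0)%E.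
  by rewrite -H; apply: eq_integral => w _; rewrite gee0_abs// counting_ge0.
by move=> /(_ measurableT mf); apply: filterS => w /(_ Logic.I).
Qed.

(** The mean number of points in the two endpoints is their Lebesgue measure, which is zero. *)
Lemma ae_counting_closed_open (r : R) :
  {ae P, forall w, cnt ((xi w : set R) `&` `](- r)%R, r[) = (num_points xi `[(- r)%R, r] w)%:E}.
Proof.
have mI : measurable ([set - r; r] : set R) by exact: measurableU.
have I0 : mu [set - r; r] = 0%E.
  by rewrite measureU0//= lebesgue_measure_set1.
have := ae_counting_null mI I0; apply: filterS => w H.
rewrite -counting_fin; congr cnt; apply/seteqP; split => x [xx]; rewrite /= !in_itv/= => /andP[x1 x2].
  by split=> //; rewrite !ltW.
have xI : ~ ([set - r; r] x).
  move=> Ix; have := counting_le (A := [set x]) (B := (xi w : set R) `&` [set - r; r]).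
  rewrite H /counting asboolT// fset_set1 finmap.cardfs1 lee_fin ler10 => F.
  by suff : false by []; apply: F => _ ->.
split=> //; rewrite !lt_neqAle x1 x2 !andbT; apply/andP; split; apply/eqP => E; apply: xI.
  by left.
by right.
Qed.

Lemma integral_num_points (r : R) : 0 <= r ->
  (\int[P]_w (num_points xi `[(- r)%R, r] w)%:E = (2 * r)%:E)%E.
Proof.
move=> r0; transitivity (\int[P]_w cnt ((xi w : set R) `&` `[(- r)%R, r]))%E.
  by apply: eq_integral => w _; rewrite counting_fin.
rewrite (palm_mean ppxi intxi palmxi)//; apply: (etrans (lebesgue_measure_itv _)).
rewrite /= lte_fin; case: ltP => H; first by rewrite -EFinD; congr EFin; lra.
by congr EFin; lra.
Qed.

Lemma num_points_second_moment (r : R) : 0 <= r ->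
  (\int[P]_w (num_points xi `[(- r)%R, r] w ^+ 2)%:E =
   \big[+%E/0]_(0 <= k <oo) (pairsum (overlap h (2 * r)) k)%:E)%E.
Proof.
move=> r0; rewrite -(second_moment_series fbmB ppxi intxi palmxi r0).
apply: eq_integral_null; have := ae_counting_closed_open r; apply: filterS => w H.
by rewrite counting_fin H -EFinM expr2.
Qed.

Lemma num_points_variance (r s : R) : 0 <= r ->
  (\int[P]_w (num_points xi `[(- r)%R, r] w ^+ 2)%:E = s%:E)%E ->
  'V_P[num_points xi `[(- r)%R, r]] = (s - (2 * r) ^+ 2)%:E.
Proof.
move=> r0 sE; set X := num_points xi _ in sE *.
have mX : measurable_fun setT X := measurable_num_points r.
have X0 w : 0 <= X w by rewrite -lee_fin -counting_fin counting_ge0.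
have XE := integral_num_points r0; rewrite -/X in XE.
have i1 : P.-integrable setT (EFin \o X).
  apply/integrableP; split; first exact/measurable_EFinP.
  rewrite (_ : (\int[P]_w _)%E = (2 * r)%:E) ?ltry// -XE; apply: eq_integral => w _.
  by rewrite /= ger0_norm.
have i2 : P.-integrable setT (EFin \o (fun w => X w ^+ 2)).
  apply/integrableP; split; first by apply/measurable_EFinP; exact: measurable_funX.
  rewrite (_ : (\int[P]_w _)%E = s%:E) ?ltry// -sE; apply: eq_integral => w _.
  by rewrite /= ger0_norm// exprn_ge0.
have i3 : P.-integrable setT (EFin \o (fun w => - (4 * r) * X w)).
  exact: integrableZ_R.
have i4 : P.-integrable setT (EFin \o (fun _ : T => (2 * r) ^+ 2)).
  exact: finite_measure_integrable_cst.
have i5 := integrableD_R measurableT i3 i4.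
have i6 := integrableD_R measurableT i2 i5.
transitivity (\int[P]_w (X w ^+ 2 + (- (4 * r) * X w + (2 * r) ^+ 2))%:E)%E.
  have EX : ('E_P[X] = (2 * r)%:E)%E by rewrite unlock.
  rewrite /variance unlock EX unlock; apply: eq_integral => w _; congr EFin => /=.
  rewrite [LHS](_ : _ = (X w - 2 * r) * (X w - 2 * r))//; ring.
rewrite -[LHS]fineK; last exact: integrable_fin_num.
congr EFin; rewrite -/(Rintegral _ _ _) RintegralD// RintegralD// RintegralZl// Rintegral_cst//=.
rewrite [X in fine X]probability_setT /Rintegral sE XE/=; ring.
Qed.

Lemma overlap_ge0 (L : R) n : 0 <= overlap h L n.
Proof. by apply: Rintegral_ge0 => y _; exact: tent_ge0. Qed.

Lemma num_points_second_moment_le (r c : R) : 0 <= r ->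
  (forall N, symsum (overlap h (2 * r)) N <= c) ->
  (\int[P]_w (num_points xi `[(- r)%R, r] w ^+ 2)%:E <= c%:E)%E.
Proof.
move=> r0 H; rewrite num_points_second_moment//.
have p0 k : (0 <= (pairsum (overlap h (2 * r)) k)%:E)%E.
  by rewrite lee_fin; apply: pairsum_ge0; exact: overlap_ge0.
apply: lime_le; first by apply: is_cvg_nneseries => k _ _; exact: p0.
apply: nearW => N; rewrite sumEFin lee_fin big_mkord.
apply: le_trans (H N); rewrite symsumE big_ord_recr/= lerDl -lee_fin; exact: p0.
Qed.

Lemma num_points_second_moment_ge (r : R) N : 0 <= r ->
  ((symsum (overlap h (2 * r)) N)%:E <= \int[P]_w (num_points xi `[(- r)%R, r] w ^+ 2)%:E)%E.
Proof.
move=> r0; rewrite num_points_second_moment// symsumE -(big_mkord xpredT (pairsum _)) -sumEFin.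
apply: (@nneseries_lim_ge R (fun k => (pairsum (overlap h (2 * r)) k)%:E) xpredT 0 N.+1).
by move=> k _ _; rewrite lee_fin; apply: pairsum_ge0; exact: overlap_ge0.
Qed.

Lemma cvg_powRN (p : R) : 0 < p -> r `^ (- p) @[r --> +oo%R] --> (0 : R).
Proof.
move=> p0; apply/cvgr0Pnorm_le => e e0; near=> r.
have r0 : 0 < r by near: r; exact: nbhs_pinfty_gt.
rewrite ger0_norm ?powR_ge0// powRN -[leRHS]invrK lef_pV2 ?posrE ?powR_gt0 ?invr_gt0//.
have <- : (e^-1 `^ p^-1) `^ p = e^-1.
  by rewrite -powRrM mulVf ?gt_eqF// powRr1// invr_ge0 ltW.
apply: ge0_ler_powR; rewrite ?nnegrE ?powR_ge0 ?(ltW p0) ?(ltW r0)//.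
Unshelve. all: by end_near. Qed.

(** The variance is at most [2 (4 r)^(2h) + K] for all [h], which is [o(r)] when [h < 1/2], and at
    least [2 c r - K'] for large [r] when [h >= 1/2]. *)
Lemma hyperuniform_iff : hyperuniform P xi <-> h < 2^-1.
Proof.
have [K HK] := symsum_overlap_le h0 h1.
have VE (r : R) : 0 <= r -> exists2 s,
    (\int[P]_w (num_points xi `[(- r)%R, r] w ^+ 2)%:E = s%:E)%E &
    s <= (2 * r) ^+ 2 + 2 * (2 * (2 * r)) `^ h ^+ 2 + K.
  move=> r0; have L0 : 0 <= 2 * r by exact: mulr_ge0.
  have := num_points_second_moment_le r0 (fun N => HK _ N L0).
  have : (0 <= \int[P]_w (num_points xi `[(- r)%R, r] w ^+ 2)%:E)%E.
    by apply: integral_ge0 => w _; rewrite lee_fin sqr_ge0.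
  case: (integral _ _ _) => [s||]//; rewrite lee_fin => _ H; by exists s.
split=> [hyp|h2].
  rewrite ltNge; apply/negP => h2.
  have [c [K' [L0 [c0 L00 H]]]] := symsum_overlap_ge h0 h1 h2.
  (* The quotient [(2 c r - K') / (2 r)] stays above [c / 2] as soon as [r > K' / c]. *)
  have c20 : (0 < (c / 2)%:E)%E by rewrite lte_fin divr_gt0.
  have nb : nbhs (0%E : \bar R) [set y | (y < (c / 2)%:E)%E].
    by apply: open_nbhs_nbhs; split => //; exact: open_ereal_lt_ereal.
  have : \forall r \near +oo%R, ('V_P[num_points xi `[(- r)%R, r]] * ((2 * r)^-1)%:E < (c / 2)%:E)%E.
    exact: hyp nb.
  suff : \forall r \near +oo%R, ((c / 2)%:E <= 'V_P[num_points xi `[(- r)%R, r]] * ((2 * r)^-1)%:E)%E.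
    move=> A1 A2; have [r [B1 B2]] := filter_ex (filterI A1 A2).
    by move: B2; rewrite ltNge B1.
  near=> r.
  have r0 : 0 < r by near: r; exact: nbhs_pinfty_gt.
  have rL : L0 < r by near: r; apply: nbhs_pinfty_gt; exact: num_real.
  have rK : K' / c < r by near: r; apply: nbhs_pinfty_gt; exact: num_real.
  have [s sE _] := VE _ (ltW r0); rewrite (num_points_variance (ltW r0) sE).
  have [N HN] := H (2 * r) ltac:(lra).
  have := num_points_second_moment_ge N (ltW r0); rewrite sE lee_fin => HS.
  rewrite -EFinM lee_fin ler_pdivlMr ?mulr_gt0//.
  by move: rK; rewrite ltr_pdivrMr//; lra.
have p0 : 0 < 1 - 2 * h by lra.
(* The upper bound of the variance divided by [2 r], with the powers of [r] gathered so that both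
   exponents are negative. *)
pose bound (r : R) := 2 * 4 `^ (2 * h) / 2 * r `^ (- (1 - 2 * h)) + K / 2 * r `^ (- 1).
apply: (@squeeze_cvge _ _ _ _ (fun _ => 0%E) _ (fun r => (bound r)%:E)).
- near=> r.
  have r0 : 0 < r by near: r; exact: nbhs_pinfty_gt.
  rewrite mule_ge0 ?variance_ge0 ?lee_fin ?invr_ge0 ?mulr_ge0 ?(ltW r0)//=.
  have [s sE sle] := VE _ (ltW r0); rewrite (num_points_variance (ltW r0) sE).
  rewrite -EFinM lee_fin ler_pdivrMr ?mulr_gt0//.
  have -> : bound r * (2 * r) = 2 * (2 * (2 * r)) `^ h ^+ 2 + K; last by lra.
  rewrite -(powR_mulrn _ (powR_ge0 _ _)) -powRrM.
  have -> : 2 * (2 * r) = 4 * r by ring.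
  rewrite powRM ?(ltW r0)//.
  have rV : r `^ (- 1) = r^-1 by rewrite powRN powRr1// ltW.
  rewrite /bound mulrDl rV.
  have -> : r `^ (h * 2%:R) = r `^ (- (1 - 2 * h)) * r.
    rewrite -{3}[r]powRr1 ?(ltW r0)// -powRD ?(gt_eqF r0) ?implybT//.
    by congr (_ `^ _); lra.
  rewrite [h * _]mulrC; have r1 := lt0r_neq0 r0; field; exact: r1.
- exact: cvg_cst.
- apply: cvg_EFin; first by apply: nearW.
  have : bound r @[r --> +oo%R] --> 2 * 4 `^ (2 * h) / 2 * 0 + K / 2 * 0.
    by apply: cvgD; (apply: cvgM; [exact: cvg_cst|exact: cvg_powRN]).
  by rewrite !mulr0 addr0.
Unshelve. all: by end_near. Qed.

End number_variance.

Theorem proposition1p3 (R : realType) (h : R) (h0 : 0 < h) (h1 : h < 1)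
    (d' : measure_display) (T' : measurableType d') (Q : probability T' R)
    (B : R -> T' -> R) (fbmB : fractional_brownian_motion Q h B)
    (d : measure_display) (T : measurableType d) (P : probability T R)
    (xi : T -> config R) (ppxi : point_process xi) (stxi : stationary P xi)
    (intxi : intensity P xi = 1%E)
    (palmxi : is_palm P xi Q (perturbed_integers B)) :
  [/\ is_structure_factor P xi Q (perturbed_integers B)
        (fbm_structure_factor h),
      (fbm_structure_factor h : R -> R^o) ~_(0^')
        (fun t : R => alpha h * `|t| `^ (1 - 2 * h) : R^o) &
      hyperuniform P xi <-> h < 2^-1].
Proof.
split.
- exact (fbm_is_structure_factor h0 h1 fbmB intxi palmxi).
- exact (structure_factor_equiv h0 h1).
- exact (hyperuniform_iff h0 h1 fbmB ppxi intxi palmxi).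
Qed.
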